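(* Let $N<0$, $\lambda_\sharp<\lambda_\flat$, and assume the arc hypothesis ($\mathrm H_{\mathrm{arc}}$). (i) If $n=p$, i.e. $\Lambda^+=\varnothing$, then $K^{\rightarrow}\equiv0$ identically on the whole domain (the Riemann surface of the logarithm), and $K^{\uparrow}+K^{\downarrow}=K^{\leftarrow}$. (ii) If $m=q$, i.e. $\Lambda^-=\varnothing$, then $K^{\leftarrow}\equiv0$ identically, and $K^{\uparrow}+K^{\downarrow}=K^{\rightarrow}$.
   Context: For $\tau>0$, $G(z;\tau)$ is the Barnes double gamma function: the entire function $G(z;\tau)=\frac{z}{\tau}e^{c_1 z/\tau+c_2 z^2/(2\tau^2)}\prod_{(k,l)\in\mathbb{Z}_{\ge0}^2\setminus\{(0,0)\}}\big(1+\frac{z}{k\tau+l}\big)e^{-\frac{z}{k\tau+l}+\frac{z^2}{2(k\tau+l)^2}}$, with real constants $c_1,c_2$ (depending on $\tau$) uniquely determined by $G(z+1;\tau)=\Gamma(z/\tau)G(z;\tau)$ and $G(z+\tau;\tau)=(2\pi)^{(\tau-1)/2}\tau^{1/2-z}\Gamma(z)G(z;\tau)$. $S_2(z;\tau)=(2\pi)^{\frac{1+\tau}{2}-z}G(z;\tau)/G(1+\tau-z;\tau)$. Let $\tau>0$, $0\le m\le q$, $0\le n\le p$ integers, $\mathbf a\in\mathbb{C}^p$, $\mathbf b\in\mathbb{C}^q$, $\alpha\in\mathbb{C}$. Put $$\mathcal G(s)=\frac{\prod_{j=1}^{m}G(b_j-s;\tau)\prod_{j=1}^{n}G(1+\tau-a_j+s;\tau)}{\prod_{j=m+1}^{q}G(1+\tau-b_j+s;\tau)\prod_{j=n+1}^{p}G(a_j-s;\tau)},\quad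 \phi(s)=\mathcal G(s)e^{\pi\alpha s^2/\tau},\quad N=2(m+n)-p-q,$$ $\Lambda^+=\{a_j+l\tau+k: n<j\le p,\ l,k\in\mathbb{Z}_{\ge0}\}$, $\Lambda^-=\{b_j-l\tau-k: m<j\le q,\ l,k\in\mathbb{Z}_{\ge1}\}$, $\lambda_\sharp=\max_{m<j\le q}\operatorname{Re}b_j-\tau-1$ ($-\infty$ if $m=q$), $\lambda_\flat=\min_{n<j\le p}\operatorname{Re}a_j$ ($+\infty$ if $n=p$). $z$ is on the Riemann surface of the logarithm, $z^{-s}=e^{-s\log z}$. $L_{\theta^-,\theta^+}$ denotes a simple, piecewise smooth, proper curve in $\mathbb{C}\setminus(\Lambda^+\cup\Lambda^-)$ that outside some disc coincides with two straight rays of angles $\theta^-\in(-\pi,0)$, $\theta^+\in(0,\pi)$, is traversed from the $\theta^-$ end to the $\theta^+$ end, and has $\Lambda^+$ in the component of its complement containing the large positive reals and $\Lambda^-$ in the other. For $\varepsilon\in(0,\pi/4)$, $K^{\rightarrow},K^{\leftarrow},K^{\uparrow},K^{\downarrow}$ are $\frac{1}{2\pi i}\int_\gamma\phi(s)z^{-s}ds$ with $\gamma=L_{-\varepsilon,\varepsilon}$, $L_{-\pi+\varepsilon,\pi-\varepsilon}$, $L_{-\varepsilon,\pi-\varepsilon}$, $L_{-\pi+\varepsilon,\varepsilon}$ respectively (for $N<0$ absolutely convergent and independent of the choices). Let $\Pi(s)=\prod_{j\le m}S_2(b_j-s;\tau)/\prod_{n<j\le p}S_2(a_j-s;\tau)$,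 $\log^+x=\max\{\log x,0\}$. ($\mathrm H_{\mathrm{arc}}$) means that at least one of the following holds. ($\mathrm H^{\sup}_{\mathrm{arc}}$): there are $\varepsilon_1\in(0,\pi/4)$ and $R_1<R_2<\cdots\to\infty$ with $\sup\{\log^+|\Pi(R_je^{i\theta})|:|\theta|\le\varepsilon_1\text{ or }|\theta-\pi|\le\varepsilon_1\}=o(R_j^2\ln R_j)$. ($\mathrm H^{\mathrm{int}}_{\mathrm{arc}}$): there is $\varepsilon_1\in(0,\pi/4)$ such that, with $M(r)=\int_{|\theta|\le\varepsilon_1}|\Pi(re^{i\theta})|d\theta+\int_{|\theta-\pi|\le\varepsilon_1}|\Pi(re^{i\theta})|d\theta$, $\log^+(\int_R^{2R}M(r)dr)=o(R^2\ln R)$ as $R\to\infty$. *)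

(* Defs.v *)
From mathcomp Require Import all_boot all_order all_algebra.
From mathcomp Require Import all_classical all_reals all_analysis.
From mathcomp Require Import complex.

Set Implicit Arguments.
Unset Strict Implicit.
Unset Printing Implicit Defensive.

Import Order.TTheory GRing.Theory Num.Theory.
Import numFieldNormedType.Exports.

Local Open Scope classical_set_scope.
Local Open Scope complex_scope.
Local Open Scope ring_scope.

(* The topology of the complex plane is found on the regular-algebra alias
   R[i]^o; R[i] itself carries only the algebraic structures. *)

Section Special_functions.
Context {R : realType}.
Implicit Types (z w : R[i]) (tau r th x : R).

Definition cexp z : R[i] :=
  (expR (complex.Re z) * cos (complex.Im z)) +i*
  (expR (complex.Re z) * sin (complex.Im z)).

(* [x ^ w] for a real base x > 0 *)
Definition cpow x w : R[i] := cexp (w * (ln x)%:C).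

(* modulus, as an element of R *)
Definition cabs z : R := complex.Re `|z|.

(* the point r e^{i th} *)
Definition polar r th : R[i] := (r * cos th) +i* (r * sin th).

Definition clim (u : nat -> R[i]) : R[i] := lim ((u : nat -> R[i]^o) @ \oo).

(* Euler's limit; the value at the poles 0, -1, -2, ... is meaningless. *)
Definition cgamma z : R[i] :=
  clim (fun k => k`!%:R * cexp (z * (ln k%:R)%:C)
                 / \prod_(j < k.+1) (z + j%:R)).

Definition barnes_factor tau z (k l : nat) : R[i] :=
  let w := (k%:R * tau + l%:R)%:C in
  (1 + z / w) * cexp (- (z / w) + z ^+ 2 / (2 * w ^+ 2)).

(* The absolutely convergent double product is taken along squares. *)
Definition barnes_product tau (c1 c2 : R) z : R[i] :=
  z / tau%:C
  * cexp (c1%:C * z / tau%:C + c2%:C * z ^+ 2 / (2 * tau%:C ^+ 2))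
  * clim (fun K => \prod_(k < K) \prod_(l < K | (0 < k + l)%N)
                     barnes_factor tau z k l).

Definition gamma_pole z : Prop := exists k : nat, z = - k%:R.

(* G is the function G(.; tau). *)
Definition is_double_gamma tau (G : R[i] -> R[i]) : Prop :=
  exists c1 c2 : R,
    [/\ forall z, G z = barnes_product tau c1 c2 z,
        forall z, ~ gamma_pole (z / tau%:C) ->
          G (z + 1) = cgamma (z / tau%:C) * G z
      & forall z, ~ gamma_pole z ->
          G (z + tau%:C) = cpow (2 * pi) ((tau - 1) / 2)%:C
                           * cpow tau (2^-1 - z) * cgamma z * G z].

Definition double_sine tau (G : R[i] -> R[i]) z : R[i] :=
  cpow (2 * pi) (((1 + tau) / 2)%:C - z) * G z / G (1 + tau%:C - z).

End Special_functions.

(* Indices are shifted by one: the paper's j <= m is (j < m)%N here, and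
   m < j is (m <= j)%N. *)
Section Fox_type_data.
Context {R : realType}.
Variables (tau : R) (m n p q : nat).
Variables (a : 'I_p -> R[i]) (b : 'I_q -> R[i]).

Definition fox_index : int := 2 * (m%:Z + n%:Z) - p%:Z - q%:Z.

Definition Lambda_plus : set R[i] :=
  [set s | exists j : 'I_p, exists l k : nat,
     (n <= j)%N /\ s = a j + (l%:R * tau + k%:R)%:C].

Definition Lambda_minus : set R[i] :=
  [set s | exists j : 'I_q, exists l k : nat,
     [/\ (m <= j)%N, (0 < l)%N, (0 < k)%N
       & s = b j - (l%:R * tau + k%:R)%:C]].

Definition lambda_sharp : \bar R :=
  (\big[maxe/-oo]_(j < q | (m <= j)%N) (complex.Re (b j))%:E
     - tau%:E - 1)%E.

Definition lambda_flat : \bar R :=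
  (\big[mine/+oo]_(j < p | (n <= j)%N) (complex.Re (a j))%:E)%E.

Variables (G : R[i] -> R[i]) (alpha : R[i]).

Definition calG (s : R[i]) : R[i] :=
  ((\prod_(j < q | (j < m)%N) G (b j - s))
   * \prod_(j < p | (j < n)%N) G (1 + tau%:C - a j + s))
  / ((\prod_(j < q | (m <= j)%N) G (1 + tau%:C - b j + s))
     * \prod_(j < p | (n <= j)%N) G (a j - s)).

Definition phi (s : R[i]) : R[i] :=
  calG s * cexp (pi%:C * alpha * s ^+ 2 / tau%:C).

Definition sine_quotient (s : R[i]) : R[i] :=
  (\prod_(j < q | (j < m)%N) double_sine tau G (b j - s))
  / \prod_(j < p | (n <= j)%N) double_sine tau G (a j - s).

End Fox_type_data.

Section Curves.
Context {R : realType}.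
Implicit Types (gam : R -> R[i]) (f : R[i] -> R[i]) (t x : R).

Definition piecewise_C1 (g : R -> R) : Prop :=
  exists breaks : seq R,
    (forall t, t \notin breaks ->
       derivable g t 1 /\ {for t, continuous g^`()%classic}) /\
    (forall t, t \in breaks ->
       cvg (g^`()%classic x @[x --> t^'-]) /\ cvg (g^`()%classic x @[x --> t^'+])).

(* gam parametrizes a curve L_{thm, thp} for the pair of sets Lp, Lm.  The
   parameter is normalized to be arc length along the two rays, which makes
   gam proper.  Since thm is in (-pi, 0) and thp in (0, pi), the component of
   the complement other than the one of the large positive reals is the one
   of the negative reals of large modulus. *)
Definition admissible_curve (Lp Lm : set R[i]) (thm thp : R) gam : Prop :=
  [/\ [/\ continuous (gam : R -> R[i]^o), injective gam,
          piecewise_C1 (@complex.Re R \o gam)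
        & piecewise_C1 (@complex.Im R \o gam)],
      (exists c : R[i], \forall t \near -oo, gam t = c + polar (- t) thm),
      (exists c : R[i], \forall t \near +oo, gam t = c + polar t thp),
      range gam `<=` ~` (Lp `|` Lm)
    & (\forall x \near +oo,
         Lp `<=` connected_component (~` range gam : set R[i]^o) x%:C) /\
      (\forall x \near -oo,
         Lm `<=` connected_component (~` range gam : set R[i]^o) x%:C)].

Definition curve_deriv gam t : R[i] :=
  (@complex.Re R \o gam)^`()%classic t +i* (@complex.Im R \o gam)^`()%classic t.

(* The line integral of f along gam converges absolutely, with value v. *)
Definition is_line_integral f gam (v : R[i]) : Prop :=
  let g t := f (gam t) * curve_deriv gam t in
  let mu := @lebesgue_measure R in
  [/\ mu.-integrable setT (fun t => (complex.Re (g t))%:E),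
      mu.-integrable setT (fun t => (complex.Im (g t))%:E)
    & v = (\int[mu]_t complex.Re (g t)) +i* (\int[mu]_t complex.Im (g t))].

Inductive direction := Rightward | Leftward | Upward | Downward.

Definition angle_start (d : direction) (eps : R) : R :=
  match d with
  | Rightward | Upward => - eps
  | Leftward | Downward => - pi + eps
  end.

Definition angle_end (d : direction) (eps : R) : R :=
  match d with
  | Rightward | Downward => eps
  | Leftward | Upward => pi - eps
  end.

(* The integral defining K in direction d, at the point z of the Riemann
   surface of the logarithm with log z = logz, is well defined (curves exist,
   the integral converges absolutely and does not depend on the choices of
   eps and of the curve) and has value v. *)
Definition is_K (tau : R) (m n p q : nat)
    (a : 'I_p -> R[i]) (b : 'I_q -> R[i]) (G : R[i] -> R[i]) (alpha : R[i])
    (d : direction) (logz v : R[i]) : Prop :=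
  forall eps : R, 0 < eps < pi / 4 ->
    let adm := admissible_curve (Lambda_plus tau n a) (Lambda_minus tau m b)
                 (angle_start d eps) (angle_end d eps) in
    (exists gam, adm gam) /\
    (forall gam, adm gam -> exists2 v0,
       is_line_integral
         (fun s => phi tau m n a b G alpha s * cexp (- s * logz)) gam v0
       & v = v0 / (0 +i* (2 * pi))).

End Curves.

Section Arc_hypothesis.
Context {R : realType}.
Variable F : R[i] -> R[i].

Definition logplus (x : \bar R) : \bar R := maxe (lne x) 0%E.

(* F is sine_quotient below.  Where a denominator vanishes, F takes the value
   0: this changes neither the suprema (F is meromorphic, so these points are
   isolated) nor the Lebesgue integrals. *)
Definition arc_sup : Prop :=
  exists2 eps1 : R, 0 < eps1 < pi / 4 &
  exists Rad : nat -> R,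
    [/\ (forall j, Rad j < Rad j.+1), Rad @ \oo --> +oo
      & forall e : R, 0 < e -> \forall j \near \oo,
          (ereal_sup [set logplus (cabs (F (polar (Rad j) th)))%:E
                     | th in [set th | `|th| <= eps1 \/ `|th - pi| <= eps1]%R]
           <= (e * (Rad j ^+ 2 * ln (Rad j)))%:E)%E].

Definition arc_mean (eps1 r : R) : \bar R :=
  (\int[lebesgue_measure]_(th in [set th | `|th| <= eps1]%R)
      (cabs (F (polar r th)))%:E
   + \int[lebesgue_measure]_(th in [set th | `|th - pi| <= eps1]%R)
      (cabs (F (polar r th)))%:E)%E.

Definition arc_int : Prop :=
  exists2 eps1 : R, 0 < eps1 < pi / 4 &
  forall e : R, 0 < e -> \forall r \near +oo,
    (logplus (\int[lebesgue_measure]_(x in `[r, (2 * r)%R]) arc_mean eps1 x)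
     <= (e * (r ^+ 2 * ln r))%:E)%E.

Definition arc_hypothesis : Prop := arc_sup \/ arc_int.

End Arc_hypothesis.

(* Main.v *)
(** The integrand f is a limit, uniform on every bounded set that stays away
from its poles, of products of Barnes factors, so it is a uniform limit of
polynomials on any bounded set K on which all the functions 1/(s - p), p a pole,
are.  Runge's pole pushing shows that this is the case when every pole can be
moved to infinity without meeting K.  The integral of f over a closed chain
with that property vanishes, because it vanishes for polynomials.

Comparing the factors of the product one by one gives, with A(r) the sum of
1/(2 w^2) over the periods w = k tau + l <= 8 r,
  log |G(z)| <= Re(z^2) A(r) + O(r^2),
and the same bound for - log |G(z)| with - Re(z^2) away from the negative real
axis.  As A is unbounded, f decays like exp(- c A(|s|) |s|^2) wherever
Re(s^2) >= c |s|^2, including the whole sector around the real half-axis which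
carries no pole.

A truncated curve of any of the four kinds is closed up by segments going through
a point sigma T of that half-axis.  The segments adjacent to the curve contribute
o(1); the other two depend only on the starting and the ending quadrant.  Hence
the integral depends on neither the curve nor the angle, the four limits are
related by Up + Down = Left + Right, and the one whose two segments lie in the
pole-free sector is 0. *)

Require Import Defs.
From mathcomp Require Import all_boot all_order all_algebra.
From mathcomp Require Import all_classical all_reals all_analysis.
From mathcomp Require Import complex measurable_realfun.
From mathcomp Require Import ring lra zify.
Import Order.TTheory GRing.Theory Num.Theory.
Import numFieldNormedType.Exports.
Local Open Scope classical_set_scope.
Local Open Scope complex_scope.
Local Open Scope ring_scope.
Set Implicit Arguments.
Unset Strict Implicit.
Unset Printing Implicit Defensive.

(** An admissible curve is known only through connected components of its complement, so the
    argument must not rest on homotopies or winding numbers. Polynomial approximation fits this: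
    polynomials have antiderivatives, and the possibility of pushing a pole to infinity is open and
    closed in the position of the pole. The hypotheses n = p and m = q leave poles on one side only.
    They escape towards - sigma * oo, whereas the chains are closed up through sigma T, so closing
    never blocks an escape. The number N is the exponent of the growth bound. Up to O(|s|^2), log
    |G(u + s)| and log |G(u - s)| have the same main term Re(s^2) A(|s|), because only the square of
    s enters it. With m + n factors G above and p + q - m - n below, the integrand is at most exp(N
    Re(s^2) A(|s|) + O(|s|^2)). The factors z^(-s) and exp(pi alpha s^2 / tau) are of size
    exp(O(|s|^2)); as A is unbounded and N < 0 they never compete, which is why the conclusion holds
    for every value of log z. *)

Notation re := (@complex.Re _).
Notation im := (@complex.Im _).

(** * Complex numbers *)

Section ComplexBasics.
Context {R : realType}.
Implicit Types (z w : R[i]) (x y r : R).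

Lemma complex_ext z w : re z = re w -> im z = im w -> z = w.
Proof. by case: z w => [a b] [c d] /= -> ->. Qed.

Lemma reD z w : re (z + w) = re z + re w. Proof. by case: z w => [? ?] []. Qed.
Lemma imD z w : im (z + w) = im z + im w. Proof. by case: z w => [? ?] []. Qed.
Lemma reN z : re (- z) = - re z. Proof. by case: z. Qed.
Lemma imN z : im (- z) = - im z. Proof. by case: z. Qed.
Lemma reM z w : re (z * w) = re z * re w - im z * im w.
Proof. by case: z w => [? ?] []. Qed.
Lemma imM z w : im (z * w) = re z * im w + im z * re w.
Proof. by case: z w => [? ?] []. Qed.
Lemma re0 : re (0 : R[i]) = 0. Proof. by []. Qed.
Lemma im0 : im (0 : R[i]) = 0. Proof. by []. Qed.
Lemma re1 : re (1 : R[i]) = 1. Proof. by []. Qed.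
Lemma im1 : im (1 : R[i]) = 0. Proof. by []. Qed.
Definition reimE := (reD, imD, reN, imN, reM, imM, re0, im0, re1, im1).

Lemma natC (n : nat) : n%:R = (n%:R)%:C :> R[i].
Proof. by rewrite rmorph_nat. Qed.

Lemma realCV x : (x^-1)%:C = (x%:C)^-1 :> R[i].
Proof. by rewrite fmorphV. Qed.

Lemma cabsC z : (cabs z)%:C = `|z|.
Proof. by rewrite /cabs normc_def. Qed.

Lemma cabsE z : cabs z = Num.sqrt (re z ^+ 2 + im z ^+ 2).
Proof. by rewrite /cabs normc_def. Qed.

Lemma cabs_sqr z : cabs z ^+ 2 = re z ^+ 2 + im z ^+ 2.
Proof. by rewrite cabsE sqr_sqrtr // addr_ge0 // sqr_ge0. Qed.

Lemma cabs_ge0 z : 0 <= cabs z.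
Proof. by rewrite cabsE sqrtr_ge0. Qed.

Lemma cabsM z w : cabs (z * w) = cabs z * cabs w.
Proof. by apply: complexI; rewrite rmorphM /= !cabsC normrM. Qed.

Lemma cabsD z w : cabs (z + w) <= cabs z + cabs w.
Proof. by rewrite -lecR rmorphD /= !cabsC ler_normD. Qed.

Lemma cabsN z : cabs (- z) = cabs z.
Proof. by apply: complexI; rewrite !cabsC normrN. Qed.

Lemma cabsB z w : cabs (z - w) = cabs (w - z).
Proof. by rewrite -opprB cabsN. Qed.

Lemma cabs_real x : cabs x%:C = `|x|.
Proof. by rewrite cabsE /= expr0n /= addr0 sqrtr_sqr. Qed.

Lemma cabs0 : cabs (0 : R[i]) = 0.
Proof. by rewrite -[0]/(0%:C) cabs_real normr0. Qed.

Lemma cabs1 : cabs (1 : R[i]) = 1.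
Proof. by rewrite -[1]/(1%:C) cabs_real normr1. Qed.

Lemma cabsV z : cabs z^-1 = (cabs z)^-1.
Proof. by apply: complexI; rewrite realCV !cabsC normfV. Qed.

Lemma cabsX z n : cabs (z ^+ n) = cabs z ^+ n.
Proof. by apply: complexI; rewrite rmorphXn /= !cabsC normrX. Qed.

Lemma cabs_eq0 z : (cabs z == 0) = (z == 0).
Proof. by rewrite -(inj_eq (@complexI R)) cabsC normr_eq0. Qed.

Lemma cabs_gt0 z : (0 < cabs z) = (z != 0).
Proof. by rewrite lt_def cabs_eq0 cabs_ge0 andbT. Qed.

Lemma cabs_re z : `|re z| <= cabs z.
Proof.
by rewrite -sqrtr_sqr cabsE ler_wsqrtr // lerDl sqr_ge0.
Qed.

Lemma cabs_im z : `|im z| <= cabs z.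
Proof.
by rewrite -sqrtr_sqr cabsE ler_wsqrtr // lerDr sqr_ge0.
Qed.

Lemma cabs_le z : cabs z <= `|re z| + `|im z|.
Proof.
rewrite -(ler_pXn2r (n := 2)) ?nnegrE ?cabs_ge0 ?addr_ge0 //.
rewrite cabs_sqr sqrrD !real_normK ?num_real // lerD2r lerDl.
by rewrite mulrn_wge0 // mulr_ge0.
Qed.

Lemma cabs_dist z w : cabs z - cabs w <= cabs (z - w).
Proof. by rewrite lerBlDr; apply: le_trans (cabsD _ _); rewrite subrK. Qed.

Lemma cabs_prod (I : Type) (r : seq I) (P : pred I) (F : I -> R[i]) :
  cabs (\prod_(i <- r | P i) F i) = \prod_(i <- r | P i) cabs (F i).
Proof. by apply: big_morph; [exact: cabsM|exact: cabs1]. Qed.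

Lemma cexpD z w : cexp (z + w) = cexp z * cexp w.
Proof.
rewrite /cexp; apply: complex_ext => /=; rewrite !reimE expRD ?cosD ?sinD; ring.
Qed.

Lemma cexp0 : cexp (0 : R[i]) = 1.
Proof. by rewrite /cexp /= expR0 cos0 sin0 mulr1 mulr0. Qed.

Lemma cexpN z : cexp (- z) = (cexp z)^-1.
Proof.
have h : cexp (- z) * cexp z = 1 by rewrite -cexpD addNr cexp0.
have h0 : cexp z != 0.
  by apply: contra_eqT h => /negPn/eqP ->; rewrite mulr0 eq_sym oner_eq0.
by rewrite -[LHS](mulfK h0) h mul1r.
Qed.

Lemma cabs_cexp z : cabs (cexp z) = expR (re z).
Proof.
rewrite cabsE /= !exprMn -mulrDr cos2Dsin2 mulr1 sqrtr_sqr ger0_norm //.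
Qed.

Lemma cexpX z n : cexp (z *+ n) = cexp z ^+ n.
Proof.
by elim: n => [|n ih]; rewrite ?mulr0n ?cexp0 ?expr0 // mulrS cexpD ih exprS.
Qed.

Lemma re_sqr z : re (z ^+ 2) = re z ^+ 2 - im z ^+ 2.
Proof. by rewrite expr2 reM !expr2. Qed.

Lemma polarE r x : polar r x = r%:C * polar 1 x :> R[i].
Proof. by apply: complex_ext; rewrite !reimE /=; ring. Qed.

Lemma cabs_polar1 x : cabs (polar 1 x : R[i]) = 1.
Proof. by rewrite cabsE /= !mul1r cos2Dsin2 sqrtr1. Qed.

Lemma nbhs_cabsP (z : R[i]^o) (A : set R[i]^o) :
  nbhs z A <-> exists2 d : R, 0 < d & forall w, cabs (w - z) < d -> A w.
Proof.
split=> [/nbhs_ballP[e e0 eA]|[d d0 dA]].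
- have e0' : 0 < e :> R[i] by exact: e0.
  have Ee : e = (re e)%:C.
    by apply: complex_ext => //=; apply/eqP; move: e0'; rewrite ltcE => /andP[].
  exists (re e); first by move: e0'; rewrite ltcE => /andP[].
  move=> w hw; apply: eA; rewrite -ball_normE /ball_ /=.
  by rewrite distrC -cabsC Ee ltcR.
- apply/nbhs_ballP; exists d%:C; first by rewrite /= ltcR.
  move=> w; rewrite -ball_normE /ball_ /= distrC -cabsC ltcR; exact: dA.
Qed.

Lemma cvg_cabsP (T : Type) (F : set_system T) (FF : Filter F) (f : T -> R[i]^o)
    (l : R[i]^o) :
  f @ F --> l <-> forall d : R, 0 < d -> \forall x \near F, cabs (f x - l) < d.
Proof.
split=> [fl d d0|h].
- by apply: (fl [set w | cabs (w - l) < d]); apply/nbhs_cabsP; exists d.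
- move=> A /nbhs_cabsP[d d0 dA]; rewrite nbhs_simpl /=.
  by apply: filterS (h d d0) => x /dA.
Qed.

Lemma clim_eq (u : nat -> R[i]) (l : R[i]) :
  (forall d : R, 0 < d -> exists N : nat, forall n, (N <= n)%N -> cabs (u n - l) < d) ->
  clim u = l.
Proof.
move=> h; apply: (@cvg_lim R[i]^o); first exact: norm_hausdorff.
apply/cvg_cabsP => d /h[N hN]; exists N => // n /= /hN; exact.
Qed.

End ComplexBasics.

(** * Derivatives of complex functions of a real variable *)

Section ComplexDerivative.
Context {R : realType}.
Implicit Types (g h : R -> R[i]) (t : R) (z w d : R[i]).

(** Differentiation coordinate by coordinate, as in [curve_deriv]. *)
Definition is_cder g t d :=
  is_derive t (1 : R) (fun u => re (g u)) (re d) /\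
  is_derive t (1 : R) (fun u => im (g u)) (im d).

Lemma is_cder_eq g t d d' : is_cder g t d -> d = d' -> is_cder g t d'.
Proof. by move=> ? <-. Qed.

Lemma is_cder_cst z t : is_cder (fun=> z) t 0.
Proof. by split; exact: is_derive_cst. Qed.

Lemma is_cderD g h t d e :
  is_cder g t d -> is_cder h t e -> is_cder (fun u => g u + h u) t (d + e).
Proof.
move=> [g1 g2] [h1 h2]; split.
- under eq_fun do rewrite reD.
  by rewrite reD; exact: is_deriveD.
- under eq_fun do rewrite imD.
  by rewrite imD; exact: is_deriveD.
Qed.

Lemma is_cderM g h t d e :
  is_cder g t d -> is_cder h t e ->
  is_cder (fun u => g u * h u) t (d * h t + g t * e).
Proof.
move=> [g1 g2] [h1 h2]; split.
- under eq_fun do rewrite reM.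
  apply: (is_derive_eq (is_deriveB (is_deriveM g1 h1) (is_deriveM g2 h2))).
  by rewrite /GRing.scale /= !reimE; ring.
- under eq_fun do rewrite imM.
  apply: (is_derive_eq (is_deriveD (is_deriveM g1 h2) (is_deriveM g2 h1))).
  by rewrite /GRing.scale /= !reimE; ring.
Qed.

Lemma is_cder_real t : is_cder (fun u => u%:C) t 1.
Proof. by split; [exact: is_derive_id|exact: is_derive_cst]. Qed.

Lemma is_cder_cexp g t d :
  is_cder g t d -> is_cder (fun u => cexp (g u)) t (d * cexp (g t)).
Proof.
move=> [g1 g2]; split; rewrite /cexp /=.
- apply: (is_derive_eq (is_deriveM (is_derive1_comp (is_derive_expR _) g1)
    (is_derive1_comp (is_derive_cos _) g2))).
  by rewrite /GRing.scale /= !reimE /=; ring.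
- apply: (is_derive_eq (is_deriveM (is_derive1_comp (is_derive_expR _) g1)
    (is_derive1_comp (is_derive_sin _) g2))).
  by rewrite /GRing.scale /= !reimE /=; ring.
Qed.

Lemma is_cder_horner (P : {poly R[i]}) g t d :
  is_cder g t d -> is_cder (fun u => P.[g u]) t (P^`().[g t] * d).
Proof.
move=> gd; elim/poly_ind: P => [|P c ih].
  under eq_fun do rewrite horner0.
  by rewrite deriv0 horner0 mul0r; exact: is_cder_cst.
under eq_fun do rewrite hornerMXaddC.
apply: is_cder_eq (is_cderD (is_cderM ih gd) (is_cder_cst c t)) _.
by rewrite derivMXaddC !hornerE; ring.
Qed.

(** The real mean value theorem is applied to each coordinate, with its own intermediate point;
    adding the two bounds costs the factor 2. *)
Lemma mean_value_le g (g' : R -> R[i]) (M : R) :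
  (forall t, is_cder g t (g' t)) -> (forall t, 0 <= t <= 1 -> cabs (g' t) <= M) ->
  cabs (g 1 - g 0) <= 2 * M.
Proof.
move=> gg' gM.
have H (f f' : R -> R) : (forall t, is_derive t (1 : R) f (f' t)) ->
    (forall t, 0 <= t <= 1 -> `|f' t| <= M) -> `|f 1 - f 0| <= M.
  move=> ff' fM.
  have cf : {within `[(0 : R), 1], continuous f}.
    apply: continuous_subspaceT => t; apply/differentiable_continuous.
    by apply/derivable1_diffP; have [] := ff' t.
  have [c c01 ->] := MVT_segment ler01 (fun t _ => ff' t) cf.
  by rewrite subr0 mulr1; apply: fM; move: c01; rewrite in_itv.
have h1 := H _ _ (fun t => (gg' t).1)
  (fun t ht => le_trans (cabs_re _) (gM t ht)).
have h2 := H _ _ (fun t => (gg' t).2)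
  (fun t ht => le_trans (cabs_im _) (gM t ht)).
by apply: le_trans (cabs_le _) _; rewrite !reimE; lra.
Qed.

Lemma is_cder_scale z t : is_cder (fun u => u%:C * z) t z.
Proof.
apply: is_cder_eq (is_cderM (is_cder_real t) (is_cder_cst z t)) _.
by rewrite mul1r mulr0 addr0.
Qed.

Lemma re_le_cabs z : re z <= cabs z.
Proof. exact: le_trans (ler_norm _) (cabs_re _). Qed.

(** The derivative of (1 + t z) exp(- t z) in t is - t z^2 exp(- t z). This estimate compares (1 + z
    / n)^n with exp z in [papprox_cexp]. *)
Lemma cexp_order2 z :
  cabs ((1 + z) * cexp (- z) - 1) <= 2 * (cabs z ^+ 2 * expR (cabs z)).
Proof.
pose g (t : R) := (1 + t%:C * z) * cexp (t%:C * - z).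
have := @mean_value_le g (fun t => - t%:C * z ^+ 2 * cexp (t%:C * - z))
  (cabs z ^+ 2 * expR (cabs z)).
rewrite /g !mul1r !mul0r cexp0 addr0 mulr1; apply.
- move=> t; apply: is_cder_eq (is_cderM (is_cderD (is_cder_cst 1 t) (is_cder_scale z t))
    (is_cder_cexp (is_cder_scale (- z) t))) _.
  by ring.
- move=> t /andP[t0 t1].
  rewrite 2!cabsM cabsX cabsN cabs_real cabs_cexp ger0_norm // -mulrA.
  rewrite -[leRHS]mul1r ler_pM ?mulr_ge0 ?exprn_ge0 ?cabs_ge0 ?expR_ge0 //.
  rewrite ler_wpM2l ?exprn_ge0 ?cabs_ge0 // ler_expR.
  apply: le_trans (re_le_cabs _) _.
  by rewrite cabsM cabsN cabs_real ger0_norm // ler_piMl ?cabs_ge0.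
Qed.

(* The derivative of (1 + t z) exp(- t z + t^2 z^2 / 2) in t is t^2 z^3 times
   the exponential: all lower-order terms cancel. *)
Lemma cexp_order3 z :
  cabs ((1 + z) * cexp (- z + z ^+ 2 / 2) - 1) <=
  2 * (cabs z ^+ 3 * expR (cabs z + cabs z ^+ 2)).
Proof.
pose g (t : R) := (1 + t%:C * z) * cexp (t%:C * - z + t%:C * t%:C * (z ^+ 2 / 2)).
have := @mean_value_le g (fun t => t%:C ^+ 2 * z ^+ 3 *
  cexp (t%:C * - z + t%:C * t%:C * (z ^+ 2 / 2)))
  (cabs z ^+ 3 * expR (cabs z + cabs z ^+ 2)).
rewrite /g !mul1r !mul0r add0r cexp0 addr0 mulr1; apply.
- move=> t; apply: is_cder_eq (is_cderM (is_cderD (is_cder_cst 1 t) (is_cder_scale z t))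
    (is_cder_cexp (is_cderD (is_cder_scale (- z) t)
      (is_cderM (is_cderM (is_cder_real t) (is_cder_real t))
         (is_cder_cst (z ^+ 2 / 2) t))))) _.
  by field.
- move=> t /andP[t0 t1].
  have tt : 0 <= t * t <= 1 by rewrite mulr_ge0 //= mulr_ile1.
  rewrite 2!cabsM !cabsX cabs_real cabs_cexp ger0_norm // -mulrA.
  rewrite -[leRHS]mul1r ler_pM ?mulr_ge0 ?exprn_ge0 ?cabs_ge0 ?expR_ge0 ?exprn_ile1 //.
  rewrite ler_wpM2l ?exprn_ge0 ?cabs_ge0 // ler_expR.
  apply: le_trans (re_le_cabs _) _; apply: le_trans (cabsD _ _) _.
  apply: lerD; first by rewrite cabsM cabs_real cabsN ger0_norm // ler_piMl ?cabs_ge0.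
  have /andP[tt0 tt1] := tt.
  rewrite -rmorphM cabsM cabs_real cabsM cabsV (ger0_norm tt0) cabsX natC cabs_real.
  rewrite (ger0_norm (ler0n _ 2)).
  have := exprn_ge0 2 (cabs_ge0 z); move: (cabs z ^+ 2) => x x0; nra.
Qed.

End ComplexDerivative.

(** * Uniform approximation by polynomials *)

Section PolynomialApproximation.
Context {R : realType}.
Implicit Types (K : set R[i]) (f g h : R[i] -> R[i]) (P : {poly R[i]}).

(** A substitute for holomorphy near K: on bounded sets it is stable under products, exponentials
    and uniform limits, and it makes integrals over closed chains vanish. *)
Definition papprox K f := forall e : R, 0 < e ->
  exists P, forall s, K s -> cabs (f s - P.[s]) <= e.

Lemma papprox_ext K f g : (forall s, K s -> f s = g s) -> papprox K f -> papprox K g.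
Proof. by move=> fg af e /af[P hP]; exists P => s Ks; rewrite -fg ?hP. Qed.

Lemma papprox_poly K P : papprox K (horner P).
Proof. by move=> e e0; exists P => s _; rewrite subrr cabs0 ltW. Qed.

Lemma papprox_cst K c : papprox K (fun=> c).
Proof. by apply: papprox_ext (papprox_poly K c%:P) => s _; rewrite hornerC. Qed.

Lemma papprox_id K : papprox K id.
Proof. by apply: papprox_ext (papprox_poly K 'X) => s _; rewrite hornerX. Qed.

Lemma papproxD K f g : papprox K f -> papprox K g -> papprox K (fun s => f s + g s).
Proof.
move=> af ag e e0; have e20 : 0 < e / 2 by rewrite divr_gt0.
have [P hP] := af _ e20; have [Q hQ] := ag _ e20; exists (P + Q) => s Ks.
rewrite hornerD opprD addrACA (le_trans (cabsD _ _)) //.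
by rewrite [leRHS](splitr e) lerD ?hP ?hQ.
Qed.

Lemma papprox_lim K f : (forall e : R, 0 < e ->
  exists2 g, papprox K g & forall s, K s -> cabs (f s - g s) <= e) -> papprox K f.
Proof.
move=> h e e0; have e20 : 0 < e / 2 by rewrite divr_gt0.
have [g ag fg] := h _ e20; have [P hP] := ag _ e20; exists P => s Ks.
rewrite -[f s](subrK (g s)) -addrA (le_trans (cabsD _ _)) //.
by rewrite [leRHS](splitr e) lerD ?hP ?fg.
Qed.

Definition cbounded K := exists M : R, forall s, K s -> cabs s <= M.

Section Bounded.
Variables (K : set R[i]) (bK : cbounded K).

Lemma poly_bounded P : exists2 M : R, 0 < M & forall s, K s -> cabs P.[s] <= M.
Proof.
have [B hB] := bK; elim/poly_ind: P => [|P c [M M0 hM]].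
  by exists 1 => // s _; rewrite horner0 cabs0.
exists (M * `|B| + cabs c + 1).
  by rewrite ltr_wpDl // addr_ge0 ?cabs_ge0 // mulr_ge0 // ltW.
move=> s Ks; rewrite hornerMXaddC (le_trans (cabsD _ _)) //.
rewrite -addrA lerD //; last by rewrite lerDl.
rewrite cabsM ler_pM ?cabs_ge0 ?hM //.
exact: le_trans (hB _ Ks) (ler_norm _).
Qed.

Lemma papprox_bounded f : papprox K f ->
  exists2 M : R, 0 < M & forall s, K s -> cabs (f s) <= M.
Proof.
move=> /(_ 1 ltr01)[P hP]; have [M M0 hM] := poly_bounded P.
exists (1 + M); first by rewrite addr_gt0.
move=> s Ks; rewrite -[f s](subrK P.[s]) (le_trans (cabsD _ _)) //.
by rewrite lerD ?hP ?hM.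
Qed.

Lemma papproxM f g : papprox K f -> papprox K g -> papprox K (fun s => f s * g s).
Proof.
move=> af ag; have [M M0 hM] := papprox_bounded af.
have [N N0 hN] := papprox_bounded ag.
apply: papprox_lim => e e0.
(* The 1 in the minimum keeps [P] below M + 1, so that the tolerance for [Q] can be fixed in
   advance. *)
have [P hP] := af (Num.min 1 (e / (2 * N))) ltac:(by rewrite lt_min ltr01 divr_gt0 ?mulr_gt0).
have [Q hQ] := ag (e / (2 * (M + 1))) ltac:(by rewrite divr_gt0 ?mulr_gt0 ?addr_gt0).
exists (horner (P * Q)); first exact: papprox_poly.
move=> s Ks; rewrite hornerM.
rewrite (_ : _ - _ = (f s - P.[s]) * g s + P.[s] * (g s - Q.[s])); last by ring.
rewrite (le_trans (cabsD _ _)) // !cabsM.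
have := hP s Ks; rewrite le_min => /andP[P1 P2].
have PM : cabs P.[s] <= M + 1.
  rewrite -[P.[s]](subrK (f s)) addrC (le_trans (cabsD _ _)) //.
  by rewrite lerD ?hM // cabsB.
rewrite [leRHS](splitr e) lerD //.
- have -> : e / 2 = e / (2 * N) * N by field; rewrite gt_eqF.
  by rewrite ler_pM ?cabs_ge0 ?hN.
- have -> : e / 2 = (M + 1) * (e / (2 * (M + 1))) by field; rewrite gt_eqF ?addr_gt0.
  by rewrite ler_pM ?cabs_ge0 ?hQ.
Qed.

Lemma papproxZ c f : papprox K f -> papprox K (fun s => c * f s).
Proof. exact: papproxM (papprox_cst K c). Qed.

Lemma papproxN f : papprox K f -> papprox K (fun s => - f s).
Proof.
by move=> /(papproxZ (-1)); apply: papprox_ext => s _; rewrite mulN1r.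
Qed.

Lemma papproxX f n : papprox K f -> papprox K (fun s => f s ^+ n).
Proof.
move=> af; elim: n => [|n ih].
  by apply: papprox_ext (papprox_cst K 1) => s _; rewrite expr0.
by apply: papprox_ext (papproxM af ih) => s _; rewrite exprS.
Qed.

Lemma papprox_sum (I : Type) (r : seq I) (p : pred I) (F : I -> R[i] -> R[i]) :
  (forall i, p i -> papprox K (F i)) -> papprox K (fun s => \sum_(i <- r | p i) F i s).
Proof.
move=> aF; elim: r => [|i r ih].
  by apply: papprox_ext (papprox_cst K 0) => s _; rewrite big_nil.
have [pi|pi] := boolP (p i).
  by apply: papprox_ext (papproxD (aF i pi) ih) => s _; rewrite big_cons pi.
by apply: papprox_ext ih => s _; rewrite big_cons (negbTE pi).
Qed.

Lemma papprox_prod (I : Type) (r : seq I) (p : pred I) (F : I -> R[i] -> R[i]) :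
  (forall i, p i -> papprox K (F i)) -> papprox K (fun s => \prod_(i <- r | p i) F i s).
Proof.
move=> aF; elim: r => [|i r ih].
  by apply: papprox_ext (papprox_cst K 1) => s _; rewrite big_nil.
have [pi|pi] := boolP (p i).
  by apply: papprox_ext (papproxM (aF i pi) ih) => s _; rewrite big_cons pi.
by apply: papprox_ext ih => s _; rewrite big_cons (negbTE pi).
Qed.

(** The n-th partial sum of the geometric series is off by h^n / (1 - h), at most 2 * 2^(-n) because
    |1 - h| >= 1/2. *)
Lemma papprox_geometric h : papprox K h -> (forall s, K s -> cabs (h s) <= 2^-1) ->
  papprox K (fun s => (1 - h s)^-1).
Proof.
move=> ah h2; apply: papprox_lim => e e0.
have [n hn] : exists n : nat, 2 * (2^-1) ^+ n <= e.
  exists (Num.bound (2 / e)).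
  have e2 : 0 <= 2 / e by rewrite divr_ge0 // ltW.
  rewrite exprVn ler_pdivrMr ?exprn_gt0 // mulrC -ler_pdivrMr //.
  apply: le_trans (ltW (archi_boundP e2)) _.
  by rewrite -natrX ler_nat ltnW // ltn_expl.
exists (fun s => \sum_(i < n) h s ^+ i); first by apply: papprox_sum => i _; exact: papproxX.
move=> s Ks; have hs := h2 s Ks.
have h1 : 2^-1 <= cabs (1 - h s).
  by have := cabs_dist 1 (h s); rewrite cabs1; lra.
have h0 : 1 - h s != 0 by rewrite -cabs_gt0; apply: lt_le_trans h1; rewrite invr_gt0.
have -> : (1 - h s)^-1 - \sum_(i < n) h s ^+ i = h s ^+ n / (1 - h s).
  apply: (mulfI h0); rewrite mulrBr mulfV // mulrCA mulfV // mulr1.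
  have -> : h s ^+ n = (h s - 1) * \sum_(i < n) h s ^+ i + 1 by rewrite -subrX1 subrK.
  by ring.
rewrite cabsM cabsX cabsV mulrC (le_trans _ hn) // ler_pM ?invr_ge0 ?exprn_ge0 ?cabs_ge0 //.
- by rewrite invf_ple ?posrE // (lt_le_trans _ h1) ?invr_gt0.
- by rewrite lerXn2r ?nnegrE ?cabs_ge0 ?invr_ge0.
Qed.

(** Write 1/(s - p) as 1/(s - p') times 1/(1 - (p - p')/(s - p')): a geometric series of ratio at
    most 1/2 when the step is at most half of d. *)
Lemma pole_pushing p p' (d : R) :
  papprox K (fun s => (s - p')^-1) -> 0 < d -> (forall s, K s -> d <= cabs (s - p')) ->
  cabs (p - p') <= d / 2 -> papprox K (fun s => (s - p)^-1).
Proof.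
move=> ap d0 dK pp'.
have hs s : K s -> s - p' != 0 by move=> /dK; rewrite -cabs_gt0; exact: lt_le_trans.
pose h s := (p - p') * (s - p')^-1.
have hh s : K s -> cabs (h s) <= 2^-1.
  move=> Ks; rewrite cabsM cabsV ler_pdivrMr ?cabs_gt0 ?hs //.
  by have := dK _ Ks; lra.
apply: papprox_ext (papproxM ap (papprox_geometric (papproxZ _ ap) hh)) => s Ks.
by rewrite /h -invfM mulrBr mulr1 mulrCA mulfV ?hs // mulr1 opprB addrA subrK.
Qed.

(** Here 1/(s - p) = - p^-1 / (1 - s/p) with |s/p| <= 1/2. *)
Lemma papprox_far_pole (M : R) p : (forall s, K s -> cabs s <= M) -> 0 < cabs p -> 2 * M <= cabs p ->
  papprox K (fun s => (s - p)^-1).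
Proof.
move=> hM p0 Mp; have p0' : p != 0 by rewrite -cabs_gt0.
have hh s : K s -> cabs (p^-1 * s) <= 2^-1.
  by move=> /hM hs; rewrite cabsM cabsV mulrC ler_pdivrMr //; lra.
have := papproxZ (- p^-1) (papprox_geometric (papproxZ p^-1 (papprox_id K)) hh).
apply: papprox_ext => s Ks.
by rewrite mulNr -invfM mulrBr mulr1 mulrA mulfV // mul1r -invrN opprB.
Qed.

End Bounded.
End PolynomialApproximation.

(** * Integration along piecewise smooth curves *)

Section PiecewiseFTC.
Context {R : realType}.
Local Notation mu := (@lebesgue_measure R).

(** At the break points [h] is arbitrary, since [curve_deriv] may be meaningless there; only its
    one-sided limits are constrained. *)
Definition piecewise_derivative (s : seq R) (a b : R) (H h : R -> R) :=
  [/\ continuous H,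
      forall t, a < t < b -> t \notin s -> is_derive t (1 : R) H (h t) /\ {for t, continuous h}
    & forall t, cvg (h x @[x --> t^'-]) /\ cvg (h x @[x --> t^'+])].

Lemma derivative_FTC (a b : R) (H h : R -> R) : a < b ->
  piecewise_derivative [::] a b H h ->
  [/\ mu.-integrable `[a, b] (EFin \o h),
      \int[mu]_(t in `[a, b]) h t = H b - H a
    & exists M : R, forall t, a <= t <= b -> `|h t| <= M].
Proof.
move=> ab [cH dH lh].
(* [k] is the continuous extension to [a, b] of the restriction of [h] to the open interval; [h]
   itself may jump at the ends. *)
pose k t := if t <= a then lim (h x @[x --> a^'+]) else
            if b <= t then lim (h x @[x --> b^'-]) else h t.
have kh t : a < t < b -> k t = h t.
  by rewrite /k => /andP[at' tb]; rewrite leNgt at' /= leNgt tb.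
have ck : {within `[a, b], continuous k}.
  apply/continuous_within_itvP => //; split.
  - move=> t; rewrite in_itv /= => tab.
    have [_ ht] := dH t tab isT.
    rewrite /prop_for /continuous_at (kh t tab).
    apply: cvg_trans ht; apply: near_eq_cvg.
    have tab' : t \in `]a, b[ by rewrite in_itv.
    by apply: filterS (near_in_itvoo tab') => u; rewrite in_itv => /= /kh.
  - have -> : k a = lim (h x @[x --> a^'+]) by rewrite /k lexx.
    apply: cvg_trans (lh a).2; apply: near_eq_cvg; near=> u.
    by apply/esym/kh; apply/andP; split; near: u; [exact: nbhs_right_gt|exact: nbhs_right_lt].
  - have -> : k b = lim (h x @[x --> b^'-]) by rewrite /k leNgt ab /= lexx.
    apply: cvg_trans (lh b).1; apply: near_eq_cvg; near=> u.
    by apply/esym/kh; apply/andP; split; near: u; [exact: nbhs_left_gt|exact: nbhs_left_lt].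
have ik : mu.-integrable `[a, b] (EFin \o k).
  by apply: continuous_compact_integrable => //; exact: segment_compact.
have Ek : \int[mu]_(t in `[a, b]) k t = H b - H a.
  rewrite /Rintegral (@continuous_FTC2 _ k H) //.
  - split.
    + by move=> t; rewrite in_itv /= => tab; have [] := (dH t tab isT).1.
    + exact/cvg_at_right_filter/cH.
    + exact/cvg_at_left_filter/cH.
  - move=> t; rewrite in_itv /= => tab; rewrite kh // derive1E.
    by have [] := (dH t tab isT).1.
have [M0 hM0] : exists M : R, forall t, a <= t <= b -> `|k t| <= M.
  have /compact_bounded[M [_ mrt]] := continuous_compact ck (@segment_compact _ a b).
  exists (`|M| + 1) => t tab; apply: mrt; first by rewrite ltr_pwDr // ler_norm.
  by exists t => //=; rewrite in_itv.
have bh : exists M : R, forall t, a <= t <= b -> `|h t| <= M.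
  exists (`|h a| + `|h b| + M0) => t /andP[at' tb].
  have M00 : 0 <= M0.
    by apply: le_trans (hM0 a _); rewrite ?normr_ge0 // lexx ltW.
  move: at'; rewrite le_eqVlt => /predU1P[<-|at'].
    by have := normr_ge0 (h b); lra.
  move: tb; rewrite le_eqVlt => /predU1P[->|tb].
    by have := normr_ge0 (h a); lra.
  have := hM0 t; rewrite (ltW at') (ltW tb) kh ?at' // => /(_ isT).
  by have := normr_ge0 (h a); have := normr_ge0 (h b); lra.
have eqkh : {in `]a, b[%classic, h =1 k}.
  by move=> t; rewrite inE /= in_itv /= => tab; rewrite kh.
have mh : measurable_fun `[a, b] h.
  apply: (@measurable_fun_itv_cc _ a b false true).
  apply: (@eq_measurable_fun _ _ _ _ _ k).
    by move=> t tab; rewrite eqkh.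
  have /measurable_int/measurable_EFinP := ik.
  by apply: measurable_funS => //; apply: subset_itv_oo_cc.
have ih : mu.-integrable `[a, b] (EFin \o h).
  apply: measurable_bounded_integrable => //.
  - by apply: compact_finite_measure; exact: segment_compact.
  - have [M hM] := bh; exists M; split; first exact: num_real.
    by move=> x Mx t /=; rewrite in_itv /= => /hM /le_trans; apply; exact: ltW.
split => //; rewrite -Ek.
have red (u : R -> R) : mu.-integrable `[a, b] (EFin \o u) ->
    \int[mu]_(t in `[a, b]) u t = \int[mu]_(t in `]a, b[) u t.
  move=> iu; rewrite -Rintegral_itv_bndo_bndc.
    rewrite -Rintegral_itv_obnd_cbnd //.
    by apply: integrableS iu => //; apply: subset_itv_oo_cc.
  by apply: integrableS iu => //; apply: subset_itv_co_cc.
by rewrite !red //; exact: eq_Rintegral.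
Unshelve. all: by end_near.
Qed.

(** Induction on the list of breaks: the interval is cut at the first one if that lies strictly
    inside, and otherwise the break is dropped. *)
Lemma piecewise_FTC (s : seq R) (a b : R) (H h : R -> R) : a <= b ->
  piecewise_derivative s a b H h ->
  [/\ mu.-integrable `[a, b] (EFin \o h),
      \int[mu]_(t in `[a, b]) h t = H b - H a
    & exists M : R, forall t, a <= t <= b -> `|h t| <= M].
Proof.
elim: s a b => [|x s ih] a b; rewrite le_eqVlt => /predU1P[<-|ab].
1,3: move=> _; rewrite set_itv1 Rintegral_set1 subrr; split => //;
  [|by exists `|h a| => t; rewrite -eq_le => /eqP <-].
1,2: apply: null_set_integrable => //; [exact: measurable_fun_set1|exact: lebesgue_measure_set1].
- exact: derivative_FTC.
- move=> [cH dH lh].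
  have [/andP[ax xb]|nx] := boolP (a < x < b).
  + have [|i1 e1 [M1 m1]] := ih a x (ltW ax).
      split => // t /andP[t1 t2] ts; apply: dH.
        by rewrite t1 (lt_trans t2 xb).
      by rewrite inE negb_or ts lt_eqF.
    have [|i2 e2 [M2 m2]] := ih x b (ltW xb).
      split => // t /andP[t1 t2] ts; apply: dH.
        by rewrite t2 (lt_trans ax t1).
      by rewrite inE negb_or ts gt_eqF.
    have U : `[a, b]%classic = `[a, x[%classic `|` `[x, b]%classic.
      by rewrite -itv_bndbnd_setU // bnd_simp ltW.
    have i1' : mu.-integrable `[a, x[ (EFin \o h).
      by apply: integrableS i1 => //; exact: subset_itv_co_cc.
    have bh : exists M : R, forall t, a <= t <= b -> `|h t| <= M.
      exists (Num.max M1 M2) => t /andP[at' tb]; rewrite le_max.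
      have [tx|xt] := leP t x; first by rewrite m1 ?at'.
      by rewrite m2 ?orbT // tb ltW.
    have ih' : mu.-integrable `[a, b] (EFin \o h).
      apply: measurable_bounded_integrable => //.
      - by apply: compact_finite_measure; exact: segment_compact.
      - rewrite U; apply/measurable_funU => //; split.
          by apply/measurable_EFinP; exact: (measurable_int mu i1').
        by apply/measurable_EFinP; exact: (measurable_int mu i2).
      - have [M hM] := bh; exists M; split; first exact: num_real.
        by move=> y My t /=; rewrite in_itv /= => /hM /le_trans; apply; exact: ltW.
    split => //; rewrite U Rintegral_setU // -?U //.
      by rewrite Rintegral_itv_bndo_bndc // e1 e2 addrC addrA subrK.
    apply/disj_setPS => t [] /=; rewrite !in_itv /= => /andP[_ tx] /andP[xt _].
    by move: tx; rewrite ltNge xt.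
  + apply: ih; first exact: ltW.
    split => // t tab ts; apply: dH => //.
    by rewrite inE negb_or ts andbT; apply: contraNneq nx => <-.
Qed.

End PiecewiseFTC.

(** * Line integrals of uniform limits of polynomials *)

Section LineIntegrals.
Context {R : realType}.
Local Notation mu := (@lebesgue_measure R).
Implicit Types (g gam dgam : R -> R[i]) (a b : R) (P F : {poly R[i]}).

Definition cint (D : set R) g : R[i] :=
  (\int[mu]_(t in D) re (g t)) +i* (\int[mu]_(t in D) im (g t)).

Definition cintegrable (D : set R) g :=
  mu.-integrable D (fun t => (re (g t))%:E) /\
  mu.-integrable D (fun t => (im (g t))%:E).

Definition cmeasurable (D : set R) g :=
  measurable_fun D (fun t => re (g t)) /\ measurable_fun D (fun t => im (g t)).

Definition cconv (Fi : set_system R) g (l : R[i]) :=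
  re (g t) @[t --> Fi] --> re l /\ im (g t) @[t --> Fi] --> im l.

Lemma cconvD (Fi : set_system R) {FF : Filter Fi} g h l k :
  cconv Fi g l -> cconv Fi h k -> cconv Fi (fun t => g t + h t) (l + k).
Proof.
move=> [g1 g2] [h1 h2]; split.
- by under eq_fun do rewrite reD; rewrite reD; exact: cvgD.
- by under eq_fun do rewrite imD; rewrite imD; exact: cvgD.
Qed.

Lemma cconvM (Fi : set_system R) {FF : Filter Fi} g h l k :
  cconv Fi g l -> cconv Fi h k -> cconv Fi (fun t => g t * h t) (l * k).
Proof.
move=> [g1 g2] [h1 h2]; split.
- by under eq_fun do rewrite reM; rewrite reM; apply: cvgB; exact: cvgM.
- by under eq_fun do rewrite imM; rewrite imM; apply: cvgD; exact: cvgM.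
Qed.

Lemma cconv_cst (Fi : set_system R) {FF : Filter Fi} l : cconv Fi (fun=> l) l.
Proof. by split; exact: cvg_cst. Qed.

Lemma cconv_horner (Fi : set_system R) {FF : Filter Fi} P g l :
  cconv Fi g l -> cconv Fi (fun t => P.[g t]) P.[l].
Proof.
move=> gl; elim/poly_ind: P => [|P c ih].
  by rewrite horner0; under eq_fun do rewrite horner0; exact: cconv_cst.
rewrite hornerMXaddC; under eq_fun do rewrite hornerMXaddC.
by apply: cconvD; [exact: cconvM|exact: cconv_cst].
Qed.

(** The speed [dgam] is a separate datum, so that segments (constant speed) and admissible curves
    ([curve_deriv]) are treated alike. *)
Definition piecewise_smooth gam dgam :=
  [/\ forall t, cconv (nbhs t) gam (gam t),
      exists s : seq R, forall t, t \notin s ->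
        is_cder gam t (dgam t) /\ cconv (nbhs t) dgam (dgam t)
    & forall t, (exists l, cconv (t^'-) dgam l) /\ (exists l, cconv (t^'+) dgam l)].

Lemma piecewise_derivative_horner gam dgam F : piecewise_smooth gam dgam ->
  exists s, forall a b,
    piecewise_derivative s a b (fun t => re F.[gam t]) (fun t => re (F^`().[gam t] * dgam t)) /\
    piecewise_derivative s a b (fun t => im F.[gam t]) (fun t => im (F^`().[gam t] * dgam t)).
Proof.
move=> [cg [s ds] lg]; exists s => a b.
have C t : cconv (nbhs t) (fun t => F.[gam t]) F.[gam t] by exact: cconv_horner.
have dC t : cconv (nbhs t) (fun t => F^`().[gam t]) F^`().[gam t] by exact: cconv_horner.
have D t : t \notin s -> is_cder (fun t => F.[gam t]) t (F^`().[gam t] * dgam t) /\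
    cconv (nbhs t) (fun t => F^`().[gam t] * dgam t) (F^`().[gam t] * dgam t).
  move=> /ds[d1 d2]; split; first exact: is_cder_horner.
  exact: cconvM.
have L t : (exists l, cconv (t^'-) (fun t => F^`().[gam t] * dgam t) l) /\
    (exists l, cconv (t^'+) (fun t => F^`().[gam t] * dgam t) l).
  have [[l1 h1] [l2 h2]] := lg t; have [c1 c2] := dC t.
  split; eexists; apply: cconvM; [|exact: h1| |exact: h2].
  - by split; apply: cvg_at_left_filter; [exact: c1|exact: c2].
  - by split; apply: cvg_at_right_filter; [exact: c1|exact: c2].
split; split.
- by move=> t; exact: (C t).1.
- by move=> t _ /D[[d1 _] [c1 _]].
- by move=> t; have [[l1 [h1 _]] [l2 [h2 _]]] := L t; split; apply/cvg_ex; eexists; [exact: h1|exact: h2].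
- by move=> t; exact: (C t).2.
- by move=> t _ /D[[_ d1] [_ c1]].
- by move=> t; have [[l1 [_ h1]] [l2 [_ h2]]] := L t; split; apply/cvg_ex; eexists; [exact: h1|exact: h2].
Qed.

Lemma cint_horner gam dgam F a b : piecewise_smooth gam dgam -> a <= b ->
  cintegrable `[a, b] (fun t => F^`().[gam t] * dgam t) /\
  cint `[a, b] (fun t => F^`().[gam t] * dgam t) = F.[gam b] - F.[gam a].
Proof.
move=> sg ab; have [s /(_ a b)[p1 p2]] := piecewise_derivative_horner F sg.
have [i1 e1 _] := piecewise_FTC ab p1; have [i2 e2 _] := piecewise_FTC ab p2.
split; first by split.
apply: complex_ext; rewrite !reimE /=.
  by rewrite -e1.
by rewrite -e2.
Qed.

Lemma curve_derivative_bounded gam dgam a b : piecewise_smooth gam dgam -> a <= b ->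
  exists2 M : R, 0 <= M & forall t, a <= t <= b -> cabs (dgam t) <= M.
Proof.
move=> sg ab; have [s /(_ a b)[p1 p2]] := piecewise_derivative_horner 'X sg.
have [_ _ [M1 h1]] := piecewise_FTC ab p1; have [_ _ [M2 h2]] := piecewise_FTC ab p2.
have aab : a <= a <= b by rewrite lexx.
exists (M1 + M2) => [|t tab].
  by rewrite addr_ge0 //; [apply: le_trans (h1 a aab)|apply: le_trans (h2 a aab)].
rewrite (le_trans (cabs_le _)) //; have := lerD (h1 t tab) (h2 t tab).
by rewrite derivX hornerC mul1r.
Qed.

Lemma poly_antiderivative P : exists F, F^`() = P.
Proof.
exists (\poly_(i < (size P).+1) (P`_i.-1 / i%:R)); apply/polyP => i.
rewrite coef_deriv coef_poly ltnS; case: ltnP => [_|/(nth_default 0) ->]; last by rewrite mul0rn.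
by rewrite -(mulr_natr (_ / _)) divfK // pnatr_eq0.
Qed.

Lemma cintegrable_bounded g a b M : a <= b -> cmeasurable `[a, b] g ->
  (forall t, a <= t <= b -> cabs (g t) <= M) -> cintegrable `[a, b] g.
Proof.
move=> ab [m1 m2] gM.
have H (h : R -> R) : measurable_fun `[a, b] h ->
    (forall t, a <= t <= b -> `|h t| <= M) -> mu.-integrable `[a, b] (EFin \o h).
  move=> mh hM; apply: measurable_bounded_integrable => //.
    by apply: compact_finite_measure; exact: segment_compact.
  exists M; split; first exact: num_real.
  by move=> y My t /=; rewrite in_itv /= => /hM /le_trans; apply; exact: ltW.
by split; apply: H => // t /gM; apply: le_trans; [exact: cabs_re|exact: cabs_im].
Qed.

Lemma cint_le g a b M : a <= b -> cintegrable `[a, b] g ->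
  (forall t, a <= t <= b -> cabs (g t) <= M) -> cabs (cint `[a, b] g) <= 2 * M * (b - a).
Proof.
move=> ab [i1 i2] gM.
have H (h : R -> R) : mu.-integrable `[a, b] (EFin \o h) ->
    (forall t, a <= t <= b -> `|h t| <= M) -> `|\int[mu]_(t in `[a, b]) h t| <= M * (b - a).
  move=> ih hM; apply: le_trans (le_normr_Rintegral _ ih) _ => //.
  have iM : mu.-integrable `[a, b] (EFin \o cst M).
    apply: continuous_compact_integrable; first exact: segment_compact.
    by apply: continuous_subspaceT => t; exact: cvg_cst.
  apply: (@le_trans _ _ (\int[mu]_(t in `[a, b]) cst M t)).
    by apply: le_Rintegral => //; exact: integrable_norm.
  have := lebesgue_measure_itv `[a, b]; rewrite Rintegral_cst //= lte_fin => ->.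
  case: ltP => [|ba]; first by rewrite -EFinD.
  by rewrite /= mulr0 mulr_ge0 ?subr_ge0 // (le_trans _ (hM a _)) ?lexx.
rewrite (le_trans (cabs_le _)) //= (_ : 2 * M * (b - a) = M * (b - a) + M * (b - a)); last by ring.
by rewrite lerD //; apply: H => // t /gM; apply: le_trans; [exact: cabs_re|exact: cabs_im].
Qed.

Lemma cintB (D : set R) g h : measurable D -> cintegrable D g -> cintegrable D h ->
  cint D (fun t => g t - h t) = cint D g - cint D h.
Proof.
move=> mD [g1 g2] [h1 h2]; apply: complex_ext; rewrite !reimE /=.
- by rewrite -RintegralB //; apply: eq_Rintegral => t _; rewrite !reimE.
- by rewrite -RintegralB //; apply: eq_Rintegral => t _; rewrite !reimE.
Qed.

Lemma cintegrableB (D : set R) g h : measurable D -> cintegrable D g -> cintegrable D h ->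
  cintegrable D (fun t => g t - h t).
Proof.
move=> mD [g1 g2] [h1 h2]; split.
- by under eq_fun do rewrite !reimE EFinB; exact: integrableB.
- by under eq_fun do rewrite !reimE EFinB; exact: integrableB.
Qed.

(** Measurability passes to the pointwise limit from the polynomial integrands, which are integrable
    by [cint_horner]. *)
Lemma cmeasurable_papprox K f gam dgam a b : piecewise_smooth gam dgam -> a <= b ->
  papprox K f -> (forall t, a <= t <= b -> K (gam t)) ->
  cmeasurable `[a, b] (fun t => f (gam t) * dgam t).
Proof.
move=> sg ab af Kg.
have e0 (n : nat) : 0 < (n.+1%:R^-1 : R) by rewrite invr_gt0.
pose P (n : nat) := projT1 (cid (af _ (e0 n))).
have hP (n : nat) s : K s -> cabs (f s - (P n).[s]) <= n.+1%:R^-1.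
  by rewrite /P; case: cid => Q /=; exact.
have mP n : cmeasurable `[a, b] (fun t => (P n).[gam t] * dgam t).
  have [F <-] := poly_antiderivative (P n).
  have [[i1 i2] _] := cint_horner F sg ab.
  by split; apply/measurable_EFinP; exact: (measurable_int mu).
have lim t : `[a, b]%classic t -> forall e : R, 0 < e -> \forall n \near \oo,
    cabs (f (gam t) * dgam t - (P n).[gam t] * dgam t) < e.
  rewrite /= in_itv /= => /Kg Kt e e_gt0.
  have h0 : 0 <= (cabs (dgam t) + 1) / e.
    by rewrite divr_ge0 ?addr_ge0 ?cabs_ge0 // ltW.
  exists (Num.bound ((cabs (dgam t) + 1) / e)) => // n /= hn.
  rewrite -mulrBl cabsM; apply: le_lt_trans (ler_pM _ _ (hP n _ Kt) (lexx _)) _; rewrite ?cabs_ge0 //.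
  rewrite mulrC ltr_pdivrMr // mulrC -ltr_pdivrMr //.
  apply: le_lt_trans (_ : (cabs (dgam t) + 1) / e < _).
    by rewrite ler_pM2r ?invr_gt0 // lerDl.
  apply: lt_le_trans (archi_boundP h0) _; rewrite ler_nat.
  exact: leq_trans hn (leqnSn _).
split.
- apply: (@measurable_fun_cvg _ _ _ _ (fun n t => re ((P n).[gam t] * dgam t))).
    by move=> n; exact: (mP n).1.
  move=> t tab; apply/cvgrPdist_lt => e e_gt0; apply: filterS (lim t tab e e_gt0) => n.
  by apply: le_lt_trans; rewrite -reN -reD; exact: cabs_re.
- apply: (@measurable_fun_cvg _ _ _ _ (fun n t => im ((P n).[gam t] * dgam t))).
    by move=> n; exact: (mP n).2.
  move=> t tab; apply/cvgrPdist_lt => e e_gt0; apply: filterS (lim t tab e e_gt0) => n.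
  by apply: le_lt_trans; rewrite -imN -imD; exact: cabs_im.
Qed.

Lemma cintegrable_papprox K f gam dgam a b : piecewise_smooth gam dgam -> a <= b ->
  cbounded K -> papprox K f -> (forall t, a <= t <= b -> K (gam t)) ->
  cintegrable `[a, b] (fun t => f (gam t) * dgam t).
Proof.
move=> sg ab bK af Kg.
have [M M0 hM] := papprox_bounded bK af.
have [M' M0' hM'] := curve_derivative_bounded sg ab.
apply: (@cintegrable_bounded _ _ _ (M * M')) => //; first exact: cmeasurable_papprox Kg.
by move=> t tab; rewrite cabsM ler_pM ?cabs_ge0 ?hM ?hM' //; exact: Kg.
Qed.

(** [C] is fixed before [e] and [F], and the main term is a difference of values of [F]: over a
    closed chain these differences telescope, while the errors vanish with [e]. *)
Lemma cint_papprox K f gam dgam a b : piecewise_smooth gam dgam -> a <= b ->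
  cbounded K -> papprox K f -> (forall t, a <= t <= b -> K (gam t)) ->
  exists2 C : R, 0 <= C & forall e F, 0 <= e -> (forall s, K s -> cabs (f s - F^`().[s]) <= e) ->
    cabs (cint `[a, b] (fun t => f (gam t) * dgam t) - (F.[gam b] - F.[gam a])) <= C * e.
Proof.
move=> sg ab bK af Kg.
have [M' M0' hM'] := curve_derivative_bounded sg ab.
exists (2 * M' * (b - a)); first by rewrite !mulr_ge0 ?subr_ge0.
move=> e F e0 hF; have [iF <-] := cint_horner F sg ab.
have ig := cintegrable_papprox sg ab bK af Kg.
rewrite -cintB //; apply: le_trans (cint_le ab (cintegrableB _ ig iF) _) _ => //.
  move=> t tab; rewrite -mulrBl cabsM; apply: ler_pM (hF _ (Kg _ tab)) (hM' _ tab); exact: cabs_ge0.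
by rewrite le_eqVlt; apply/orP; left; apply/eqP; ring.
Qed.

End LineIntegrals.

(** * Pole pushing *)

Section PolePushing.
Context {R : realType}.
Variables (sigma : R) (sigmaE : sigma = 1 \/ sigma = -1).
Variables (gam : R -> R[i]) (S : R -> set R[i]) (Lam : set R[i]) (B : R).
Hypothesis gam_cont : forall t, cconv (nbhs t) gam (gam t).
Hypothesis gam_far : forall X : R, exists T : R, forall t : R, T <= `|t| -> X <= `|im (gam t)|.
Hypothesis S_far : forall X : R, \forall T \near +oo, forall s, S T s ->
  X <= `|im s| \/ X <= sigma * re s.
Hypothesis S_bounded : forall T, cbounded (S T).
Hypothesis B_ge0 : 0 <= B.
Hypothesis Lam_strip : forall p, Lam p -> `|im p| <= B.
Hypothesis Lam_finite : forall X : R, exists l : seq R[i], forall p,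
  Lam p -> - X <= sigma * re p -> p \in l.
Hypothesis Lam_component : \forall x \near +oo,
  Lam `<=` connected_component (~` range gam : set R[i]^o) (- sigma * x)%:C.

(** [S T] stands for the path closing the curve truncated to [-T, T]. By [S_far] it leaves every
    bounded set, and inside a horizontal strip it is found only far out in the direction sigma,
    whereas poles are pushed in the direction - sigma. *)
Definition chain_support T : set R[i] :=
  [set s | exists2 t, - T <= t <= T & s = gam t] `|` S T.

Let sigma_norm : `|sigma| = 1.
Proof. by case: sigmaE => ->; rewrite ?normrN normr1. Qed.

Let sigma_sqr : sigma ^+ 2 = 1.
Proof. by case: sigmaE => ->; rewrite ?sqrrN expr1n. Qed.

Lemma curve_bounded a b : exists M : R, forall t, a <= t <= b -> cabs (gam t) <= M.
Proof.
have H (h : R -> R) : continuous h -> exists M : R, forall t, a <= t <= b -> `|h t| <= M.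
  move=> ch; have ck : {within `[a, b], continuous h} by exact: continuous_subspaceT.
  have /compact_bounded[M [_ mrt]] := continuous_compact ck (@segment_compact _ a b).
  exists (`|M| + 1) => t tab; apply: mrt; first by rewrite ltr_pwDr // ler_norm.
  by exists t => //=; rewrite in_itv.
have [M1 h1] := H _ (fun t => (gam_cont t).1).
have [M2 h2] := H _ (fun t => (gam_cont t).2).
exists (M1 + M2) => t tab; rewrite (le_trans (cabs_le _)) //.
exact: lerD (h1 t tab) (h2 t tab).
Qed.

Lemma chain_support_bounded T : cbounded (chain_support T).
Proof.
have [M hM] := curve_bounded (- T) T; have [N hN] := S_bounded T.
exists (Num.max M N) => s [[t tT ->]|Ss]; rewrite le_max.
  by rewrite hM.
by rewrite hN ?orbT.
Qed.

(* A far-away pole in the strip is harmless by [papprox_far_pole]; it is then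
   moved towards the curve in steps of length 1/2. *)
Lemma strip_pole : exists2 X : R, 0 <= X & \forall T \near +oo, forall p, `|im p| <= B ->
  sigma * re p <= - X -> papprox (chain_support T) (fun s => (s - p)^-1).
Proof.
have [T0 hT0] := gam_far (B + 1).
have [M hM] := curve_bounded (- T0) T0.
exists (`|M| + 1); first by rewrite addr_ge0.
apply: filterS (S_far (B + 1)) => T ST.
(* Where |im s| < B + 1, the curve shows only its piece |t| < T0, of modulus at most M, and the
   closing path only points with sigma re s >= B + 1. A point p of the strip with sigma re p <= -
   (|M| + 1) is at distance at least 1 from all of these, and from the points with larger |im s| as
   well. *)
have dK p : `|im p| <= B -> sigma * re p <= - (`|M| + 1) ->
    forall s, chain_support T s -> 1 <= cabs (s - p).
  move=> pB pM s; rewrite leNgt => sT; apply/negP => sp.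
  suff : (1 : R) <= 0 by rewrite ler10.
  have := le_lt_trans (cabs_im _) sp; have := le_lt_trans (cabs_re _) sp.
  rewrite !reimE => h1 h2.
  have h1' : sigma * re s < - `|M|.
    have : sigma * (re s - re p) <= 1 * `|re s - re p|.
      by rewrite -sigma_norm -normrM ler_norm.
    by rewrite mul1r mulrBr; lra.
  have h2' : `|im s| < B + 1.
    by have := ler_normD (im s - im p) (im p); rewrite subrK; lra.
  case: sT => [[t _ ts]|/ST[]]; last first.
  - by have := normr_ge0 M; have := B_ge0; lra.
  - by rewrite leNgt h2'.
  have [/hT0|tT0] := leP T0 `|t|; first by rewrite -ts leNgt h2'.
  have := hM t; rewrite -ler_norml ltW // => /(_ isT); rewrite -ts => sM.
  have := le_trans (cabs_re s) sM; have := ler_norm M.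
  have := ler_norm (- (sigma * re s)); rewrite normrN normrM sigma_norm mul1r; lra.
have [N hN] := chain_support_bounded T.
suff H (k : nat) p : `|im p| <= B -> sigma * re p <= - (`|M| + 1) ->
    sigma * re p <= - (2 * `|N| + 1) + k%:R / 2 ->
    papprox (chain_support T) (fun s => (s - p)^-1).
  move=> p pB pM; pose y := 2 * (sigma * re p + (2 * `|N| + 1)).
  apply: (H (Num.bound `|y|)) => //.
  have := archi_boundP (normr_ge0 y); have := ler_norm y; rewrite /y; lra.
elim: k p => [|k ih] p pB pM pk.
  have h : 2 * `|N| + 1 <= cabs p.
    have := cabs_re p; have := ler_norm (- (sigma * re p)).
    by rewrite normrN normrM sigma_norm mul1r; move: pk; rewrite mul0r; lra.
  apply: (papprox_far_pole (chain_support_bounded T) hN).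
  - by have := normr_ge0 N; lra.
  - by have := ler_norm N; lra.
have E : sigma * re (p - (sigma / 2)%:C) = sigma * re p - 2^-1.
  rewrite !reimE /=; have -> : sigma * (re p - sigma / 2) = sigma * re p - sigma ^+ 2 / 2 by ring.
  by rewrite sigma_sqr mul1r.
have iE : im (p - (sigma / 2)%:C) = im p by rewrite !reimE /= subr0.
apply: (@pole_pushing _ _ (chain_support_bounded T) p (p - (sigma / 2)%:C) 1).
- apply: ih; rewrite ?iE // E; first by lra.
  by move: pk; rewrite -natr1; lra.
- by [].
- by apply: dK; rewrite ?iE // E; lra.
- rewrite opprB addrC subrK cabs_real normrM sigma_norm mul1r ger0_norm ?invr_ge0 //.
  by rewrite mul1r.
Qed.

(** One d serves all large T. The closing path and the tails of the curve stay at distance at least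
    1 from p, and on the remaining compact piece the distance to p attains a positive minimum. *)
Lemma chain_separation p : (~` range gam) p -> exists2 d : R, 0 < d &
  \forall T \near +oo, forall s, chain_support T s -> d <= cabs (s - p).
Proof.
move=> np; have [T0 hT0] := gam_far (cabs p + 1).
have T0' : - `|T0| <= `|T0| by have := normr_ge0 T0; lra.
pose u t := (re (gam t) - re p) ^+ 2 + (im (gam t) - im p) ^+ 2.
have cu : continuous u.
  move=> t; have [c1 c2] := gam_cont t; apply: cvgD; rewrite /=.
    by apply: cvgM; apply: cvgB => //; exact: cvg_cst.
  by apply: cvgM; apply: cvgB => //; exact: cvg_cst.
have [t0 _ ht0] := EVT_min T0' (continuous_subspaceT cu).
have uE t : Num.sqrt (u t) = cabs (gam t - p) by rewrite cabsE !reimE.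
exists (Num.min 1 (cabs (gam t0 - p))).
  rewrite lt_min ltr01 cabs_gt0 subr_eq0; apply/eqP => e.
  by apply: np; exists t0.
apply: filterS (S_far (cabs p + 1)) => T ST s.
have far (x y : R) : cabs p + 1 <= `|x| -> `|x - y| <= cabs (s - p) -> `|y| <= cabs p ->
    1 <= cabs (s - p).
  by move=> h1 h2 h3; have := ler_normD (x - y) y; rewrite subrK; lra.
case=> [[t tT ts]|/ST[h|h]].
- rewrite ge_min; have [/hT0 h|tT0] := leP T0 `|t|.
    rewrite -ts in h; apply/orP; left; apply: (far (im s) (im p)) => //.
      by have := cabs_im (s - p); rewrite !reimE.
    exact: cabs_im.
  apply/orP; right; rewrite ts -!uE; apply: ler_wsqrtr; apply: ht0.
  rewrite in_itv /= -ler_norml; apply: le_trans (ltW tT0) (ler_norm _).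
- rewrite ge_min; apply/orP; left; apply: (far (im s) (im p)) => //.
    by have := cabs_im (s - p); rewrite !reimE.
  exact: cabs_im.
- rewrite ge_min; apply/orP; left; apply: (far (re s) (re p)) => //.
  + apply: le_trans h _; apply: le_trans (ler_norm _) _.
    by rewrite normrM sigma_norm mul1r.
  + by have := cabs_re (s - p); rewrite !reimE.
  + exact: cabs_re.
Qed.

(* The set of points that can be pushed to infinity is open and closed in the
   complement of the curve, so it contains the whole component. *)
Lemma Lam_pole p : Lam p ->
  \forall T \near +oo, papprox (chain_support T) (fun s => (s - p)^-1).
Proof.
move=> Lp; have [X X0 hX] := strip_pole.
near (+oo : set_system R) => x.
have xX : X <= x by near: x; apply: nbhs_pinfty_ge; exact: num_real.
have : Lam `<=` connected_component (~` range gam : set R[i]^o) (- sigma * x)%:C.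
  by near: x; exact: Lam_component.
move=> /(_ _ Lp)[C [Cx CA cC] Cp].
pose U : set R[i]^o :=
  [set q | \forall T \near +oo, papprox (chain_support T) (fun s => (s - q)^-1)].
suff E : C `&` U = C by have [] : (C `&` U) p by rewrite E.
have Ux : U (- sigma * x)%:C.
  apply: filterS hX => T; apply; rewrite /= ?normr0 //.
  have -> : sigma * (- sigma * x) = - sigma ^+ 2 * x by ring.
  by rewrite sigma_sqr; lra.
(* For |q' - q| < d / 4 the pole can be moved both ways: q has distance at least d from the chain,
   q' at least 3 d / 4, and the step is at most half of either. *)
have loc q : C q -> exists2 d : R, 0 < d & forall q', cabs (q' - q) < d -> U q <-> U q'.
  move=> /CA /chain_separation[d d0 hd]; exists (d / 4); first by rewrite divr_gt0.
  move=> q' qq'; split; rewrite /U /=; apply: filterS2 hd => T hd hT.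
  - apply: (pole_pushing (chain_support_bounded T) hT d0 hd).
    by apply: le_trans (ltW qq') _; lra.
  - apply: (@pole_pushing _ _ (chain_support_bounded T) q q' (3 * d / 4) hT); first by lra.
      move=> s /hd; have := cabsD (s - q') (q' - q); rewrite addrA subrK; lra.
    by rewrite cabsB; lra.
apply: cC.
- by exists (- sigma * x)%:C.
- exists (interior U); first exact: open_interior.
  apply/seteqP; split=> q [Cq Uq]; split=> //; last exact: interior_subset Uq.
  have [d d0 hd] := loc q Cq; apply/nbhs_cabsP; exists d => // w /hd[h _]; exact: h.
- exists (closure U); first exact: closed_closure.
  apply/seteqP; split=> q [Cq Uq]; split=> //; first exact: subset_closure.
  have [d d0 hd] := loc q Cq.
  have /Uq[q' [Uq' qq']] : nbhs (q : R[i]^o) [set w | cabs (w - q) < d].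
    by apply/nbhs_cabsP; exists d.
  by have [_] := hd _ qq'; exact.
Unshelve. all: by end_near.
Qed.

(** A single T has to serve infinitely many poles. Those with sigma re p <= - X share the threshold
    of [strip_pole]; the remaining ones are finite in number, and their individual thresholds are
    combined. *)
Lemma Lam_poles : \forall T \near +oo, forall p, Lam p ->
  papprox (chain_support T) (fun s => (s - p)^-1).
Proof.
have [X X0 hX] := strip_pole; have [l hl] := Lam_finite X.
have : \forall T \near +oo, forall p, p \in l -> Lam p ->
    papprox (chain_support T) (fun s => (s - p)^-1).
  elim: l {hl} => [|q l ih]; first by near=> T.
  have [Lq|nLq] := pselect (Lam q).
    apply: filterS2 ih (Lam_pole Lq) => T hT hq p.
    by rewrite inE => /predU1P[->//|]; exact: hT.
  by apply: filterS ih => T hT p; rewrite inE => /predU1P[->//|]; exact: hT.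
apply: filterS2 hX => T hX hT p Lp.
have [pX|pX] := leP (sigma * re p) (- X); first by apply: hX => //; exact: Lam_strip.
by apply: hT => //; apply: hl => //; exact: ltW.
Unshelve. all: by end_near.
Qed.

End PolePushing.

(** * Segments and closed chains *)

Section Segments.
Context {R : realType}.
Implicit Types (z w c s v : R[i]) (f : R[i] -> R[i]) (T : R).

Definition seg z w (t : R) : R[i] := z + t%:C * (w - z).

Definition sint f z w : R[i] := cint `[0, 1] (fun t => f (seg z w t) * (w - z)).

Definition segset z w : set R[i] := [set s | exists2 t, 0 <= t <= 1 & s = seg z w t].

Lemma segE z w t : seg z w t = (1 - t)%:C * z + t%:C * w.
Proof. by rewrite /seg rmorphB /= rmorph1; ring. Qed.

Lemma seg_smooth z w : piecewise_smooth (seg z w) (fun=> w - z).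
Proof.
split.
- move=> t; apply: cconvD; first exact: cconv_cst.
  apply: cconvM; last exact: cconv_cst.
  by split; [exact: cvg_id|exact: cvg_cst].
- exists [::] => t _; split; last exact: cconv_cst.
  by apply: is_cder_eq (is_cderD (is_cder_cst z t) (is_cder_scale (w - z) t)) _; rewrite add0r.
- by move=> t; split; exists (w - z); exact: cconv_cst.
Qed.

Lemma segset_bounded z w : cbounded (segset z w).
Proof.
exists (cabs z + cabs (w - z)) => s [t /andP[t0 t1] ->]; rewrite /seg.
by rewrite (le_trans (cabsD _ _)) // lerD2l cabsM cabs_real ger0_norm // ler_piMl ?cabs_ge0.
Qed.

Lemma cboundedU (A A' : set R[i]) : cbounded A -> cbounded A' -> cbounded (A `|` A').
Proof.
move=> [M hM] [N hN]; exists (Num.max M N) => s [/hM|/hN] h; rewrite le_max h ?orbT //.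
Qed.

Lemma sint_papprox (K : set R[i]) f z w : cbounded K -> papprox K f -> segset z w `<=` K ->
  exists2 C : R, 0 <= C & forall e (F : {poly R[i]}), 0 <= e ->
    (forall s, K s -> cabs (f s - F^`().[s]) <= e) ->
    cabs (sint f z w - (F.[w] - F.[z])) <= C * e.
Proof.
move=> bK af zwK.
have [C C0 hC] := cint_papprox (seg_smooth z w) ler01 bK af
  (fun t t01 => zwK _ (ex_intro2 _ _ t t01 erefl)).
exists C => // e F e0 /(hC _ _ e0).
by rewrite {2 3}/seg mul1r mul0r addr0 [z + _]addrC subrK.
Qed.

Lemma sint_le (K : set R[i]) f z w (M : R) : cbounded K -> papprox K f -> segset z w `<=` K ->
  (forall s, segset z w s -> cabs (f s) <= M) -> cabs (sint f z w) <= 2 * (M * cabs (w - z)).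
Proof.
move=> bK af zwK hM.
have i := cintegrable_papprox (seg_smooth z w) ler01 bK af
  (fun t t01 => zwK _ (ex_intro2 _ _ t t01 erefl)).
apply: le_trans (cint_le (M := M * cabs (w - z)) ler01 i _) _.
  by move=> t t01; rewrite cabsM ler_wpM2r ?cabs_ge0 // hM //; exists t.
by rewrite subr0 mulr1.
Qed.

(** With f replaced by a polynomial F' the five integrals telescope to 0, so their sum is at most a
    fixed multiple of every e > 0. *)
Lemma closed_chain_integral (K : set R[i]) f gam dgam a b z1 z2 z3 :
  piecewise_smooth gam dgam -> a <= b -> cbounded K -> papprox K f ->
  (forall t, a <= t <= b -> K (gam t)) ->
  segset (gam b) z1 `<=` K -> segset z1 z2 `<=` K ->
  segset z2 z3 `<=` K -> segset z3 (gam a) `<=` K ->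
  cint `[a, b] (fun t => f (gam t) * dgam t) + sint f (gam b) z1 + sint f z1 z2
  + sint f z2 z3 + sint f z3 (gam a) = 0.
Proof.
move=> sg ab bK af Kg k1 k2 k3 k4; set I := LHS.
have [C0 C00 h0] := cint_papprox sg ab bK af Kg.
have [C1 C10 h1] := sint_papprox bK af k1.
have [C2 C20 h2] := sint_papprox bK af k2.
have [C3 C30 h3] := sint_papprox bK af k3.
have [C4 C40 h4] := sint_papprox bK af k4.
have I_le e : 0 < e -> cabs I <= (C0 + C1 + C2 + C3 + C4) * e.
  move=> e0; have [P hP] := af e e0; have [F FP] := poly_antiderivative P.
  rewrite -FP in hP; have e0' := ltW e0.
  have := h0 _ _ e0' hP; have := h1 _ _ e0' hP; have := h2 _ _ e0' hP.
  have := h3 _ _ e0' hP; have := h4 _ _ e0' hP; rewrite /I.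
  move: (cint _ _) (sint _ _ _) (sint _ _ _) (sint _ _ _) (sint _ _ _) => x0 x1 x2 x3 x4.
  move=> a4 a3 a2 a1 a0.
  have -> : x0 + x1 + x2 + x3 + x4 = (x0 - (F.[gam b] - F.[gam a])) + (x1 - (F.[z1] - F.[gam b]))
    + (x2 - (F.[z2] - F.[z1])) + (x3 - (F.[z3] - F.[z2])) + (x4 - (F.[gam a] - F.[z3])) by ring.
  do 4 (apply: le_trans (cabsD _ _) _; rewrite mulrDl; apply: lerD => //).
apply/eqP; rewrite -cabs_eq0 eq_le cabs_ge0 andbT leNgt; apply/negP => I0.
set C := C0 + C1 + C2 + C3 + C4 in I_le.
have C_ge0 : 0 <= C by rewrite !addr_ge0.
pose u := cabs I / (2 * (C + 1)).
have u0 : 0 < u by rewrite divr_gt0 ?mulr_gt0 ?ltr_wpDl.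
have E : cabs I = 2 * (C + 1) * u by rewrite /u; field; rewrite gt_eqF // ltr_wpDl.
have := I_le u u0; rewrite E; have := mulr_ge0 C_ge0 (ltW u0) => ? ?.
suff : (1 : R) <= 0 by rewrite ler10.
lra.
Qed.

End Segments.

(** * Decay and position of the closing segments *)

Section RayRegions.
Context {R : realType}.
Variables (sigma : R) (sigmaE : sigma = 1 \/ sigma = -1) (f : R[i] -> R[i]).
Hypothesis f_decay : forall c : R, 0 < c -> exists R0 : R, forall s, R0 <= cabs s ->
  c * cabs s ^+ 2 <= re (s ^+ 2) -> 0 <= sigma * re s \/ c * cabs s <= `|im s| ->
  cabs (f s) <= expR (- cabs s ^+ 2).

(** The signs x and y choose the quadrant, so the four ray angles e, - e, pi - e and - pi + e are
    treated at once, and e < pi / 4 enters only as sin e < cos e. *)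
Definition ray_point (x y e T : R) : R[i] := (x * (T * cos e)) +i* (y * (T * sin e)).

Definition is_sign (x : R) := x = 1 \/ x = -1.

Lemma is_sign_norm x : is_sign x -> `|x| = 1.
Proof. by case=> ->; rewrite ?normrN normr1. Qed.

Lemma sin_cos_pi4 (e : R) : 0 < e < pi / 4 -> [/\ 0 < sin e, sin e < sin (pi / 4),
  sin (pi / 4) < cos e & cos e <= 1].
Proof.
move=> /andP[e0 e4]; have pi0 := @pi_gt0 R.
have E : sin (pi / 4) = cos (pi / 4) :> R.
  rewrite {1}(_ : pi / 4 = pi / 2 - pi / 4); last by field.
  by rewrite sinB sin_pihalf cos_pihalf mul0r subr0 mul1r.
split; last exact: cos_le1.
- by apply: sin_gt0_pi; rewrite e0 /=; lra.
- by rewrite ltr_sin ?in_itv /= ?e4 //; apply/andP; split; lra.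
- by rewrite E ltr_cos ?in_itv /= ?e4 //; apply/andP; split; lra.
Qed.

(** The segment joins the ray of the curve (angle e, bounded shift v) to a corner of angle e0 in the
    same quadrant. Both angles are below pi / 4, so up to the shift |im s| / |re s| stays below a
    constant less than 1; thus Re(s^2) is comparable to |s|^2, while |im s| still grows like T. *)
Lemma end_region (x y e e0 C : R) : is_sign x -> is_sign y ->
  0 < e < pi / 4 -> 0 < e0 < pi / 4 ->
  exists2 k : R, 0 < k & \forall T \near +oo, forall (t : R) (v : R[i]), 0 <= t <= 1 -> cabs v <= C ->
    let s := (1 - t)%:C * ray_point x y e T + t%:C * ray_point x y e0 T + v in
    cabs (f s) <= expR (- (k * T ^+ 2)) /\ k * T <= `|im s|.
Proof.
move=> xs ys he he0.
have [s0 sh hc c1] := sin_cos_pi4 he; have [s0' sh' hc' c1'] := sin_cos_pi4 he0.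
pose m := Num.min (sin e) (sin e0); pose M := Num.max (sin e) (sin e0).
pose c := Num.min (cos e) (cos e0).
have m0 : 0 < m by rewrite lt_min s0.
have Mc : M < c.
  by rewrite gt_max !lt_min !(lt_trans sh) ?(lt_trans sh').
have M0 : 0 < M by rewrite lt_max s0.
have c0 : 0 < c by exact: lt_trans Mc.
(* Once T dominates C, the bounds below are Re(s^2) >= (c - M) c T^2 / 2, |im s| >= m T / 2 and |s|
   <= 3 T, whence the denominators 18 = 2 * 9 and 6 = 2 * 3. *)
pose kap := Num.min ((c - M) * c / 18) (m / 6).
have kap0 : 0 < kap by rewrite lt_min !divr_gt0 ?mulr_gt0 ?subr_gt0.
have [R0 hR0] := f_decay kap0.
exists (Num.min (m / 2) (m ^+ 2 / 4)); first by rewrite lt_min !divr_gt0 ?exprn_gt0.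
near=> T => t v /andP[t0 t1] vC; set s := _ + v.
have T0 : 0 < T by near: T; apply: nbhs_pinfty_gt; exact: num_real.
have T1 : 2 * C / m <= T by near: T; apply: nbhs_pinfty_ge; exact: num_real.
have T2 : 2 * R0 / m <= T by near: T; apply: nbhs_pinfty_ge; exact: num_real.
have T3 : 2 * C <= T by near: T; apply: nbhs_pinfty_ge; exact: num_real.
have T4 : 4 * C / (c - M) <= T by near: T; apply: nbhs_pinfty_ge; exact: num_real.
have T5 : C / c <= T by near: T; apply: nbhs_pinfty_ge; exact: num_real.
have C0 : 0 <= C := le_trans (cabs_ge0 v) vC.
rewrite ler_pdivrMr // in T1; rewrite ler_pdivrMr // in T2.
rewrite ler_pdivrMr ?subr_gt0 // in T4; rewrite ler_pdivrMr // in T5.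
pose avg (a b : R) := (1 - t) * a + t * b.
have avg_lb (a b l : R) : l <= a -> l <= b -> l <= avg a b.
  by rewrite /avg => la lb; nra.
have avg_ub (a b l : R) : a <= l -> b <= l -> avg a b <= l.
  by rewrite /avg => la lb; nra.
have re_s : re s = x * (T * avg (cos e) (cos e0)) + re v.
  by rewrite /s !reimE /= /avg; ring.
have im_s : im s = y * (T * avg (sin e) (sin e0)) + im v.
  by rewrite /s !reimE /= /avg; ring.
have a1 : c <= avg (cos e) (cos e0) by rewrite avg_lb // ge_min lexx ?orbT.
have a2 : avg (cos e) (cos e0) <= 1 by rewrite avg_ub.
have b1 : m <= avg (sin e) (sin e0) by rewrite avg_lb // ge_min lexx ?orbT.
have b2 : avg (sin e) (sin e0) <= M by rewrite avg_ub // le_max lexx ?orbT.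
move: (avg (cos e) (cos e0)) (avg (sin e) (sin e0)) a1 a2 b1 b2 re_s im_s => A Bv a1 a2 b1 b2 re_s im_s.
have rev := le_trans (cabs_re v) vC; have imv := le_trans (cabs_im v) vC.
have TA : `|x * (T * A)| = T * A.
  by rewrite normrM is_sign_norm // mul1r ger0_norm // mulr_ge0 ?(ltW T0) // (le_trans _ a1) // ltW.
have TB : `|y * (T * Bv)| = T * Bv.
  by rewrite normrM is_sign_norm // mul1r ger0_norm // mulr_ge0 ?(ltW T0) // (le_trans _ b1) // ltW.
have r1 : T * c - C <= `|re s|.
  have := lerB_normD (x * (T * A)) (re v); rewrite -re_s TA; nra.
have r2 : `|re s| <= T + C.
  have := ler_normD (x * (T * A)) (re v); rewrite -re_s TA; nra.
have i1 : T * m - C <= `|im s|.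
  have := lerB_normD (y * (T * Bv)) (im v); rewrite -im_s TB; nra.
have i2 : `|im s| <= T * M + C.
  have := ler_normD (y * (T * Bv)) (im v); rewrite -im_s TB; nra.
have M1 : M <= 1 by apply: le_trans (ltW Mc) _; rewrite ge_min c1.
have im_lb : m / 2 * T <= `|im s| by lra.
have s_lb : m / 2 * T <= cabs s := le_trans im_lb (cabs_im s).
have s_ub : cabs s <= 3 * T.
  by apply: le_trans (cabs_le s) _; nra.
have sq : (c - M) * c / 2 * T ^+ 2 <= re (s ^+ 2).
  rewrite re_sqr -(real_normK (num_real (re s))) -(real_normK (num_real (im s))).
  have q1 : (T * c - C) ^+ 2 <= `|re s| ^+ 2.
    by rewrite lerXn2r ?nnegrE //; lra.
  have q2 : `|im s| ^+ 2 <= (T * M + C) ^+ 2.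
    by rewrite lerXn2r ?nnegrE // addr_ge0 ?mulr_ge0 // ltW.
  apply: le_trans (lerB q1 q2).
  have -> : (T * c - C) ^+ 2 - (T * M + C) ^+ 2 = (T * (c - M) - 2 * C) * (T * (c + M)) by ring.
  have h1 : T * (c - M) / 2 <= T * (c - M) - 2 * C by lra.
  have h2 : T * c <= T * (c + M) by nra.
  apply: le_trans (ler_pM _ _ h1 h2); last 2 first.
  - by rewrite divr_ge0 ?mulr_ge0 ?subr_ge0 ?(ltW T0) // ltW.
  - by rewrite mulr_ge0 // ltW.
  - by rewrite le_eqVlt; apply/orP; left; apply/eqP; ring.
have k1 : kap <= (c - M) * c / 18 by rewrite ge_min lexx.
have k2 : kap <= m / 6 by rewrite ge_min lexx orbT.
have s2 : cabs s ^+ 2 <= (3 * T) ^+ 2.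
  by rewrite lerXn2r ?nnegrE ?cabs_ge0 // mulr_ge0 // ltW.
split; last by apply: le_trans im_lb; rewrite ler_wpM2r ?(ltW T0) // ge_min lexx.
apply: le_trans (hR0 s _ _ _) _.
- by apply: le_trans s_lb; lra.
- apply: le_trans sq; apply: le_trans (ler_pM (ltW kap0) (exprn_ge0 _ (cabs_ge0 s)) k1 s2) _.
  by rewrite le_eqVlt; apply/orP; left; apply/eqP; field.
- right; apply: le_trans im_lb; apply: le_trans (ler_pM (ltW kap0) (cabs_ge0 s) k2 s_ub) _; lra.
- rewrite ler_expR lerN2; apply: (@le_trans _ _ (m ^+ 2 / 4 * T ^+ 2)).
    by rewrite ler_wpM2r ?exprn_ge0 ?(ltW T0) // ge_min lexx orbT.
  have -> : m ^+ 2 / 4 * T ^+ 2 = (m / 2 * T) ^+ 2 by field.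
  by rewrite lerXn2r ?nnegrE ?cabs_ge0 // mulr_ge0 ?divr_ge0 // ltW.
Unshelve. all: by end_near.
Qed.

(** The segment ends on the real axis, so the decay comes from the alternative 0 <= sigma re s of
    [f_decay]; this is why the corner has to lie on the side sigma. *)
Lemma middle_region (y e0 : R) : is_sign y -> 0 < e0 < pi / 4 ->
  exists2 k : R, 0 < k & \forall T \near +oo, forall (t : R), 0 <= t <= 1 ->
    cabs (f ((1 - t)%:C * ray_point sigma y e0 T + t%:C * (sigma * T)%:C)) <= expR (- (k * T ^+ 2)).
Proof.
move=> ys he0; have [s0 sh hc c1] := sin_cos_pi4 he0.
have sc : sin e0 < cos e0 := lt_trans sh hc.
have c0 : 0 < cos e0 := lt_trans s0 sc.
pose kap := (cos e0 ^+ 2 - sin e0 ^+ 2) / 4.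
have kap0 : 0 < kap by rewrite divr_gt0 // subr_gt0 ltrXn2r // ?nnegrE ltW.
have [R0 hR0] := f_decay kap0.
exists (cos e0 ^+ 2); first by rewrite exprn_gt0.
near=> T => t /andP[t0 t1]; set s := _ + _.
have T0 : 0 < T by near: T; apply: nbhs_pinfty_gt; exact: num_real.
have T1 : R0 / cos e0 <= T by near: T; apply: nbhs_pinfty_ge; exact: num_real.
rewrite ler_pdivrMr // in T1.
have sg : sigma ^+ 2 = 1 by case: sigmaE => ->; rewrite ?sqrrN expr1n.
have y2 : y ^+ 2 = 1 by case: ys => ->; rewrite ?sqrrN expr1n.
have re_s : re s = sigma * (T * ((1 - t) * cos e0 + t)) by rewrite /s !reimE /=; ring.
have im_s : im s = y * (T * ((1 - t) * sin e0)) by rewrite /s !reimE /=; ring.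
have A1 : cos e0 <= (1 - t) * cos e0 + t by nra.
have A2 : (1 - t) * cos e0 + t <= 1 by nra.
have B1 : 0 <= (1 - t) * sin e0 by rewrite mulr_ge0 ?subr_ge0 // ltW.
have B2 : (1 - t) * sin e0 <= sin e0 by nra.
move: ((1 - t) * cos e0 + t) ((1 - t) * sin e0) A1 A2 B1 B2 re_s im_s => A Bv A1 A2 B1 B2 re_s im_s.
have re2 : re s ^+ 2 = T ^+ 2 * A ^+ 2 by rewrite re_s !exprMn sg mul1r.
have im2 : im s ^+ 2 = T ^+ 2 * Bv ^+ 2 by rewrite im_s !exprMn y2 mul1r.
have A2' : cos e0 ^+ 2 <= A ^+ 2 by rewrite lerXn2r ?nnegrE ?(le_trans _ A1) // ltW.
have A3 : A ^+ 2 <= 1 by rewrite exprn_ile1 // (le_trans _ A1) // ltW.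
have B3 : Bv ^+ 2 <= sin e0 ^+ 2 by rewrite lerXn2r ?nnegrE // ltW.
have B4 : sin e0 ^+ 2 <= 1 by rewrite exprn_ile1 ?sin_le1 // ltW.
have TT : 0 < T ^+ 2 by rewrite exprn_gt0.
have s_sq : cabs s ^+ 2 <= T ^+ 2 * 2 by rewrite cabs_sqr re2 im2 -mulrDr ler_pM2l //; lra.
have s_lb : T ^+ 2 * cos e0 ^+ 2 <= cabs s ^+ 2.
  by rewrite cabs_sqr re2 im2 -mulrDr ler_pM2l //; have := sqr_ge0 Bv; lra.
apply: le_trans (hR0 s _ _ _) _.
- apply: le_trans T1 _; rewrite -(ler_pXn2r (n := 2)) ?nnegrE ?cabs_ge0 ?exprMn //.
  by rewrite mulr_ge0 // ltW.
- rewrite re_sqr re2 im2 -mulrBr; apply: le_trans (ler_wpM2l (ltW kap0) s_sq) _.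
  rewrite mulrCA ler_pM2l //; have := kap0; rewrite /kap; lra.
- by left; rewrite re_s mulrA -expr2 sg mul1r mulr_ge0 ?(ltW T0) // (le_trans _ A1) // ltW.
- by rewrite ler_expR lerN2 mulrC.
Unshelve. all: by end_near.
Qed.

(** The sign x is free, so the segment may cross the imaginary axis. If |im s| < X then (1 - t) T <
    X / sin e0, and sigma re s >= t T - (1 - t) T = T - 2 (1 - t) T remains at least X. *)
Lemma middle_far (x y e0 X : R) : is_sign x -> is_sign y -> 0 < e0 < pi / 4 ->
  \forall T \near +oo, forall t, 0 <= t <= 1 ->
    let s := (1 - t)%:C * ray_point x y e0 T + t%:C * (sigma * T)%:C in
    X <= `|im s| \/ X <= sigma * re s.
Proof.
move=> xs ys he0; have [s0 sh hc c1] := sin_cos_pi4 he0.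
have c0 : 0 < cos e0 := lt_trans s0 (lt_trans sh hc).
near=> T => t /andP[t0 t1]; set s := _ + _.
have T0 : 0 < T by near: T; apply: nbhs_pinfty_gt; exact: num_real.
have T1 : X + 2 * X / sin e0 <= T by near: T; apply: nbhs_pinfty_ge; exact: num_real.
have im_s : `|im s| = (1 - t) * T * sin e0.
  have -> : im s = y * ((1 - t) * T * sin e0) by rewrite /s !reimE /=; ring.
  by rewrite normrM is_sign_norm // mul1r ger0_norm // !mulr_ge0 ?subr_ge0 // ltW.
have [h|h] := leP X `|im s|; [by left|right].
rewrite im_s -ltr_pdivlMr // in h.
have sg : sigma ^+ 2 = 1 by case: sigmaE => ->; rewrite ?sqrrN expr1n.
have -> : sigma * re s = (sigma * x) * ((1 - t) * T * cos e0) + sigma ^+ 2 * (t * T).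
  by rewrite /s !reimE /=; ring.
have h1 : - ((1 - t) * T) <= (sigma * x) * ((1 - t) * T * cos e0).
  have := ler_norm (- ((sigma * x) * ((1 - t) * T * cos e0))).
  have p0 : 0 <= (1 - t) * T by rewrite mulr_ge0 ?subr_ge0 // ltW.
  rewrite normrN !normrM (is_sign_norm xs) (is_sign_norm sigmaE) !mul1r.
  rewrite -normrM (ger0_norm p0) (ger0_norm (ltW c0)); nra.
have -> : X = X + 2 * X / sin e0 - 2 * (X / sin e0) by field; rewrite gt_eqF.
rewrite sg mul1r; nra.
Unshelve. all: by end_near.
Qed.

End RayRegions.

Section NearInfinity.
Context {R : realType}.

Lemma near_pinftyE (P : R -> Prop) :
  (\forall t \near +oo, P t) -> exists2 T : R, 0 < T & forall t, T <= t -> P t.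
Proof.
move=> [M [_ hM]]; exists (`|M| + 1) => [|t tM]; first by rewrite ltr_wpDl.
by apply: hM; apply: lt_le_trans tM; rewrite ltr_pwDr // ler_norm.
Qed.

Lemma near_ninftyE (P : R -> Prop) :
  (\forall t \near -oo, P t) -> exists2 T : R, 0 < T & forall t, t <= - T -> P t.
Proof.
move=> [M [_ hM]]; exists (`|M| + 1) => [|t tM]; first by rewrite ltr_wpDl.
apply: hM; apply: le_lt_trans tM _; rewrite opprD ltrBlDr.
by have := ler_norm (- M); rewrite normrN; lra.
Qed.

Lemma near_pinftyI (P : R -> Prop) (T : R) :
  (forall t, T <= t -> P t) -> \forall t \near +oo, P t.
Proof. by move=> h; exists T; split; rewrite ?num_real // => t /ltW /h. Qed.

End NearInfinity.

(** * Gaussian domination and integrals over the line *)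

Section ImproperIntegrals.
Context {R : realType}.
Local Notation mu := (@lebesgue_measure R).

Lemma integrable_gaussian (k : R) : 0 < k ->
  mu.-integrable setT (EFin \o (fun t => expR (- (k * t ^+ 2)))).
Proof.
(* The Gaussian is a rescaled normal density of variance 1 / (2 k). *)
move=> k0; pose s : R := Num.sqrt (2 * k)^-1.
have s2 : s ^+ 2 = (2 * k)^-1 by rewrite sqr_sqrtr // invr_ge0 mulr_ge0 // ltW.
have s0 : s != 0 by rewrite gt_eqF // sqrtr_gt0 invr_gt0 mulr_gt0.
have p0 := normal_peak_gt0 s0.
have := @integrableZl _ _ _ mu _ measurableT ((normal_peak s)^-1) _ (integrable_normal_pdf 0 s).
congr (integrable _ _ _); apply/funext => t /=.
rewrite -EFinM normal_pdfE // mulKf ?gt_eqF // /normal_fun subr0 s2; congr (expR _)%:E.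
by rewrite -mulr_natr; field; rewrite gt_eqF.
Qed.

Lemma integrable_gaussian_decay (h : R -> R) (M k : R) : 0 < k ->
  measurable_fun setT h -> (forall t, `|h t| <= M * expR (- (k * t ^+ 2))) ->
  mu.-integrable setT (EFin \o h).
Proof.
move=> k0 mh hM.
have i : mu.-integrable setT (fun t => (M%:E * (expR (- (k * t ^+ 2)))%:E)%E).
  by apply: integrableZl => //; exact: integrable_gaussian.
apply: (le_integrable _ _ _ i) => //; first exact/measurable_EFinP.
move=> t _ /=; rewrite lee_fin normrM [`|expR _|]ger0_norm ?expR_ge0 //.
apply: le_trans (hM t) _; rewrite ler_wpM2r ?expR_ge0 //; exact: ler_norm.
Qed.

Lemma integral_symmetric_limit (h : R -> R) : mu.-integrable setT (EFin \o h) ->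
  (\int[mu]_(t in `[- n%:R, n%:R]) h t) @[n --> \oo] --> \int[mu]_t h t.
Proof.
move=> ih; pose D (n : nat) : set R := `[- n%:R, n%:R]%classic.
pose h_ (n : nat) := (EFin \o h) \_ (D n).
have mh := measurable_int mu ih.
have mh_ n : measurable_fun setT (h_ n).
  by apply/(measurable_restrictT _ _).1; [exact: measurable_itv|exact: measurable_funTS].
have lim : {ae mu, forall t, setT t -> h_ ^~ t @ \oo --> (EFin \o h) t}.
  apply: aeW => t _; apply: cvg_near_cst; exists (Num.bound `|t|) => // i /= hn.
  rewrite /h_ patchE mem_set // /D /= in_itv /= -ler_norml.
  apply: le_trans (ltW (archi_boundP (normr_ge0 t))) _.
  by rewrite ler_nat.
have dom : {ae mu, forall t n, setT t -> (`|h_ n t| <= `|(EFin \o h) t|)%E}.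
  apply: aeW => t i _; rewrite /h_ patchE; case: ifP => // _.
  by rewrite /point /= normr0 lee_fin.
have [_ _] := @dominated_convergence _ _ _ mu setT measurableT h_ (EFin \o h) _ mh_ mh lim
  (integrable_abse ih) dom.
rewrite /= => H.
have E n : \int[mu]_(t in `[- n%:R, n%:R]) h t = fine (\int[mu]_t h_ n t)%E.
  by rewrite /Rintegral integral_mkcond.
under eq_fun do rewrite E.
apply: fine_cvg; rewrite fineK //.
exact: integrable_fin_num.
Qed.

End ImproperIntegrals.

(** * Contour integrals *)

Section ContourIntegral.
Context {R : realType}.
Variables (sigma : R) (sigmaE : sigma = 1 \/ sigma = -1) (f : R[i] -> R[i]).
Variables (Lam : set R[i]) (B : R).
Hypothesis f_decay : forall c : R, 0 < c -> exists R0 : R, forall s, R0 <= cabs s ->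
  c * cabs s ^+ 2 <= re (s ^+ 2) -> 0 <= sigma * re s \/ c * cabs s <= `|im s| ->
  cabs (f s) <= expR (- cabs s ^+ 2).
Hypothesis f_approx : forall K : set R[i], cbounded K ->
  (forall p, Lam p -> papprox K (fun s => (s - p)^-1)) -> papprox K f.
Hypothesis B_ge0 : 0 <= B.
Hypothesis Lam_strip : forall p, Lam p -> `|im p| <= B.
Hypothesis Lam_finite : forall X : R, exists l : seq R[i], forall p,
  Lam p -> - X <= sigma * re p -> p \in l.

(** A fixed angle below pi / 4, common to all curves, so that the corners do not depend on eps. *)
Let e0 : R := pi / 8.
Let e0P : 0 < e0 < pi / 4.
Proof. by have := @pi_gt0 R; rewrite /e0 => ?; apply/andP; split; lra. Qed.

(* sigma = 1 if the poles lie to the left of the curves (n = p) and sigma = -1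
   if they lie to the right (m = q).  The signs x1 and x2 are those of the real
   part along the incoming and the outgoing ray. *)
Definition corner (x y T : R) := ray_point x y e0 T.

Definition corner_integral (x1 x2 T : R) :=
  sint f (corner x2 1 T) (sigma * T)%:C + sint f (sigma * T)%:C (corner x1 (-1) T).

(** What the contour argument retains of an admissible curve. The bound on [dgam] reflects arc
    length along the rays, and the component condition is that of the side carrying the poles. *)
Definition two_ray_curve (x1 x2 e : R) (gam dgam : R -> R[i]) :=
  [/\ piecewise_smooth gam dgam,
      exists c, \forall t \near -oo, gam t = c + ray_point x1 (-1) e (- t) /\ cabs (dgam t) <= 1,
      exists c, \forall t \near +oo, gam t = c + ray_point x2 1 e t /\ cabs (dgam t) <= 1
    & \forall x \near +oo,
        Lam `<=` connected_component (~` range gam : set R[i]^o) (- sigma * x)%:C].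

Section Curve.
Variables (x1 x2 e : R) (gam dgam : R -> R[i]).
Hypotheses (sx1 : is_sign x1) (sx2 : is_sign x2) (eP : 0 < e < pi / 4).
Hypothesis gamP : two_ray_curve x1 x2 e gam dgam.

Let s1 : is_sign (1 : R). Proof. by left. Qed.
Let sN1 : is_sign (-1 : R). Proof. by right. Qed.

Definition closing_path T : set R[i] :=
  segset (gam T) (corner x2 1 T) `|` segset (corner x2 1 T) (sigma * T)%:C
  `|` segset (sigma * T)%:C (corner x1 (-1) T) `|` segset (corner x1 (-1) T) (gam (- T)).

(** The segments contain their end points gam T and gam (- T), so the same bounds control f and |im|
    along the two tails of the curve. *)
Lemma curve_end_bounds : exists2 k : R, 0 < k & exists2 C : R, 0 <= C & exists2 T0 : R, 0 < T0 &
  forall T, T0 <= T ->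
    [/\ forall s, segset (gam T) (corner x2 1 T) s \/ segset (corner x1 (-1) T) (gam (- T)) s ->
          cabs (f s) <= expR (- (k * T ^+ 2)) /\ k * T <= `|im s|,
        cabs (corner x2 1 T - gam T) <= 4 * T + C,
        cabs (gam (- T) - corner x1 (-1) T) <= 4 * T + C &
        cabs (dgam T) <= 1 /\ cabs (dgam (- T)) <= 1].
Proof.
have [_ [c1 h1] [c2 h2] _] := gamP.
have [k1 k10 r1] := end_region f_decay (cabs c1) sx1 sN1 eP e0P.
have [k2 k20 r2] := end_region f_decay (cabs c2) sx2 s1 eP e0P.
have [T1 T10 {}h1] := near_ninftyE h1; have [T2 T20 {}h2] := near_pinftyE h2.
have [T3 T30 {}r1] := near_pinftyE r1; have [T4 T40 {}r2] := near_pinftyE r2.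
exists (Num.min k1 k2); first by rewrite lt_min k10.
exists (cabs c1 + cabs c2); first by rewrite addr_ge0 ?cabs_ge0.
exists (T1 + T2 + T3 + T4); first by rewrite !addr_gt0.
move=> T hT; have [g1 d1] : gam (- T) = c1 + ray_point x1 (-1) e T /\ cabs (dgam (- T)) <= 1.
  by have := h1 (- T); rewrite opprK; apply; lra.
have [g2 d2] : gam T = c2 + ray_point x2 1 e T /\ cabs (dgam T) <= 1 by apply: h2; lra.
have T0 : 0 < T by lra.
have rp (x y e' : R) : is_sign x -> is_sign y -> cabs (ray_point x y e' T) <= 2 * T.
  move=> sx sy; apply: le_trans (cabs_le _) _; rewrite /= !normrM (is_sign_norm sx) (is_sign_norm sy) !mul1r.
  rewrite (gtr0_norm T0); have := cos_max e'; have := sin_max e'; nra.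
have mk : forall k, k = k1 \/ k = k2 -> forall s, cabs (f s) <= expR (- (k * T ^+ 2)) /\ k * T <= `|im s| ->
    cabs (f s) <= expR (- (Num.min k1 k2 * T ^+ 2)) /\ Num.min k1 k2 * T <= `|im s|.
  move=> k hk s [fs ims].
  have kk : Num.min k1 k2 <= k by case: hk => ->; rewrite ge_min lexx ?orbT.
  split; last by apply: le_trans ims; rewrite ler_wpM2r // ltW.
  by apply: le_trans fs _; rewrite ler_expR lerN2 ler_wpM2r // exprn_ge0 // ltW.
split => //.
- move=> s [[t /andP[t0 t1] ->]|[t /andP[t0 t1] ->]]; rewrite segE.
  + apply: (mk k2); [by right|].
    have -> : (1 - t)%:C * gam T + t%:C * corner x2 1 T =
      (1 - t)%:C * ray_point x2 1 e T + t%:C * ray_point x2 1 e0 T + (1 - t)%:C * c2.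
      by rewrite g2 /corner; ring.
    apply: r2; [lra|by rewrite t0 t1|].
    by rewrite cabsM cabs_real ger0_norm ?ler_piMl ?cabs_ge0 //; lra.
  + apply: (mk k1); [by left|].
    have -> : (1 - t)%:C * corner x1 (-1) T + t%:C * gam (- T) =
      (1 - (1 - t))%:C * ray_point x1 (-1) e T + (1 - t)%:C * ray_point x1 (-1) e0 T + t%:C * c1.
      by rewrite g1 /corner subKr; ring.
    apply: r1; [lra|by apply/andP; split; lra|].
    by rewrite cabsM cabs_real ger0_norm ?ler_piMl ?cabs_ge0 //; lra.
- apply: le_trans (cabsD _ _) _; rewrite cabsN g2.
  have := cabsD c2 (ray_point x2 1 e T); have := rp x2 1 e sx2 s1; have := rp x2 1 e0 sx2 s1.
  rewrite /corner; have := cabs_ge0 c1; lra.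
- apply: le_trans (cabsD _ _) _; rewrite cabsN g1.
  have := cabsD c1 (ray_point x1 (-1) e T); have := rp x1 (-1) e sx1 sN1; have := rp x1 (-1) e0 sx1 sN1.
  rewrite /corner; have := cabs_ge0 c2; lra.
Qed.

Lemma curve_far (X : R) : exists T : R, forall t : R, T <= `|t| -> X <= `|im (gam t)|.
Proof.
have [k k0 [C C0 [T0 T00 h]]] := curve_end_bounds.
exists (T0 + `|X| / k) => t tT; have Xk : 0 <= `|X| / k by rewrite divr_ge0 // ltW.
have [h1 _ _ _] := h `|t| ltac:(lra).
have {}h1 : k * `|t| <= `|im (gam t)|.
  have [t0|t0] := leP 0 t.
    rewrite (ger0_norm t0) in h1 *; apply: (h1 _ (or_introl _)).2.
    by exists 0; rewrite ?lexx ?ler01 // /seg mul0r addr0.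
  rewrite (ltr0_norm t0) opprK in h1; rewrite (ltr0_norm t0); apply: (h1 _ (or_intror _)).2.
  by exists 1; rewrite ?lexx ?ler01 // /seg mul1r addrC subrK.
apply: le_trans h1; apply: le_trans (ler_norm X) _.
by rewrite -ler_pdivrMl // mulrC; lra.
Qed.

Lemma closing_path_far (X : R) : \forall T \near +oo, forall s, closing_path T s ->
  X <= `|im s| \/ X <= sigma * re s.
Proof.
have [k k0 [C C0 [T0 T00 h]]] := curve_end_bounds.
have [T1 T10 M1] := near_pinftyE (middle_far sigmaE X sx2 s1 e0P).
have [T2 T20 M2] := near_pinftyE (middle_far sigmaE X sx1 sN1 e0P).
have Xk : 0 <= `|X| / k by rewrite divr_ge0 // ltW.
apply: (@near_pinftyI _ _ (T0 + T1 + T2 + `|X| / k)) => T hT0.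
have hT : T0 <= T by lra.
have hX : `|X| / k <= T by lra.
have [h1 _ _ _] := h T hT.
have {}h1 : forall s, segset (gam T) (corner x2 1 T) s \/ segset (corner x1 (-1) T) (gam (- T)) s ->
  X <= `|im s|.
  move=> s /h1[_]; apply: le_trans; apply: le_trans (ler_norm X) _.
  by rewrite -ler_pdivrMl // mulrC.
move=> s [[[hs|[t t01 ->]]|[t /andP[t0 t1] ->]]|hs].
- by left; apply: h1; left.
- by rewrite segE; apply: M1 => //; lra.
- have -> : seg (sigma * T)%:C (corner x1 (-1) T) t =
    (1 - (1 - t))%:C * ray_point x1 (-1) e0 T + (1 - t)%:C * (sigma * T)%:C.
    by rewrite segE subKr addrC.
  by apply: M2; [lra|apply/andP; split; lra].
- by left; apply: h1; right.
Qed.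

Let sgam : piecewise_smooth gam dgam. Proof. by case: gamP. Qed.

Lemma closing_path_bounded T : cbounded (closing_path T).
Proof. by do 3 (apply: cboundedU; last exact: segset_bounded); exact: segset_bounded. Qed.

Lemma papprox_support : \forall T \near +oo, cbounded (chain_support gam closing_path T) /\
  papprox (chain_support gam closing_path T) f.
Proof.
have cg : forall t, cconv (nbhs t) gam (gam t) by case: sgam.
have comp : \forall x \near +oo, Lam `<=` connected_component (~` range gam : set R[i]^o) (- sigma * x)%:C.
  by case: gamP.
apply: filterS (Lam_poles sigmaE cg curve_far closing_path_far closing_path_bounded B_ge0 Lam_strip
  Lam_finite comp) => T hT.
have bK := chain_support_bounded cg closing_path_bounded T.
by split => //; exact: f_approx.
Qed.

(** The closed chain has integral 0, so the sum estimated here is minus the integral over the two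
    segments adjacent to the curve. Each contributes at most 2 * maximum * length by [sint_le],
    hence the 4. *)
Lemma truncated_integral : exists2 k : R, 0 < k & exists2 C : R, 0 <= C & exists2 T0 : R, 0 < T0 &
  forall T, T0 <= T -> cmeasurable `[- T, T] (fun t => f (gam t) * dgam t) /\
    cabs (cint `[- T, T] (fun t => f (gam t) * dgam t) + corner_integral x1 x2 T) <=
    4 * (expR (- (k * T ^+ 2)) * (4 * T + C)).
Proof.
have [k k0 [C C0 [T0 T00 h]]] := curve_end_bounds.
have [T1 T10 hT1] := near_pinftyE papprox_support.
exists k => //; exists C => //; exists (T0 + T1); first by rewrite addr_gt0.
move=> T hT; have [bK af] := hT1 T ltac:(lra); have [hs l1 l2 _] := h T ltac:(lra).
set K := chain_support _ _ _ in bK af.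
have TT : - T <= T by lra.
have gK t : - T <= t <= T -> K (gam t) by left; exists t.
split; first exact: cmeasurable_papprox af gK.
have k1 : segset (gam T) (corner x2 1 T) `<=` K by move=> s ?; right; left; left; left.
have k2 : segset (corner x2 1 T) (sigma * T)%:C `<=` K by move=> s ?; right; left; left; right.
have k3 : segset (sigma * T)%:C (corner x1 (-1) T) `<=` K by move=> s ?; right; left; right.
have k4 : segset (corner x1 (-1) T) (gam (- T)) `<=` K by move=> s ?; right; right.
have := closed_chain_integral sgam TT bK af gK k1 k2 k3 k4.
have b1 := sint_le bK af k1 (fun s ss => (hs s (or_introl ss)).1).
have b4 := sint_le bK af k4 (fun s ss => (hs s (or_intror ss)).1).
rewrite /corner_integral; move: (cint _ _) (sint f (corner x2 1 T) _) (sint f _ (corner x1 (-1) T)) => x y z.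
move: (sint f (gam T) _) (sint f _ (gam (- T))) b1 b4 => u v b1 b4 E.
have -> : x + (y + z) = - (u + v).
  by apply/eqP; rewrite -subr_eq0 opprK; apply/eqP; rewrite -E; ring.
have ex := expR_ge0 (- (k * T ^+ 2)).
rewrite cabsN; apply: le_trans (cabsD _ _) _.
apply: le_trans (lerD b1 b4) _.
have := ler_wpM2l ex l1; have := ler_wpM2l ex l2; lra.
Qed.

Lemma curve_integrable : cintegrable setT (fun t => f (gam t) * dgam t).
Proof.
have [k k0 [C C0 [T0 T00 hb]]] := curve_end_bounds.
have [k' _ [C' _ [T1 T10 ht]]] := truncated_integral.
have [T2 T20 hp] := near_pinftyE papprox_support.
have mg : cmeasurable setT (fun t => f (gam t) * dgam t).
  have E : setT = \bigcup_n `[- (T1 + n%:R), T1 + n%:R]%classic.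
    apply/seteqP; split=> // t _; exists (Num.bound `|t|) => //=; rewrite in_itv /= -ler_norml.
    by apply: le_trans (ltW (archi_boundP (normr_ge0 t))) _; rewrite lerDr ltW.
  have mI n : measurable (`[- (T1 + n%:R), T1 + n%:R]%classic : set R) by exact: measurable_itv.
  have H n : cmeasurable `[- (T1 + n%:R), T1 + n%:R] (fun t => f (gam t) * dgam t).
    by apply: (ht _ _).1; rewrite lerDl.
  by split; rewrite E; apply/measurable_fun_bigcup => // n; [exact: (H n).1|exact: (H n).2].
pose T3 := T0 + T2; have T30 : 0 < T3 by rewrite addr_gt0.
have [M M0 hM] : exists2 M : R, 0 < M & forall t, - T3 <= t <= T3 -> cabs (f (gam t) * dgam t) <= M.
  have [bK af] := hp T3 ltac:(rewrite /T3; lra).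
  have [M M0 hM] := papprox_bounded bK af.
  have [M' M0' hM'] := curve_derivative_bounded sgam (ltac:(lra) : - T3 <= T3).
  exists (M * M' + 1); first by rewrite ltr_wpDl // mulr_ge0 // ltW.
  move=> t tT; rewrite cabsM; apply: le_trans (ler_pM _ _ (hM _ _) (hM' _ tT)) _; rewrite ?cabs_ge0 ?lerDl //.
  by left; exists t.
(* On |t| <= T3 only the bound [M] is known; there exp(k T3^2) lifts the Gaussian above 1. Outside,
   [curve_end_bounds] applies. *)
have bound t : cabs (f (gam t) * dgam t) <= (1 + M * expR (k * T3 ^+ 2)) * expR (- (k * t ^+ 2)).
  have ex := expR_ge0 (- (k * t ^+ 2)).
  have [tT|tT] := leP `|t| T3.
    apply: le_trans (hM t _) _; first by rewrite -ler_norml.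
    rewrite mulrDl -mulrA -expRD mul1r.
    have : 1 <= expR (k * T3 ^+ 2 - k * t ^+ 2).
      rewrite -expR0 ler_expR -mulrBr mulr_ge0 ?(ltW k0) // subr_ge0.
      by rewrite -(real_normK (num_real t)) lerXn2r ?nnegrE // ltW.
    nra.
  have fb : cabs (f (gam t)) <= expR (- (k * t ^+ 2)) /\ cabs (dgam t) <= 1.
    have [h1 _ _ [d1 d2]] := hb `|t| ltac:(rewrite /T3 in tT; lra).
    rewrite -(real_normK (num_real t)).
    have [t0|t0] := leP 0 t.
      rewrite (ger0_norm t0) in h1 d1 *; split => //; apply: (h1 _ (or_introl _)).1.
      by exists 0; rewrite ?lexx ?ler01 // /seg mul0r addr0.
    rewrite (ltr0_norm t0) opprK in h1 d2; rewrite (ltr0_norm t0); split => //.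
    apply: (h1 _ (or_intror _)).1.
    by exists 1; rewrite ?lexx ?ler01 // /seg mul1r addrC subrK.
  rewrite cabsM; apply: le_trans (ler_pM _ _ fb.1 fb.2) _; rewrite ?cabs_ge0 // mulr1 mulrDl mul1r lerDl.
  by rewrite !mulr_ge0 ?expR_ge0 // ltW.
split.
- apply: (integrable_gaussian_decay k0 mg.1 (M := 1 + M * expR (k * T3 ^+ 2))) => t.
  exact: le_trans (cabs_re _) (bound t).
- apply: (integrable_gaussian_decay k0 mg.2 (M := 1 + M * expR (k * T3 ^+ 2))) => t.
  exact: le_trans (cabs_im _) (bound t).
Qed.

Lemma curve_integral_limit d : 0 < d -> exists N : nat, forall n, (N <= n)%N ->
  cabs (cint setT (fun t => f (gam t) * dgam t) + corner_integral x1 x2 n%:R) < d.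
Proof.
move=> d0; have [k k0 [C C0 [T0 T00 hT]]] := truncated_integral.
have [i1 i2] := curve_integrable.
have d30 : 0 < d / 3 by rewrite divr_gt0.
have /cvgrPdist_lt /(_ _ d30)[N1 _ h1] := integral_symmetric_limit i1.
have /cvgrPdist_lt /(_ _ d30)[N2 _ h2] := integral_symmetric_limit i2.
(* Since exp(- y) <= 1 / y, the error 4 exp(- k n^2) (4 n + C) is at most (16 + 4 C) / (k n) for n
   >= 1, which is below d / 3 for n > X. *)
pose X := 3 * (16 + 4 * C) / (k * d).
have X0 : 0 <= X by rewrite divr_ge0 ?mulr_ge0 ?addr_ge0 ?mulr_ge0 // ltW.
exists (maxn (maxn N1 N2) (maxn (Num.bound T0) (maxn 1 (Num.bound X)))) => n.
rewrite !geq_max => /andP[/andP[n1 n2] /andP[n3 /andP[n4 n5]]].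
have nT : T0 <= n%:R.
  by apply: le_trans (ltW (archi_boundP (ltW T00))) _; rewrite ler_nat.
have nX : X < n%:R.
  by apply: lt_le_trans (archi_boundP X0) _; rewrite ler_nat.
have n_gt0 : 1 <= n%:R :> R by rewrite ler1n.
have [_ htr] := hT _ nT.
set I := cint setT _; set In := cint `[- n%:R, n%:R] _ in htr; set W := corner_integral _ _ _.
rewrite -/W in htr.
have -> : I + W = (I - In) + (In + W) by ring.
apply: le_lt_trans (cabsD _ _) _.
have e1 : cabs (I - In) < d / 3 + d / 3.
  apply: le_lt_trans (cabs_le _) _; rewrite !reimE /=.
  by apply: ltrD; [exact: h1|exact: h2].
suff e2 : cabs (In + W) <= d / 3 by lra.
apply: le_trans htr _.
have y0 : 0 < k * n%:R ^+ 2 by rewrite mulr_gt0 // exprn_gt0 // (lt_le_trans ltr01).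
have e3 : expR (- (k * n%:R ^+ 2)) <= (k * n%:R ^+ 2)^-1.
  rewrite expRN lef_pV2 ?posrE ?expR_gt0 //; apply: le_trans (expR_ge1Dx _).
  by rewrite lerDr.
apply: (@le_trans _ _ (4 * ((k * n%:R ^+ 2)^-1 * (4 * n%:R + C)))).
  by rewrite ler_pM2l // ler_wpM2r // addr_ge0 // mulr_ge0.
rewrite mulrCA mulrC ler_pdivrMr //.
move: nX; rewrite /X ltr_pdivrMr ?mulr_gt0 // => nX.
have h : 4 * (4 * n%:R + C) <= (16 + 4 * C) * n%:R by nra.
apply: le_trans h _; rewrite expr2.
have -> : d / 3 * (k * (n%:R * n%:R)) = (n%:R * (k * d) / 3) * n%:R by field.
by rewrite ler_wpM2r ?ler0n //; lra.
Qed.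

End Curve.

Lemma two_ray_integral_unique x1 x2 e e' gam dgam gam' dgam' :
  is_sign x1 -> is_sign x2 -> 0 < e < pi / 4 -> 0 < e' < pi / 4 ->
  two_ray_curve x1 x2 e gam dgam -> two_ray_curve x1 x2 e' gam' dgam' ->
  cint setT (fun t => f (gam t) * dgam t) = cint setT (fun t => f (gam' t) * dgam' t).
Proof.
move=> sx1 sx2 eP eP' gP gP'; set I := LHS; set I' := RHS.
apply/eqP; rewrite -subr_eq0 -cabs_eq0 eq_le cabs_ge0 andbT leNgt; apply/negP => d0.
have d20 : 0 < cabs (I - I') / 2 by rewrite divr_gt0.
have [N hN] := curve_integral_limit sx1 sx2 eP gP d20.
have [N' hN'] := curve_integral_limit sx1 sx2 eP' gP' d20.
have {hN} h1 := hN _ (leq_maxl N N'); have {hN'} h2 := hN' _ (leq_maxr N N').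
have := ltrD h1 h2; rewrite -splitr; apply/negP; rewrite -leNgt.
rewrite -/I -/I' -[cabs (I' + _)]cabsN; apply: le_trans (cabsD _ _).
by rewrite le_eqVlt; apply/orP; left; apply/eqP; congr cabs; ring.
Qed.

Lemma corner_integral_vanishes e gam dgam : 0 < e < pi / 4 ->
  two_ray_curve sigma sigma e gam dgam ->
  cint setT (fun t => f (gam t) * dgam t) = 0.
Proof.
move=> eP gP; set I := LHS.
have s1 : is_sign (1 : R) by left.
have sN1 : is_sign (-1 : R) by right.
have [T1 T10 hT1] := near_pinftyE (papprox_support sigmaE sigmaE eP gP).
have [k1 k10 r1] := middle_region sigmaE f_decay s1 e0P.
have [k2 k20 r2] := middle_region sigmaE f_decay sN1 e0P.
have [T2 T20 {}r1] := near_pinftyE r1; have [T3 T30 {}r2] := near_pinftyE r2.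
apply/eqP; rewrite -cabs_eq0 eq_le cabs_ge0 andbT leNgt; apply/negP => I0.
have I20 : 0 < cabs I / 2 by rewrite divr_gt0.
have [N hN] := curve_integral_limit sigmaE sigmaE eP gP I20.
pose k := Num.min k1 k2; have k0 : 0 < k by rewrite lt_min k10.
(* For T >= 32 / (k |I|) the corner integral W satisfies |W| <= 16 exp(- k T^2) T <= 16 / (k T) <=
   |I| / 2, which contradicts |I + W| < |I| / 2. *)
pose X := 1 + T1 + T2 + T3 + 32 / (k * cabs I).
have X0 : 0 <= X by rewrite !addr_ge0 ?divr_ge0 ?mulr_ge0 // ltW.
pose n := maxn N (Num.bound X); pose T : R := n%:R.
have TX : X < T by apply: lt_le_trans (archi_boundP X0) _; rewrite ler_nat leq_maxr.
have q0 : 0 < 32 / (k * cabs I) by rewrite divr_gt0 ?mulr_gt0.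
have [bK af] := hT1 T ltac:(rewrite /X in TX; lra).
have T0 : 1 <= T by rewrite /X in TX; lra.
have l (y : R) : is_sign y -> cabs (corner sigma y T - (sigma * T)%:C) <= 4 * T.
  move=> sy; apply: le_trans (cabsD _ _) _; rewrite cabsN cabs_real normrM (is_sign_norm sigmaE) mul1r.
  have := cabs_le (corner sigma y T); rewrite /= !normrM (is_sign_norm sigmaE) (is_sign_norm sy) !mul1r.
  rewrite (ger0_norm (_ : 0 <= T)); last by lra.
  have := cos_max e0; have := sin_max e0; nra.
have kk1 : k <= k1 by rewrite ge_min lexx.
have kk2 : k <= k2 by rewrite ge_min lexx orbT.
have ek k' : k <= k' -> expR (- (k' * T ^+ 2)) <= expR (- (k * T ^+ 2)).
  by move=> kk; rewrite ler_expR lerN2 ler_wpM2r // exprn_ge0 //; lra.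
have b1 : cabs (sint f (corner sigma 1 T) (sigma * T)%:C) <= 2 * (expR (- (k * T ^+ 2)) * (4 * T)).
  apply: le_trans (sint_le bK af (M := expR (- (k * T ^+ 2))) _ _) _.
  - by move=> s ?; right; left; left; right.
  - move=> s [t t01 ->]; rewrite segE; apply: le_trans (ek _ kk1); apply: r1 => //.
    by rewrite /X in TX; lra.
  - by rewrite ler_pM2l // ler_wpM2l ?expR_ge0 // cabsB l.
have b2 : cabs (sint f (sigma * T)%:C (corner sigma (-1) T)) <= 2 * (expR (- (k * T ^+ 2)) * (4 * T)).
  apply: le_trans (sint_le bK af (M := expR (- (k * T ^+ 2))) _ _) _.
  - by move=> s ?; right; left; right.
  - move=> s [t /andP[t0 t1] ->]; apply: le_trans (ek _ kk2).
    have -> : seg (sigma * T)%:C (corner sigma (-1) T) t =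
      (1 - (1 - t))%:C * ray_point sigma (-1) e0 T + (1 - t)%:C * (sigma * T)%:C.
      by rewrite segE subKr addrC.
    apply: r2; last by apply/andP; split; lra.
    by rewrite /X in TX; lra.
  - by rewrite ler_pM2l // ler_wpM2l ?expR_ge0 // l.
have := hN n (leq_maxl _ _); rewrite -/I -/T.
have h0 := cabs_dist I (- corner_integral sigma sigma T).
rewrite opprK cabsN in h0.
have h1 : cabs (corner_integral sigma sigma T) <= 16 * (expR (- (k * T ^+ 2)) * T).
  by apply: le_trans (cabsD _ _) _; lra.
have h2 : 16 * (expR (- (k * T ^+ 2)) * T) <= cabs I / 2.
  have y0 : 0 < k * T ^+ 2 by rewrite mulr_gt0 // exprn_gt0 //; lra.
  have e3 : expR (- (k * T ^+ 2)) <= (k * T ^+ 2)^-1.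
    rewrite expRN lef_pV2 ?posrE ?expR_gt0 //; apply: le_trans (expR_ge1Dx _).
    by rewrite lerDr.
  apply: (@le_trans _ _ (16 * ((k * T ^+ 2)^-1 * T))).
    by rewrite ler_pM2l // ler_wpM2r //; lra.
  rewrite mulrCA mulrC ler_pdivrMr //.
  have : 32 / (k * cabs I) <= T by rewrite /X in TX; lra.
  rewrite ler_pdivrMr ?mulr_gt0 // => h.
  have -> : cabs I / 2 * (k * T ^+ 2) = (T * (k * cabs I)) / 2 * T by field.
  have T0' : 0 <= T by lra.
  have := ler_wpM2r T0' h; lra.
by move=> h3; suff : (1 : R) <= 0 by [rewrite ler10]; lra.
Qed.

Lemma corner_integral_additive e1 e2 e3 e4 g1 g2 g3 g4 d1 d2 d3 d4 :
  0 < e1 < pi / 4 -> 0 < e2 < pi / 4 -> 0 < e3 < pi / 4 -> 0 < e4 < pi / 4 ->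
  two_ray_curve 1 (-1) e1 g1 d1 -> two_ray_curve (-1) 1 e2 g2 d2 ->
  two_ray_curve sigma sigma e3 g3 d3 -> two_ray_curve (- sigma) (- sigma) e4 g4 d4 ->
  cint setT (fun t => f (g1 t) * d1 t) + cint setT (fun t => f (g2 t) * d2 t) =
  cint setT (fun t => f (g4 t) * d4 t).
Proof.
move=> p1 p2 p3 p4 c1 c2 c3 c4.
have s1 : is_sign (1 : R) by left.
have sN1 : is_sign (-1 : R) by right.
have sN : is_sign (- sigma) by case: sigmaE => ->; [right|left; rewrite opprK].
have := corner_integral_vanishes p3 c3.
have l1 d := @curve_integral_limit _ _ _ _ _ s1 sN1 p1 c1 d.
have l2 d := @curve_integral_limit _ _ _ _ _ sN1 s1 p2 c2 d.
have l3 d := @curve_integral_limit _ _ _ _ _ sigmaE sigmaE p3 c3 d.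
have l4 d := @curve_integral_limit _ _ _ _ _ sN sN p4 c4 d.
move: l1 l2 l3 l4; set I1 := cint _ _; set I2 := cint _ _; set I3 := cint _ _; set I4 := cint _ _.
move=> l1 l2 l3 l4 I30; apply/eqP; rewrite -subr_eq0 -cabs_eq0 eq_le cabs_ge0 andbT leNgt.
apply/negP => d0; pose d := cabs (I1 + I2 - I4) / 4.
have dd : 0 < d by rewrite divr_gt0.
have [N1 h1] := l1 _ dd; have [N2 h2] := l2 _ dd.
have [N3 h3] := l3 _ dd; have [N4 h4] := l4 _ dd.
pose n := (N1 + N2 + N3 + N4)%N.
have {}h1 := h1 n ltac:(by rewrite /n -!addnA leq_addr).
have {}h2 := h2 n ltac:(by rewrite /n [(N1 + N2)%N]addnC -!addnA leq_addr).
have {}h3 := h3 n ltac:(by rewrite /n -addnA addnCA leq_addr).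
have {}h4 := h4 n ltac:(by rewrite /n leq_addl).
(* [corner_integral x1 x2] is a term in x2 plus a term in x1, so both sides consist of the same four
   segment integrals. *)
have E : corner_integral 1 (-1) n%:R + corner_integral (-1) 1 n%:R =
    corner_integral sigma sigma n%:R + corner_integral (- sigma) (- sigma) n%:R.
  by rewrite /corner_integral; case: sigmaE => ->; rewrite ?opprK; ring.
have : cabs (I1 + I2 - I4) < d + d + d + d.
  have -> : I1 + I2 - I4 = (I1 + corner_integral 1 (-1) n%:R) + (I2 + corner_integral (-1) 1 n%:R)
    + - (I3 + corner_integral sigma sigma n%:R) + - (I4 + corner_integral (- sigma) (- sigma) n%:R).
    rewrite I30 (_ : corner_integral 1 (-1) n%:R = corner_integral sigma sigma n%:R +
      corner_integral (- sigma) (- sigma) n%:R - corner_integral (-1) 1 n%:R); first by ring.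
    by rewrite -E addrK.
  apply: le_lt_trans (cabsD _ _) _; apply: ltrD; last by rewrite cabsN.
  apply: le_lt_trans (cabsD _ _) _; apply: ltrD; last by rewrite cabsN.
  by apply: le_lt_trans (cabsD _ _) _; apply: ltrD.
by rewrite /d => h; suff : (1 : R) <= 0 by [rewrite ler10]; lra.
Qed.

End ContourIntegral.

(** * Admissible curves: reduction to two rays, and existence *)

Section AdmissibleCurves.
Context {R : realType}.
Implicit Types (gam : R -> R[i]) (g : R -> R).

Lemma near_ninftyI (P : R -> Prop) (T : R) :
  (forall t, t <= - T -> P t) -> \forall t \near -oo, P t.
Proof. by move=> h; exists (- T); split; rewrite ?num_real // => t /ltW /h. Qed.

Lemma cconvP (Fi : set_system R) {FF : Filter Fi} gam (l : R[i]) :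
  cconv Fi gam l <-> (gam : R -> R[i]^o) @ Fi --> (l : R[i]^o).
Proof.
split.
- move=> [/cvgrPdist_lt h1 /cvgrPdist_lt h2]; apply/cvg_cabsP => d d0.
  have d20 : 0 < d / 2 by rewrite divr_gt0.
  apply: filterS2 (h1 _ d20) (h2 _ d20) => t a1 a2.
  apply: le_lt_trans (cabs_le _) _; rewrite !reimE [d]splitr.
  by apply: ltrD; rewrite distrC.
- move=> /cvg_cabsP h; split; apply/cvgrPdist_lt => d /h; apply: filterS => t.
  + by apply: le_lt_trans; rewrite distrC; have := cabs_re (gam t - l); rewrite !reimE.
  + by apply: le_lt_trans; rewrite distrC; have := cabs_im (gam t - l); rewrite !reimE.
Qed.

Lemma is_derive_near_linear g (x y t : R) :
  (\forall u \near t, g u = x * u + y) -> is_derive t (1 : R) g x.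
Proof.
move=> h; apply: (@near_eq_is_derive _ _ _ (fun u => x * u + y)).
  by apply: filterS h => u ->.
apply: (is_derive_eq (is_deriveD (is_deriveM (is_derive_cst x t 1) (is_derive_id t 1))
  (is_derive_cst y t 1))).
by rewrite /GRing.scale /= mulr1 mulr0 !addr0.
Qed.

Lemma piecewise_linear_C1 g (x1 y1 x2 y2 : R) :
  (forall t : R, t < 0 -> g t = x1 * t + y1) -> (forall t : R, 0 < t -> g t = x2 * t + y2) ->
  piecewise_C1 g.
Proof.
move=> h1 h2.
have d1 (t : R) : t < 0 -> is_derive t (1 : R) g x1.
  move=> t0; apply: (@is_derive_near_linear _ _ y1); near=> u; apply: h1.
  by near: u; exact: lt_nbhsl.
have d2 (t : R) : 0 < t -> is_derive t (1 : R) g x2.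
  move=> t0; apply: (@is_derive_near_linear _ _ y2); near=> u; apply: h2.
  by near: u; exact: lt_nbhsr.
have e1 (t : R) : t < 0 -> g^`()%classic t = x1 by move=> /d1 ?; rewrite derive1E derive_val.
have e2 (t : R) : 0 < t -> g^`()%classic t = x2 by move=> /d2 ?; rewrite derive1E derive_val.
exists [:: 0]; split=> t.
- rewrite inE => /lt_total/orP[t0|t0].
  + split; first by have [] := d1 t t0.
    rewrite /prop_for /continuous_at (e1 t t0); apply: cvg_near_cst; near=> u; apply: e1.
    by near: u; exact: lt_nbhsl.
  + split; first by have [] := d2 t t0.
    rewrite /prop_for /continuous_at (e2 t t0); apply: cvg_near_cst; near=> u; apply: e2.
    by near: u; exact: lt_nbhsr.
- rewrite inE => /eqP ->; split; apply/cvg_ex.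
  + by exists x1; apply: cvg_near_cst; near=> u; apply: e1; near: u; exact: nbhs_left_lt.
  + by exists x2; apply: cvg_near_cst; near=> u; apply: e2; near: u; exact: nbhs_right_gt.
Unshelve. all: by end_near.
Qed.

Definition end_sign (d : direction) : R :=
  match d with Rightward | Downward => 1 | Leftward | Upward => -1 end.

Definition start_sign (d : direction) : R :=
  match d with Rightward | Upward => 1 | Leftward | Downward => -1 end.

Lemma end_signP d : is_sign (end_sign d).
Proof. by case: d; [left|right|right|left]. Qed.

Lemma start_signP d : is_sign (start_sign d).
Proof. by case: d; [left|right|left|right]. Qed.

Lemma polar_end d (e t : R) : polar t (angle_end d e) = ray_point (end_sign d) 1 e t.
Proof.
by case: d; rewrite /polar /ray_point /= ?cosB ?sinB ?cospi ?sinpi;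
  apply: complex_ext => /=; ring.
Qed.

Lemma polar_start d (e t : R) : polar t (angle_start d e) = ray_point (start_sign d) (-1) e t.
Proof.
by case: d; rewrite /polar /ray_point /= ?cosD ?sinD ?cosN ?sinN ?cospi ?sinpi;
  apply: complex_ext => /=; ring.
Qed.

Lemma piecewise_smooth_C1 gam : continuous (gam : R -> R[i]^o) ->
  piecewise_C1 (@complex.Re R \o gam) -> piecewise_C1 (@complex.Im R \o gam) ->
  piecewise_smooth gam (curve_deriv gam).
Proof.
move=> cg [s1 [d1 l1]] [s2 [d2 l2]].
have D g (s : seq R) t : (t \notin s -> derivable g t 1 /\ {for t, continuous g^`()%classic}) ->
    t \notin s -> is_derive t (1 : R) g (g^`()%classic t).
  by move=> H /H[+ _]; rewrite derive1E => /derivableP.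
have L g (s : seq R) : (forall t, t \notin s -> derivable g t 1 /\ {for t, continuous g^`()%classic}) ->
    (forall t, t \in s -> cvg (g^`()%classic x @[x --> t^'-]) /\ cvg (g^`()%classic x @[x --> t^'+])) ->
    forall t, cvg (g^`()%classic x @[x --> t^'-]) /\ cvg (g^`()%classic x @[x --> t^'+]).
  move=> H1 H2 t; have [/H2//|/H1[_ c]] := boolP (t \in s).
  by split; apply/cvg_ex; exists (g^`()%classic t); [exact: cvg_at_left_filter|exact: cvg_at_right_filter].
split.
- by move=> t; apply/cconvP; exact: cg.
- exists (s1 ++ s2) => t; rewrite mem_cat negb_or => /andP[t1 t2]; split.
    by split; [exact: D (d1 t) t1|exact: D (d2 t) t2].
  by split; [exact: (d1 t t1).2|exact: (d2 t t2).2].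
- move=> t; have [/cvg_ex[a1 c1] /cvg_ex[a2 c2]] := L _ _ d1 l1 t.
  have [/cvg_ex[b1 c1'] /cvg_ex[b2 c2']] := L _ _ d2 l2 t.
  by split; [exists (a1 +i* b1)|exists (a2 +i* b2)]; split.
Qed.

Lemma curve_deriv_linear gam (t : R) (w z : R[i]) :
  (\forall u \near t, gam u = u%:C * w + z) -> curve_deriv gam t = w.
Proof.
move=> h; apply: complex_ext; rewrite /= derive1E.
- apply: (@derive_val _ _ _ _ _ _ _ (@is_derive_near_linear _ _ (re z) _ _)).
  by apply: filterS h => u /= ->; rewrite !reimE /= mul0r subr0 mulrC.
- apply: (@derive_val _ _ _ _ _ _ _ (@is_derive_near_linear _ _ (im z) _ _)).
  by apply: filterS h => u /= ->; rewrite !reimE /= mul0r addr0 mulrC.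
Qed.

Lemma admissible_two_ray (sigma : R) Lp Lm Lam d (e : R) gam :
  (sigma = 1 /\ Lam = Lm) \/ (sigma = -1 /\ Lam = Lp) ->
  admissible_curve Lp Lm (angle_start d e) (angle_end d e) gam ->
  two_ray_curve sigma Lam (start_sign d) (end_sign d) e gam (curve_deriv gam).
Proof.
move=> sL [[cg ig p1 p2] [c1 h1] [c2 h2] _ [comp1 comp2]].
split; first exact: piecewise_smooth_C1.
- exists c1; have [T T0 h] := near_ninftyE h1; apply: (@near_ninftyI _ (T + 1)) => t tT.
  split; first by rewrite -polar_start; apply: h; lra.
  rewrite (@curve_deriv_linear _ _ (- polar 1 (angle_start d e)) c1).
    by rewrite cabsN cabs_polar1.
  have tT' : t < - T by lra.
  near=> u; rewrite h; last by apply: ltW; near: u; exact: lt_nbhsl.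
  by rewrite polarE rmorphN /=; ring.
- exists c2; have [T T0 h] := near_pinftyE h2; apply: (@near_pinftyI _ _ (T + 1)) => t tT.
  split; first by rewrite -polar_end; apply: h; lra.
  rewrite (@curve_deriv_linear _ _ (polar 1 (angle_end d e)) c2) ?cabs_polar1 //.
  have tT' : T < t by lra.
  near=> u; rewrite h; last by apply: ltW; near: u; exact: lt_nbhsr.
  by rewrite [in LHS]polarE; ring.
- case: sL => [[-> ->]|[-> ->]].
  + have [T T0 h] := near_ninftyE comp2; apply: (@near_pinftyI _ _ T) => t tT.
    by rewrite mulN1r; apply: h; lra.
  + have [T T0 h] := near_pinftyE comp1; apply: (@near_pinftyI _ _ T) => t tT.
    by rewrite opprK mul1r; apply: h.
Unshelve. all: by end_near.
Qed.

(** Two rays issuing from the real point c, in one formula: |t| - t vanishes for t > 0 and equals 2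
    |t| for t < 0, and |t| + t behaves the opposite way. The imaginary part t sin e makes the path
    injective. *)
Definition two_ray_path (c x1 x2 e t : R) : R[i] :=
  (c + cos e / 2 * (x1 * (`|t| - t) + x2 * (`|t| + t))) +i* (t * sin e).

Lemma two_ray_path_neg c x1 x2 e t : t < 0 ->
  two_ray_path c x1 x2 e t = c%:C + ray_point x1 (-1) e (- t).
Proof.
by move=> t0; apply: complex_ext; rewrite !reimE /= ?(ltr0_norm t0); field.
Qed.

Lemma two_ray_path_pos c x1 x2 e t : 0 < t ->
  two_ray_path c x1 x2 e t = c%:C + ray_point x2 1 e t.
Proof.
by move=> t0; apply: complex_ext; rewrite !reimE /= ?(gtr0_norm t0); field.
Qed.

(** The poles lie in the convex half-strip |im| <= B, sigma re <= B. A point of the path in the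
    strip has |t| <= B / sin e, so the apex sigma (B + B / sin e + 1) keeps sigma re >= B + 1 there.
    The half-strip is thus missed, and segments inside it join the poles to - sigma x. *)
Lemma two_ray_path_admissible (sigma B : R) Lp Lm Lam d (e : R) :
  (sigma = 1 /\ Lam = Lm /\ Lp = set0) \/ (sigma = -1 /\ Lam = Lp /\ Lm = set0) ->
  0 <= B -> (forall p, Lam p -> `|im p| <= B) -> (forall p, Lam p -> sigma * re p <= B) ->
  0 < e < pi / 4 ->
  admissible_curve Lp Lm (angle_start d e) (angle_end d e)
    (two_ray_path (sigma * (B + B / sin e + 1)) (start_sign d) (end_sign d) e).
Proof.
move=> sL B0 L1 L2 eP.
have [s0 _ hc c1] := sin_cos_pi4 eP.
have s_sign : is_sign sigma by case: sL => [[-> _]|[-> _]]; [left|right].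
have cose0 : 0 < cos e.
  by have [? ? ? _] := sin_cos_pi4 eP; apply: lt_trans hc; apply: lt_trans s0 _.
set c := sigma * _; set x1 := start_sign d; set x2 := end_sign d.
have sx1 : is_sign x1 := start_signP d.
have sx2 : is_sign x2 := end_signP d.
set gam := two_ray_path _ _ _ _.
have hn (t : R) : t < 0 -> gam t = c%:C + ray_point x1 (-1) e (- t) by exact: two_ray_path_neg.
have hp (t : R) : 0 < t -> gam t = c%:C + ray_point x2 1 e t by exact: two_ray_path_pos.
have avoid p : `|im p| <= B -> sigma * re p <= B -> (~` range gam) p.
  move=> p1 p2 [t _ E]; move: p1 p2; rewrite -E /= normrM (gtr0_norm s0) -ler_pdivlMr //.
  move=> tB; apply/negP; rewrite -ltNge mulrDr {1}/c mulrA -expr2.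
  have -> : sigma ^+ 2 = 1 by case: s_sign => ->; rewrite ?sqrrN expr1n.
  rewrite mul1r.
  have k : `|sigma * (cos e / 2 * (x1 * (`|t| - t) + x2 * (`|t| + t)))| <= `|t|.
    rewrite normrM (is_sign_norm s_sign) mul1r normrM ger0_norm; last by rewrite divr_ge0 // ltW.
    have a1 := ler_norm t; have a2 := ler_norm (- t); rewrite normrN in a2.
    have : `|x1 * (`|t| - t) + x2 * (`|t| + t)| <= 2 * `|t|.
      apply: le_trans (ler_normD _ _) _; rewrite !normrM (is_sign_norm sx1) (is_sign_norm sx2) !mul1r.
      have b1 : 0 <= `|t| - t by lra.
      have b2 : 0 <= `|t| + t by lra.
      by rewrite (ger0_norm b1) (ger0_norm b2); lra.
    have := normr_ge0 (x1 * (`|t| - t) + x2 * (`|t| + t)); move: `|_ + _| => y; nra.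
  have := ler_norm (- (sigma * (cos e / 2 * (x1 * (`|t| - t) + x2 * (`|t| + t))))).
  rewrite normrN; lra.
have LA : Lam `<=` ~` range gam by move=> p Lp'; apply: avoid; [exact: L1|exact: L2].
have comp x p : B <= x -> Lam p ->
    connected_component (~` range gam : set R[i]^o) (- sigma * x)%:C p.
  move=> Bx Lp'; pose q : R[i] := (- sigma * x)%:C.
  have [c0 _ _] := seg_smooth q p.
  have H : (seg q p : R -> R[i]^o) @` `[0, 1] `<=` connected_component (~` range gam : set R[i]^o) q.
    apply: connected_component_max.
    - by exists 0; rewrite /= ?in_itv /= ?lexx ?ler01 // /seg mul0r addr0.
    - move=> y [t /=]; rewrite in_itv /= => /andP[t0 t1] <-; apply: avoid.
        rewrite segE !reimE /= !mul0r !addr0 mulr0 add0r normrM (ger0_norm t0).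
        by have := L1 p Lp'; have := normr_ge0 (im p); nra.
      rewrite segE !reimE /= !mul0r !subr0 mulrDr.
      have -> : sigma * ((1 - t) * (- sigma * x)) = - (sigma ^+ 2 * ((1 - t) * x)) by ring.
      have -> : sigma ^+ 2 = 1 by case: s_sign => ->; rewrite ?sqrrN expr1n.
      by have := L2 p Lp'; nra.
    - apply: connected_continuous_connected; first by apply/connected_intervalP; exact: interval_is_interval.
      by apply: continuous_subspaceT => t; apply/cconvP; exact: c0.
  by apply: H; exists 1; rewrite /= ?in_itv /= ?lexx ?ler01 // /seg mul1r addrC subrK.
split.
- split.
  + move=> t; apply/cconvP; split; rewrite /gam /=.
      apply: cvgD; first exact: cvg_cst.
      apply: cvgM; first exact: cvg_cst.
      by apply: cvgD; (apply: cvgM; first exact: cvg_cst); [apply: cvgB|apply: cvgD];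
        try exact: cvg_id; exact: norm_continuous.
    by apply: cvgM; [exact: cvg_id|exact: cvg_cst].
  + by move=> t u /(congr1 im) /= /(mulIf (lt0r_neq0 s0)).
  + apply: (@piecewise_linear_C1 _ (- x1 * cos e) c (x2 * cos e) c) => t t0 /=.
      by rewrite (ltr0_norm t0); field.
    by rewrite (gtr0_norm t0); field.
  + by apply: (@piecewise_linear_C1 _ (sin e) 0 (sin e) 0) => t t0 /=; ring.
- exists c%:C; apply: (@near_ninftyI _ 1) => t t1; rewrite polar_start; apply: hn; lra.
- exists c%:C; apply: (@near_pinftyI _ _ 1) => t t1; rewrite polar_end; apply: hp; lra.
- by case: sL => [[_ [<- ->]]|[_ [<- ->]]]; rewrite ?set0U ?setU0 => p /LA.
- case: sL => [[se [<- ->]]|[se [<- ->]]]; split.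
  + by apply: (@near_pinftyI _ _ 0) => x _ p [].
  + apply: (@near_ninftyI _ B) => x xB p Lp'; have := @comp (- x) p; rewrite se mulN1r opprK; apply => //; lra.
  + by apply: (@near_pinftyI _ _ B) => x xB p Lp'; have := @comp x p xB Lp'; rewrite se opprK mul1r.
  + by apply: (@near_ninftyI _ 0) => x _ p [].
Qed.

End AdmissibleCurves.

(** * Infinite products *)

Section InfiniteProducts.
Context {R : realType}.
Implicit Types (s z : R[i]).

Lemma expR_le_inv (x : R) : x < 1 -> expR x <= (1 - x)^-1.
Proof.
move=> x1; have h : 1 - x <= expR (- x) by have := expR_ge1Dx (- x).
by rewrite -[expR x]invrK -expRN lef_pV2 ?posrE ?expR_gt0 // subr_gt0.
Qed.

Lemma expR_sub1_le (x : R) : 0 <= x <= 2^-1 -> expR x - 1 <= 2 * x.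
Proof.
move=> /andP[x0 x2]; have x1 : x < 1 by lra.
rewrite lerBlDr; apply: le_trans (expR_le_inv x1) _.
rewrite -[leLHS]div1r ler_pdivrMr ?subr_gt0 //; nra.
Qed.

Lemma prod_sub1_le (I : Type) (r : seq I) (y : I -> R[i]) :
  cabs (\prod_(i <- r) (1 + y i) - 1) <= expR (\sum_(i <- r) cabs (y i)) - 1.
Proof.
elim: r => [|i r ih]; first by rewrite !big_nil subrr cabs0 expR0 subrr.
rewrite !big_cons expRD; move: (\prod_(_ <- _) _) (\sum_(_ <- _) _) ih => P S ih.
have -> : (1 + y i) * P - 1 = (1 + y i) * (P - 1) + y i by ring.
apply: le_trans (cabsD _ _) _; rewrite cabsM.
have h1 : cabs (1 + y i) <= 1 + cabs (y i) by rewrite -[X in X + cabs _]cabs1 cabsD.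
have h2 := expR_ge1Dx (cabs (y i)); have h3 := cabs_ge0 (y i); have h4 := expR_gt0 S.
have h5 := ler_pM (cabs_ge0 _) (cabs_ge0 _) h1 ih.
nra.
Qed.

Lemma exp_sub1_le (x : R[i]) n : cabs ((1 + x) ^+ n - 1) <= expR (n%:R * cabs x) - 1.
Proof.
have := prod_sub1_le (iota 0 n) (fun=> x).
rewrite !big_const_seq !count_predT !size_iota iter_addr addr0 mulr_natl.
by rewrite iter_mulr mulr1.
Qed.

(** The approximants are (1 + h / n)^n. With v = z / n and 1 + x = (1 + v) exp(- v) one has (1 +
    v)^n = exp(z) (1 + x)^n, and x = O(1 / n^2) by [cexp_order2]. *)
Lemma papprox_cexp (K : set R[i]) h : cbounded K -> papprox K h -> papprox K (fun s => cexp (h s)).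
Proof.
move=> bK ah; have [M M0 hM] := papprox_bounded bK ah.
apply: papprox_lim => e e0.
pose C := 2 * (M ^+ 2 * expR M); have C0 : 0 < C by rewrite !mulr_gt0 ?exprn_gt0 ?expR_gt0.
(* The three summands ensure n > 1, C / n <= 1/2 and a final error of at most e. *)
pose X := 1 + 2 * C + expR M * (2 * C) / e.
have X0 : 0 <= X by rewrite !addr_ge0 ?divr_ge0 ?mulr_ge0 ?expR_ge0 // ltW.
pose n := Num.bound X; have nX : X < n%:R := archi_boundP X0.
have eX : 0 <= expR M * (2 * C) / e by rewrite divr_ge0 ?mulr_ge0 ?expR_ge0 // ltW.
have n1 : 1 < n%:R :> R by rewrite /X in nX; lra.
have n0 : 0 < n%:R :> R by lra.
exists (fun s => (1 + n%:R^-1 * h s) ^+ n).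
  apply: papproxX => //; apply: papproxD; first exact: papprox_cst.
  exact: papproxZ.
move=> s Ks; set z := h s; have zM : cabs z <= M by exact: hM.
pose v := n%:R^-1 * z; have vE : z = v *+ n.
  by rewrite /v -mulr_natl mulrA mulfV ?mul1r // pnatr_eq0; move: n0; rewrite ltr0n lt0n.
have vM : cabs v <= M / n%:R.
  by rewrite /v cabsM cabsV natC cabs_real ger0_norm ?ler0n // mulrC ler_wpM2r // invr_ge0 ler0n.
have vM' : cabs v <= M.
  by apply: le_trans vM _; rewrite ler_pdivrMr // ler_peMr // ltW.
pose x := (1 + v) * cexp (- v) - 1.
have xC : cabs x <= C / n%:R ^+ 2.
  apply: le_trans (cexp_order2 v) _.
  have -> : C / n%:R ^+ 2 = 2 * ((M / n%:R) ^+ 2 * expR M).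
    by rewrite /C; field; rewrite gt_eqF.
  rewrite ler_pM2l // ler_pM ?exprn_ge0 ?cabs_ge0 ?expR_ge0 ?ler_expR //.
  by rewrite lerXn2r ?nnegrE ?cabs_ge0 // divr_ge0 // ltW.
have E : cexp z - (1 + v) ^+ n = - (cexp z * ((1 + x) ^+ n - 1)).
  have -> : 1 + x = (1 + v) * cexp (- v) by rewrite /x addrC subrK.
  have -> : (1 + v) ^+ n = (1 + v) ^+ n * (cexp (- v) * cexp v) ^+ n.
    by rewrite -cexpD addNr cexp0 expr1n mulr1.
  by rewrite vE cexpX !exprMn; ring.
rewrite -/z -/v E cabsN cabsM cabs_cexp.
have nx : n%:R * cabs x <= C / n%:R.
  have -> : C / n%:R = n%:R * (C / n%:R ^+ 2) by field; rewrite gt_eqF.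
  by rewrite ler_pM2l.
have h1 : C / n%:R <= 2^-1.
  by rewrite ler_pdivrMr //; rewrite /X in nX; lra.
have h2 : cabs ((1 + x) ^+ n - 1) <= 2 * (C / n%:R).
  apply: le_trans (exp_sub1_le x n) _; apply: le_trans (expR_sub1_le _) _.
    by rewrite mulr_ge0 ?cabs_ge0 ?ler0n //= (le_trans nx).
  by rewrite ler_pM2l.
have h3 : expR (re z) <= expR M by rewrite ler_expR; exact: le_trans (re_le_cabs z) zM.
apply: le_trans (ler_pM (expR_ge0 _) (cabs_ge0 _) h3 h2) _.
have -> : expR M * (2 * (C / n%:R)) = expR M * (2 * C) / n%:R by field; rewrite gt_eqF.
rewrite ler_pdivrMr // [leRHS]mulrC -ler_pdivrMr //; rewrite /X in nX; lra.
Qed.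

(* The pairs with max(k, l) = K, by which the square of side K + 1 exceeds the
   square of side K. *)
Definition layer (K : nat) : seq (nat * nat) :=
  [seq (k, K) | k <- iota 0 K] ++ [seq (K, l) | l <- iota 0 K.+1].

Lemma size_layer K : size (layer K) = (K + K.+1)%N.
Proof. by rewrite size_cat !size_map !size_iota. Qed.

(** Stated for any commutative monoid law because it serves both the products of factors and the
    sums of weights. *)
Lemma big_square_recr (T : Type) (idx : T) (op : Monoid.com_law idx) (F : nat -> nat -> T) K :
  \big[op/idx]_(k < K.+2) \big[op/idx]_(l < K.+2 | (0 < k + l)%N) F k l =
  op (\big[op/idx]_(k < K.+1) \big[op/idx]_(l < K.+1 | (0 < k + l)%N) F k l)
     (\big[op/idx]_(x <- layer K.+1) F x.1 x.2).
Proof.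
rewrite big_ord_recr /= big_cat !big_map /=.
have -> : \big[op/idx]_(i < K.+2 | (0 < K.+1 + i)%N) F K.+1 i = \big[op/idx]_(i <- iota 0 K.+2) F K.+1 i.
  by rewrite (_ : iota 0 K.+2 = index_iota 0 K.+2) ?big_mkord // /index_iota subn0.
have -> : \big[op/idx]_(k <- iota 0 K.+1) F k K.+1 = \big[op/idx]_(k < K.+1) F k K.+1.
  by rewrite -(big_mkord xpredT (fun k => F k K.+1)) /index_iota subn0.
rewrite Monoid.mulmA; congr (op _ _); apply: etrans; last exact: (@big_split _ idx op).
apply: eq_bigr => k _.
rewrite big_mkcond big_ord_recr /= -big_mkcond /=.
by rewrite addnS.
Qed.

Lemma big_square1 (T : Type) (idx : T) (op : Monoid.com_law idx) (F : nat -> nat -> T) :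
  \big[op/idx]_(k < 1) \big[op/idx]_(l < 1 | (0 < k + l)%N) F k l = idx.
Proof. by rewrite big_ord1 big_mkcond big_ord1 /=. Qed.

Lemma cauchy_rate_cvg (u : nat -> R) (C : R) (K0 : nat) :
  (forall m n, (K0 <= m <= n)%N -> `|u n - u m| <= C / m%:R) -> cvg (u @ \oo).
Proof.
move=> h; apply: cauchy_cvg; apply: cauchy_exP => e e0.
have Ce : 0 <= `|C| / e by rewrite divr_ge0 // ltW.
pose m := (maxn K0 (Num.bound (`|C| / e))).+1.
exists (u m); exists m => // n /= mn.
rewrite -ball_normE /ball_ /= distrC; apply: le_lt_trans (h m n _) _.
  by rewrite mn andbT (leq_trans (leq_maxl _ _) (leqnSn _)).
have m0 : 0 < m%:R :> R by rewrite ltr0n.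
rewrite ltr_pdivrMr // mulrC -ltr_pdivrMr //.
apply: le_lt_trans (_ : `|C| / e < _).
  by rewrite ler_pM2r ?invr_gt0 // ler_norm.
apply: lt_le_trans (archi_boundP Ce) _; rewrite ler_nat.
exact: leq_trans (leq_maxr _ _) (leqnSn _).
Qed.

(** The increments are dominated by a telescoping series: the products stay below M0 exp(D) and are
    Cauchy at the rate M D / K, uniformly on A. *)
Lemma product_limit (A : set R[i]) (Q : nat -> R[i] -> R[i]) (D : R) (K0 : nat) :
  cbounded A -> (0 < K0)%N -> 0 <= D -> (forall K, papprox A (Q K)) ->
  (forall K s, (K0 <= K)%N -> A s -> exists2 d, Q K.+1 s = Q K s * (1 + d) &
     cabs d <= D * (K%:R^-1 - K.+1%:R^-1)) ->
  papprox A (fun s => clim (Q ^~ s)) /\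
  forall s, A s -> forall d : R, 0 < d ->
    exists N : nat, forall K, (N <= K)%N -> cabs (Q K s - clim (Q ^~ s)) < d.
Proof.
move=> bA K00 D0 aQ rec.
have [M0 M00 hM0] := papprox_bounded bA (aQ K0).
have inv_le (K : nat) : (K0 <= K)%N -> 0 < (K.+1%:R^-1 : R) <= K%:R^-1.
  move=> K0K; rewrite invr_gt0 ltr0n /= lef_pV2 ?posrE ?ltr0n ?ler_nat //.
  exact: leq_trans K0K.
have bound K s : (K0 <= K)%N -> A s -> cabs (Q K s) <= M0 * expR (D * (K0%:R^-1 - K%:R^-1)).
  move=> K0K As; rewrite -(subnK K0K); elim: (K - K0)%N => [|i ih].
    by rewrite add0n subrr mulr0 expR0 mulr1 hM0.
  rewrite addSn; have [d -> hd] := rec (i + K0)%N s (leq_addl _ _) As.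
  rewrite cabsM.
  have -> : D * (K0%:R^-1 - (i + K0).+1%:R^-1) = D * (K0%:R^-1 - (i + K0)%:R^-1) +
    D * ((i + K0)%:R^-1 - (i + K0).+1%:R^-1) by ring.
  rewrite expRD mulrA; apply: ler_pM => //; rewrite ?cabs_ge0 //.
  apply: le_trans (cabsD _ _) _; rewrite cabs1; apply: le_trans (expR_ge1Dx _).
  by rewrite lerD2l.
pose M := M0 * expR D; have M0' : 0 < M by rewrite mulr_gt0 ?expR_gt0.
have boundM K s : (K0 <= K)%N -> A s -> cabs (Q K s) <= M.
  move=> K0K As; apply: le_trans (bound K s K0K As) _; rewrite ler_pM2l // ler_expR.
  rewrite ler_piMr //.
  have h1 : K0%:R^-1 <= 1 :> R by rewrite invf_le1 ?ltr0n // ler1n.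
  have h2 : 0 <= K%:R^-1 :> R by rewrite invr_ge0 ler0n.
  lra.
have rate s m n : A s -> (K0 <= m <= n)%N ->
    cabs (Q n s - Q m s) <= M * D * (m%:R^-1 - n%:R^-1).
  move=> As /andP[K0m mn]; rewrite -(subnK mn); elim: (n - m)%N => [|i ih].
    by rewrite add0n !subrr cabs0 mulr0.
  have K0i : (K0 <= i + m)%N by exact: leq_trans K0m (leq_addl _ _).
  rewrite addSn; have [d -> hd] := rec (i + m)%N s K0i As.
  have -> : Q (i + m)%N s * (1 + d) - Q m s = (Q (i + m)%N s - Q m s) + Q (i + m)%N s * d by ring.
  have -> : M * D * (m%:R^-1 - (i + m).+1%:R^-1) = M * D * (m%:R^-1 - (i + m)%:R^-1) +
    M * (D * ((i + m)%:R^-1 - (i + m).+1%:R^-1)) by ring.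
  apply: le_trans (cabsD _ _) _; apply: lerD => //; rewrite cabsM.
  by apply: ler_pM; rewrite ?cabs_ge0 //; exact: boundM.
have rate' s m n : A s -> (K0 <= m <= n)%N -> cabs (Q n s - Q m s) <= M * D / m%:R.
  move=> As mn; apply: le_trans (rate s m n As mn) _.
  have MD : 0 <= M * D by rewrite mulr_ge0 // ltW.
  by apply: ler_wpM2l => //; rewrite gerBl invr_ge0 ler0n.
have lim s : A s -> forall d : R, 0 < d ->
    exists N : nat, forall K, (N <= K)%N -> cabs (Q K s - clim (Q ^~ s)) < d.
  move=> As.
  have c1 : cvg ((fun n => re (Q n s)) @ \oo).
    apply: (@cauchy_rate_cvg _ (M * D) K0) => m n mn; apply: le_trans (rate' s m n As mn).
    by have := cabs_re (Q n s - Q m s); rewrite !reimE.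
  have c2 : cvg ((fun n => im (Q n s)) @ \oo).
    apply: (@cauchy_rate_cvg _ (M * D) K0) => m n mn; apply: le_trans (rate' s m n As mn).
    by have := cabs_im (Q n s - Q m s); rewrite !reimE.
  have /cvg_ex[l1 /cvgrPdist_lt h1] := c1; have /cvg_ex[l2 /cvgrPdist_lt h2] := c2.
  have H (d : R) : 0 < d -> exists N : nat, forall K, (N <= K)%N -> cabs (Q K s - (l1 +i* l2)) < d.
    move=> d0; have d20 : 0 < d / 2 by rewrite divr_gt0.
    have [N1 _ {}h1] := h1 _ d20; have [N2 _ {}h2] := h2 _ d20.
    exists (maxn N1 N2) => K; rewrite geq_max => /andP[n1 n2].
    apply: le_lt_trans (cabs_le _) _; rewrite !reimE /= [d]splitr; apply: ltrD; rewrite distrC.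
      exact: h1.
    exact: h2.
  by rewrite (clim_eq H).
split => //; apply: papprox_lim => e e0.
pose X := M * D / e; have X0 : 0 <= X by rewrite divr_ge0 ?mulr_ge0 // ltW.
pose m := (maxn K0 (Num.bound X)).+1; exists (Q m) => // s As.
have m0 : 0 < m%:R :> R by rewrite ltr0n.
have Xm : M * D / m%:R <= e.
  rewrite ler_pdivrMr // [leRHS]mulrC -ler_pdivrMr //; apply: le_trans (ltW (archi_boundP X0)) _.
  by rewrite ler_nat (leq_trans (leq_maxr _ _) (leqnSn _)).
apply/ler_addgt0Pr => d d0; have [N hN] := lim s As d d0.
pose n := maxn m N.
have -> : clim (Q ^~ s) - Q m s = (Q n s - Q m s) - (Q n s - clim (Q ^~ s)) by ring.
apply: le_trans (cabsD _ _) _; rewrite cabsN; apply: lerD; last by rewrite ltW // hN // leq_maxr.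
apply: le_trans (rate' s m n As _) Xm.
by rewrite leq_maxl andbT (leq_trans (leq_maxl _ _) (leqnSn _)).
Qed.

End InfiniteProducts.

(** * Convergence of the Barnes product and of its reciprocal *)

Section BarnesProduct.
Context {R : realType}.
Variables (tau : R) (tau_gt0 : 0 < tau).
Implicit Types (s z u : R[i]) (r w : R).

Definition lattice (k l : nat) : R := k%:R * tau + l%:R.
Local Notation wt := lattice.

(** The periods of layer K lie between c K and (1 + tau) K. *)
Let c : R := Num.min 1 tau.
Let c0 : 0 < c. Proof. by rewrite lt_min ltr01. Qed.
Let c1 : c <= 1. Proof. by rewrite ge_min lexx. Qed.
Let ct : c <= tau. Proof. by rewrite ge_min lexx orbT. Qed.

Lemma lattice_gt0 k l : (0 < k + l)%N -> c <= wt k l.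
Proof.
rewrite /wt addn_gt0 => /orP[h|h].
  have : 1 <= k%:R :> R by rewrite ler1n.
  have : 0 <= l%:R :> R by rewrite ler0n.
  have := ct; have := tau_gt0; nra.
have : 1 <= l%:R :> R by rewrite ler1n.
have : 0 <= k%:R :> R by rewrite ler0n.
have := c1; have := tau_gt0; nra.
Qed.

Lemma layer_bounds K x : x \in layer K -> c * K%:R <= wt x.1 x.2 <= (1 + tau) * K%:R.
Proof.
have t0 := tau_gt0; have cc1 := c1; have cct := ct; have K0 : 0 <= K%:R :> R by rewrite ler0n.
rewrite mem_cat => /orP[/mapP[k]|/mapP[l]]; rewrite mem_iota add0n => /andP[_ h] -> /=; rewrite /wt.
- have k0 : 0 <= k%:R :> R by rewrite ler0n.
  have kK : k%:R <= K%:R :> R by rewrite ler_nat ltnW.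
  by apply/andP; split; nra.
- have l0 : 0 <= l%:R :> R by rewrite ler0n.
  have lK : l%:R <= K%:R :> R by rewrite ler_nat -ltnS.
  by apply/andP; split; nra.
Qed.

Lemma layer_pos K x : x \in layer K.+1 -> (0 < x.1 + x.2)%N.
Proof. by rewrite mem_cat => /orP[/mapP[k _ ->]|/mapP[l _ ->]] /=; rewrite ?addnS ?addSn. Qed.

Lemma sum_le_size (I : eqType) (q : seq I) (g : I -> R) (b : R) :
  (forall x, x \in q -> g x <= b) -> \sum_(x <- q) g x <= (size q)%:R * b.
Proof.
move=> h; elim: q h => [|x q ih] h; first by rewrite big_nil mul0r.
rewrite big_cons /= -natr1 mulrDl mul1r addrC lerD ?h ?mem_head // ih // => y yq.
by rewrite h // inE yq orbT.
Qed.

Lemma sum_ge_size (I : eqType) (q : seq I) (g : I -> R) (b : R) :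
  (forall x, x \in q -> b <= g x) -> (size q)%:R * b <= \sum_(x <- q) g x.
Proof.
move=> h; elim: q h => [|x q ih] h; first by rewrite big_nil mul0r.
rewrite big_cons /= -natr1 mulrDl mul1r addrC lerD ?h ?mem_head // ih // => y yq.
by rewrite h // inE yq orbT.
Qed.

Definition square_prod (F : nat -> nat -> R[i]) K : R[i] :=
  \prod_(k < K) \prod_(l < K | (0 < k + l)%N) F k l.

(** Layer K has 2 K + 1 factors, each within C / (c K)^3 of 1. The total deviation O(1 / K^2) is put
    in the telescoping form required by [product_limit]. *)
Lemma square_product_limit (A : set R[i]) (F : nat -> nat -> R[i] -> R[i]) (W C : R) :
  cbounded A -> 0 <= C -> (forall k l, (0 < k + l)%N -> papprox A (F k l)) ->
  (forall k l s, (0 < k + l)%N -> W <= wt k l -> A s -> cabs (F k l s - 1) <= C / wt k l ^+ 3) ->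
  papprox A (fun s => clim (square_prod (fun k l => F k l s))) /\
  forall s, A s -> forall d : R, 0 < d -> exists N : nat, forall K, (N <= K)%N ->
    cabs (square_prod (fun k l => F k l s) K - clim (square_prod (fun k l => F k l s))) < d.
Proof.
move=> bA C0 aF close.
(* The 6 comes from (2 t + 1) t (t + 1) <= 6 t^3 for t >= 1, used with t = K + 1. *)
pose S := 6 * C / c ^+ 3; have S0 : 0 <= S by rewrite divr_ge0 ?mulr_ge0 ?exprn_ge0 // ltW.
pose X := `|W| / c; have X0 : 0 <= X by rewrite divr_ge0 // ltW.
pose Q K s := square_prod (fun k l => F k l s) K.
apply: (@product_limit _ A Q (2 * S) (maxn (Num.bound (2 * S)) (Num.bound X)).+1) => //.
- by rewrite mulr_ge0.
- move=> K; apply: papprox_prod => // k _; apply: papprox_prod => // l; exact: aF.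
move=> [//|K] s; rewrite ltnS geq_max => /andP[K1 K2] As.
exists (\prod_(x <- layer K.+1) F x.1 x.2 s - 1).
  by rewrite addrC subrK /Q /square_prod (@big_square_recr _ 1 *%R (fun k l => F k l s)).
have KR : 1 <= K.+1%:R :> R by rewrite ler1n.
have hX : `|W| <= c * K.+1%:R.
  rewrite -ler_pdivrMl // mulrC; apply: le_trans (ltW (archi_boundP X0)) _.
  by rewrite ler_nat leqW.
have hS : 2 * S <= K.+1%:R.
  by apply: le_trans (ltW (archi_boundP (mulr_ge0 (ler0n _ 2) S0))) _; rewrite ler_nat leqW.
pose y (x : nat * nat) := F x.1 x.2 s - 1.
have -> : \prod_(x <- layer K.+1) F x.1 x.2 s = \prod_(x <- layer K.+1) (1 + y x).
  by apply: eq_bigr => x _; rewrite /y addrC subrK.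
have sum_le : \sum_(x <- layer K.+1) cabs (y x) <= S * (K.+1%:R^-1 - K.+2%:R^-1).
  have : \sum_(x <- layer K.+1) cabs (y x) <= (size (layer K.+1))%:R * (C / (c * K.+1%:R) ^+ 3).
    apply: sum_le_size => x xl; have /andP[w1 _] := layer_bounds xl.
    have cK : 0 < c * K.+1%:R by rewrite mulr_gt0 // ltr0n.
    apply: le_trans (close _ _ _ (layer_pos xl) _ As) _.
      by apply: le_trans (ler_norm W) (le_trans hX w1).
    rewrite ler_wpM2l // lef_pV2 ?posrE ?exprn_gt0 ?(lt_le_trans cK) //.
    by rewrite lerXn2r ?nnegrE ?(ltW cK) // (le_trans (ltW cK)).
  move/le_trans; apply; rewrite size_layer.
  have -> : (K.+1 + K.+2)%:R = 2 * K.+1%:R + 1 :> R by rewrite natrD -[K.+2%:R]natr1; ring.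
  have -> : K.+2%:R = K.+1%:R + 1 :> R by rewrite -natr1.
  move: (K.+1%:R) KR => t t1; have t0 : 0 < t by lra.
  have -> : S * (t^-1 - (t + 1)^-1) = C / c ^+ 3 * (6 / (t * (t + 1))).
    by rewrite /S; field; rewrite !gt_eqF //; lra.
  have -> : (2 * t + 1) * (C / (c * t) ^+ 3) = C / c ^+ 3 * ((2 * t + 1) / t ^+ 3).
    by field; rewrite !gt_eqF.
  rewrite ler_wpM2l ?divr_ge0 ?exprn_ge0 ?(ltW c0) //.
  rewrite ler_pdivrMr ?exprn_gt0 // mulrAC ler_pdivlMr ?mulr_gt0 ?addr_gt0 //.
  have tt : 0 <= t ^+ 3 - t by rewrite exprS; nra.
  rewrite (_ : (2 * t + 1) * (t * (t + 1)) = 2 * t ^+ 3 + 3 * t ^+ 2 + t); last by ring.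
  have : t ^+ 2 <= t ^+ 3 by rewrite [leRHS]exprS ler_peMl ?exprn_ge0 // ltW.
  lra.
apply: le_trans (prod_sub1_le _ _) _; apply: le_trans (expR_sub1_le _) _.
  rewrite sumr_ge0 => [/=|x _]; last exact: cabs_ge0.
  apply: le_trans sum_le _.
  have h1 : K.+1%:R^-1 - K.+2%:R^-1 <= K.+1%:R^-1 :> R by rewrite gerBl invr_ge0 ler0n.
  apply: le_trans (ler_wpM2l S0 h1) _.
  by rewrite ler_pdivrMr ?ltr0n //; lra.
by rewrite -mulrA ler_pM2l.
Qed.

Lemma barnes_factorE z k l : barnes_factor tau z k l =
  (1 + z / (wt k l)%:C) * cexp (- (z / (wt k l)%:C) + (z / (wt k l)%:C) ^+ 2 / 2).
Proof.
by rewrite /barnes_factor -/(wt k l) exprMn exprVn invfM; congr (_ * cexp (_ + _)); ring.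
Qed.

(** Put x = z / w, so |x| <= 1/4 and exp(|x| + |x|^2) <= 2 in [cexp_order3]. The factor is then
    within 1/16 of 1, hence at least 1/2 in modulus, and inversion at most doubles its deviation. *)
Lemma barnes_factor_close z k l : 0 < wt k l -> 4 * cabs z <= wt k l ->
  cabs (barnes_factor tau z k l - 1) <= 4 * (cabs z ^+ 3 / wt k l ^+ 3) /\
  cabs ((barnes_factor tau z k l)^-1 - 1) <= 8 * (cabs z ^+ 3 / wt k l ^+ 3).
Proof.
move=> w0 zw; rewrite barnes_factorE; set x := z / _.
have xE : cabs x = cabs z / wt k l.
  by rewrite cabsM cabsV cabs_real gtr0_norm.
have -> : cabs z ^+ 3 / wt k l ^+ 3 = cabs x ^+ 3 by rewrite xE exprMn exprVn.
have x4 : cabs x <= 4^-1 by rewrite xE ler_pdivrMr //; lra.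
have x0 := cabs_ge0 x.
have ex : expR (cabs x + cabs x ^+ 2) <= 2.
  have h : cabs x + cabs x ^+ 2 <= 5 / 16 by rewrite expr2; nra.
  have h1 : cabs x + cabs x ^+ 2 < 1 by lra.
  apply: le_trans (expR_le_inv h1) _.
  by rewrite invf_ple ?posrE ?subr_gt0 //; lra.
have x3 : 0 <= cabs x ^+ 3 by rewrite exprn_ge0.
have close : cabs ((1 + x) * cexp (- x + x ^+ 2 / 2) - 1) <= 4 * cabs x ^+ 3.
  by apply: le_trans (cexp_order3 x) _; nra.
split=> //; move: close; set E := (1 + x) * _ => close.
have x3' : cabs x ^+ 3 <= 64^-1.
  have -> : 64^-1 = (4^-1) ^+ 3 :> R by field.
  by rewrite lerXn2r ?nnegrE ?invr_ge0.
have E2 : 2^-1 <= cabs E.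
  have := cabs_dist 1 (1 - E); rewrite cabs1 subKr cabsB; lra.
have E0 : E != 0 by rewrite -cabs_gt0; lra.
have -> : E^-1 - 1 = - (E - 1) / E by field.
rewrite cabsM cabsN cabsV ler_pdivrMr ?(lt_le_trans _ E2) ?invr_gt0 //.
by nra.
Qed.

Definition barnes_partial z K := square_prod (barnes_factor tau z) K.
Definition barnes_lim z := clim (barnes_partial z).

Definition converges (u : nat -> R[i]) (l : R[i]) := forall d : R, 0 < d ->
  exists N : nat, forall K, (N <= K)%N -> cabs (u K - l) < d.

Lemma converges_le (u : nat -> R[i]) l (b : R) N0 : converges u l ->
  (forall K, (N0 <= K)%N -> cabs (u K) <= b) -> cabs l <= b.
Proof.
move=> ul ub; apply/ler_addgt0Pr => d d0; have [N hN] := ul d d0.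
pose n := maxn N N0; have -> : l = u n - (u n - l) by ring.
apply: le_trans (cabsD _ _) _; rewrite cabsN; apply: lerD.
  by apply: ub; rewrite leq_maxr.
by apply: ltW; apply: hN; rewrite leq_maxl.
Qed.

Lemma barnes_factor_papprox A h k l : cbounded A -> papprox A h ->
  papprox A (fun s => barnes_factor tau (h s) k l).
Proof.
move=> bA ah; have ax : papprox A (fun s => h s / (wt k l)%:C).
  by apply: papprox_ext (papproxZ bA (wt k l)%:C^-1 ah) => s _; rewrite mulrC.
apply: papprox_ext (papproxM bA (papproxD (papprox_cst A 1) ax)
  (papprox_cexp bA (papproxD (papproxN bA ax) (papproxZ bA 2^-1 (papproxX bA 2 ax))))) => s _.
by rewrite barnes_factorE [2^-1 * _]mulrC.
Qed.

Lemma barnes_limP A h : cbounded A -> papprox A h ->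
  papprox A (fun s => barnes_lim (h s)) /\
  forall s, A s -> converges (barnes_partial (h s)) (barnes_lim (h s)).
Proof.
move=> bA ah; have [M M0 hM] := papprox_bounded bA ah.
apply: (@square_product_limit A (fun k l s => barnes_factor tau (h s) k l) (4 * M) (4 * M ^+ 3)) => //.
- by rewrite mulr_ge0 ?exprn_ge0 // ltW.
- by move=> k l _; exact: barnes_factor_papprox.
move=> k l s kl Ww As; have w0 := lt_le_trans c0 (lattice_gt0 kl).
have zM := hM s As; have zw : 4 * cabs (h s) <= wt k l by lra.
have [h1 _] := barnes_factor_close w0 zw; apply: le_trans h1 _.
rewrite -mulrA ler_pM2l // ler_wpM2r ?invr_ge0 ?exprn_ge0 ?(ltW w0) //.
by rewrite lerXn2r ?nnegrE ?cabs_ge0 // ltW.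
Qed.

Lemma square_prodV F K : square_prod (fun k l => (F k l)^-1) K = (square_prod F K)^-1.
Proof. by rewrite /square_prod -prodfV; apply: eq_bigr => k _; rewrite prodfV. Qed.

Lemma square_prod_eq0 F K K' : (0 < K)%N -> (K <= K')%N -> square_prod F K = 0 -> square_prod F K' = 0.
Proof.
move=> K0 KK; rewrite -(subnK KK); elim: (K' - K)%N => [//|i ih] /ih.
case: K K0 {KK ih} => // K _; rewrite addSn addnS => h.
by rewrite /square_prod (@big_square_recr _ 1 *%R F) -/(square_prod F _) h /= mul0r.
Qed.

(** The reciprocal factors form a convergent product as well; it remains to identify its limit with
    the reciprocal of [barnes_lim], also where the latter might vanish. *)
Lemma barnes_lim_invP A h : cbounded A -> papprox A h ->
  (forall k l, (0 < k + l)%N -> papprox A (fun s => (1 + h s / (wt k l)%:C)^-1)) ->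
  papprox A (fun s => (barnes_lim (h s))^-1) /\
  forall s, A s -> converges (fun K => (barnes_partial (h s) K)^-1) (barnes_lim (h s))^-1.
Proof.
move=> bA ah ai; have [M M0 hM] := papprox_bounded bA ah.
have [_ lim] := barnes_limP bA ah.
have [|||a' lim'] := @square_product_limit A (fun k l s => (barnes_factor tau (h s) k l)^-1) (4 * M) (8 * M ^+ 3) bA.
- by rewrite mulr_ge0 ?exprn_ge0 // ltW.
- move=> k l kl.
  have ax : papprox A (fun s => h s / (wt k l)%:C).
    by apply: papprox_ext (papproxZ bA (wt k l)%:C^-1 ah) => s _; rewrite mulrC.
  apply: papprox_ext (papproxM bA (ai k l kl)
    (papprox_cexp bA (papproxN bA (papproxD (papproxN bA ax) (papproxZ bA 2^-1 (papproxX bA 2 ax)))))) => s _.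
  by rewrite barnes_factorE invfM cexpN [2^-1 * _]mulrC.
- move=> k l s kl Ww As; have w0 := lt_le_trans c0 (lattice_gt0 kl).
  have zM := hM s As; have zw : 4 * cabs (h s) <= wt k l by lra.
  have [_ h1] := barnes_factor_close w0 zw; apply: le_trans h1 _.
  rewrite -mulrA ler_pM2l // ler_wpM2r ?invr_ge0 ?exprn_ge0 ?(ltW w0) //.
  by rewrite lerXn2r ?nnegrE ?cabs_ge0 // ltW.
have E s : square_prod (fun k l => (barnes_factor tau (h s) k l)^-1) = fun K => (barnes_partial (h s) K)^-1.
  by apply/funext => K; rewrite square_prodV.
have inv s : A s -> clim (square_prod (fun k l => (barnes_factor tau (h s) k l)^-1)) = (barnes_lim (h s))^-1.
  move=> As; have l2 : converges (fun K => (barnes_partial (h s) K)^-1) (clim (fun K => (barnes_partial (h s) K)^-1)).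
    by have := lim' s As; rewrite E.
  rewrite E; have l1 := lim s As.
  (* If some partial product is 0, so are all later ones and, since 0^-1 = 0, both limits are 0.
     Otherwise the two limits have product 1. *)
  have [[K [K0 PK]]|nz] := pselect (exists K, (0 < K)%N /\ barnes_partial (h s) K = 0).
    have z K' : (K <= K')%N -> barnes_partial (h s) K' = 0.
      by move=> KK; exact: square_prod_eq0 KK PK.
    have L1 : barnes_lim (h s) = 0.
      by apply: clim_eq => d d0; exists K => n /z ->; rewrite subr0 cabs0.
    rewrite L1 invr0; apply: clim_eq => d d0; exists K => n /z ->.
    by rewrite invr0 subr0 cabs0.
  have nz' K : barnes_partial (h s) K != 0.
    case: K => [|K]; first by rewrite /barnes_partial /square_prod big_ord0 oner_eq0.
    by apply/eqP => e; apply: nz; exists K.+1.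
  move: l1 l2; rewrite -/(barnes_lim _); move: (barnes_lim _) (clim _) => l l' l1 l2.
  suff : l * l' = 1 by move=> e; rewrite -[l']mul1r -[1](@mulVf _ l) -?mulrA ?e ?mulr1 //;
    apply: contra_eqT e => /negPn/eqP ->; rewrite mul0r eq_sym oner_eq0.
  apply/eqP; rewrite -subr_eq0 -cabs_eq0 eq_le cabs_ge0 andbT.
  apply/ler_addgt0Pr => e e0; rewrite add0r.
  pose e' := Num.min 1 (e / (cabs l + cabs l' + 1)).
  have den : 0 < cabs l + cabs l' + 1 by rewrite ltr_wpDl // addr_ge0 ?cabs_ge0.
  have e0' : 0 < e' by rewrite lt_min ltr01 divr_gt0.
  have [N1 h1] := l1 _ e0'; have [N2 h2] := l2 _ e0'.
  have {}h1 := h1 _ (leq_maxl N1 N2); have {}h2 := h2 _ (leq_maxr N1 N2).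
  set p := barnes_partial _ _ in h1 h2; have p0 : p != 0 by exact: nz'.
  have -> : l * l' - 1 = - ((p - l) * l' + l * (p^-1 - l') + (p - l) * (p^-1 - l')).
    by have := mulfV p0 => pp; rewrite -[in LHS]pp; ring.
  rewrite cabsN; apply: le_trans (cabsD _ _) _; rewrite cabsM.
  have h3 := cabsD ((p - l) * l') (l * (p^-1 - l')); rewrite !cabsM in h3.
  have e1 : e' <= 1 by rewrite ge_min lexx.
  have e2 : e' * (cabs l + cabs l' + 1) <= e by rewrite -ler_pdivlMr // ge_min lexx orbT.
  have := cabs_ge0 l; have := cabs_ge0 l'; have := cabs_ge0 (p - l); have := cabs_ge0 (p^-1 - l').
  nra.
split; first by apply: papprox_ext a' => s /inv.
by move=> s As; have := lim' s As; rewrite inv // E.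
Qed.

End BarnesProduct.

(** * Growth of the double gamma function *)

Section BarnesGrowth.
Context {R : realType}.
Variables (tau : R) (tau_gt0 : 0 < tau).
Implicit Types (s z u : R[i]) (r w : R).
Local Notation wt := (lattice tau).

Let c : R := Num.min 1 tau.
Let c0 : 0 < c. Proof. by rewrite lt_min ltr01. Qed.

Definition square_sum (g : R -> R) K : R :=
  \sum_(k < K) \sum_(l < K | (0 < k + l)%N) g (wt k l).

(* At radius r a factor of period w <= 8 r contributes the quadratic term of
   its exponential, up to an error O(r / w); a factor of larger period
   contributes O(r^3 / w^3).  Up to constants [error_weight] dominates both. *)
Definition low_weight r w : R := if w <= 8 * r then (2 * w ^+ 2)^-1 else 0.
Definition error_weight r w : R := r ^+ 3 / (w * (r ^+ 2 + w ^+ 2)).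

Lemma square_sum_recr g K : square_sum g K.+2 = square_sum g K.+1 +
  \sum_(x <- layer K.+1) g (wt x.1 x.2).
Proof. exact: (@big_square_recr _ 0 +%R (fun k l => g (wt k l))). Qed.

Lemma square_sum1 g : square_sum g 1 = 0.
Proof. exact: (@big_square1 _ 0 +%R (fun k l => g (wt k l))). Qed.

Lemma ler_square_sum g h K : (forall w, c <= w -> g w <= h w) ->
  square_sum g K <= square_sum h K.
Proof.
move=> gh; apply: ler_sum => k _; apply: ler_sum => l kl; apply: gh.
exact: (lattice_gt0 tau_gt0).
Qed.

Lemma square_sum_lin (x y : R) g h K :
  square_sum (fun w => x * g w + y * h w) K = x * square_sum g K + y * square_sum h K.
Proof.
rewrite /square_sum !mulr_sumr -big_split; apply: eq_bigr => k _.
by rewrite !mulr_sumr -big_split.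
Qed.

Lemma square_prod_le (F : nat -> nat -> R[i]) g K :
  (forall k l, (0 < k + l)%N -> cabs (F k l) <= expR (g (wt k l))) ->
  cabs (square_prod F K) <= expR (square_sum g K).
Proof.
move=> h; rewrite /square_prod /square_sum cabs_prod expR_sum.
apply: ler_prod => k _; rewrite cabs_ge0 cabs_prod expR_sum /=.
by apply: ler_prod => l kl; rewrite cabs_ge0 h.
Qed.

(** With Y = r / c, layer t contributes at most (r / c)^3 (2 t + 1) / (t (Y^2 + t^2)). By 2 t + 1 <=
    3 t and (Y + t)^2 <= 2 (Y^2 + t^2) this is at most 6 (r / c)^3 (1 / (Y + t - 1) - 1 / (Y + t)),
    which telescopes to 6 (r / c)^3 / Y = O(r^2), without a logarithm. *)
Lemma error_weight_sum : exists2 C : R, 0 <= C & forall r K, 1 <= r ->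
  square_sum (error_weight r) K <= C * r ^+ 2.
Proof.
exists (6 / c ^+ 2) => [|r [|K] r1]; first by rewrite divr_ge0 ?exprn_ge0 // ltW.
  by rewrite /square_sum big_ord0 mulr_ge0 ?exprn_ge0 ?divr_ge0 ?exprn_ge0 ?(ltW c0) //; lra.
have r0 : 0 < r by lra.
pose Y := r / c; have Y0 : 0 < Y by rewrite divr_gt0.
suff H : square_sum (error_weight r) K.+1 <= 6 * r ^+ 3 / c ^+ 3 * (Y^-1 - (Y + K%:R)^-1).
  apply: le_trans H _; have -> : 6 / c ^+ 2 * r ^+ 2 = 6 * r ^+ 3 / c ^+ 3 * Y^-1.
    by rewrite /Y; field; rewrite !gt_eqF.
  apply: ler_wpM2l; first by rewrite divr_ge0 ?mulr_ge0 ?exprn_ge0 // ltW.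
  by rewrite gerBl invr_ge0 addr_ge0 ?ler0n // ltW.
elim: K => [|K ih]; first by rewrite square_sum1 addr0 subrr mulr0.
rewrite square_sum_recr.
have K0 : 1 <= K.+1%:R :> R by rewrite ler1n.
have KK : K%:R = K.+1%:R - 1 :> R by rewrite -natr1 addrK.
rewrite KK in ih; move: (K.+1%:R) (size_layer K.+1) (@layer_bounds _ _ tau_gt0 K.+1) K0 KK ih => t sz lb t1 KK ih.
have {}sz : (size (layer K.+1))%:R = 2 * t + 1 :> R.
  by rewrite sz natrD -[K.+2%:R]natr1 -natr1 KK; ring.
have t0 : 0 < t by lra.
pose b := r ^+ 3 / (c * t * (r ^+ 2 + (c * t) ^+ 2)).
have hl : \sum_(x <- layer K.+1) error_weight r (wt x.1 x.2) <= (2 * t + 1) * b.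
  rewrite -sz; apply: sum_le_size => x /lb /andP[w1 _].
  have ct0 : 0 < c * t by rewrite mulr_gt0.
  have w0 : 0 < wt x.1 x.2 by exact: lt_le_trans w1.
  rewrite /error_weight /b ler_wpM2l ?exprn_ge0 ?(ltW r0) //.
  have q1 : 0 < r ^+ 2 + (c * t) ^+ 2 by rewrite addr_gt0 ?exprn_gt0.
  have q2 : 0 < r ^+ 2 + wt x.1 x.2 ^+ 2 by rewrite addr_gt0 ?exprn_gt0.
  rewrite lef_pV2 ?posrE; last 2 first.
  - exact: mulr_gt0.
  - exact: mulr_gt0.
  apply: ler_pM; [exact: ltW|exact: ltW|exact: w1|].
  by rewrite lerD2l lerXn2r ?nnegrE ?(ltW ct0) ?(ltW w0).
apply: le_trans (lerD ih hl) _.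
have -> : 6 * r ^+ 3 / c ^+ 3 * (Y^-1 - (Y + t)^-1) =
  6 * r ^+ 3 / c ^+ 3 * (Y^-1 - (Y + (t - 1))^-1) + 6 * r ^+ 3 / c ^+ 3 * ((Y + (t - 1))^-1 - (Y + t)^-1) by ring.
rewrite lerD2l.
have -> : (2 * t + 1) * b = r ^+ 3 / c ^+ 3 * ((2 * t + 1) / (t * (Y ^+ 2 + t ^+ 2))).
  have -> : b = r ^+ 3 / (c ^+ 3 * (t * (Y ^+ 2 + t ^+ 2))).
    rewrite /b; congr (_ / _); rewrite /Y; field; exact: lt0r_neq0.
  by rewrite [(c ^+ 3 * _)^-1]invfM; ring.
have Yt : 0 < Y + (t - 1) by lra.
have Yt' : 0 < Y + t by lra.
have -> : 6 * r ^+ 3 / c ^+ 3 * ((Y + (t - 1))^-1 - (Y + t)^-1) =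
  r ^+ 3 / c ^+ 3 * (6 / ((Y + (t - 1)) * (Y + t))).
  by field; rewrite !gt_eqF.
apply: ler_wpM2l; first by rewrite divr_ge0 ?exprn_ge0 // ltW.
have Y2 : 0 < Y ^+ 2 + t ^+ 2 by rewrite addr_gt0 ?exprn_gt0.
rewrite ler_pdivrMr ?mulr_gt0 // mulrAC ler_pdivlMr ?mulr_gt0 //.
apply: (@le_trans _ _ ((3 * t) * (2 * (Y ^+ 2 + t ^+ 2)))).
  apply: ler_pM; [lra|by rewrite mulr_ge0 ?ltW|lra|].
  by have := sqr_ge0 (Y - t); rewrite !expr2; nra.
by rewrite le_eqVlt; apply/orP; left; apply/eqP; ring.
Qed.

(** Here r^2 + w^2 <= 65 r^2, with 65 = 1 + 8^2. *)
Lemma error_weight_near r w : 0 < r -> 0 < w -> w <= 8 * r -> r / w <= 65 * error_weight r w.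
Proof.
move=> r0 w0 wr; rewrite /error_weight.
have q0 : 0 < r ^+ 2 + w ^+ 2 by rewrite addr_gt0 ?exprn_gt0.
have -> : 65 * (r ^+ 3 / (w * (r ^+ 2 + w ^+ 2))) = r / w * (65 * r ^+ 2 / (r ^+ 2 + w ^+ 2)).
  by field; rewrite !gt_eqF.
rewrite ler_peMr ?divr_ge0 ?(ltW r0) ?(ltW w0) // ler_pdivlMr // mul1r.
have : w ^+ 2 <= (8 * r) ^+ 2 by rewrite lerXn2r ?nnegrE ?mulr_ge0 ?(ltW r0) ?(ltW w0).
by rewrite exprMn; lra.
Qed.

Lemma error_weight_far r w : 0 < r -> 8 * r < w -> r ^+ 3 / w ^+ 3 <= 2 * error_weight r w.
Proof.
move=> r0 wr; have w0 : 0 < w by lra.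
have q0 : 0 < r ^+ 2 + w ^+ 2 by rewrite addr_gt0 ?exprn_gt0.
rewrite /error_weight mulrCA ler_wpM2l ?exprn_ge0 ?(ltW r0) //.
rewrite -[leLHS]div1r ler_pdivrMr ?exprn_gt0 // mulrAC ler_pdivlMr ?mulr_gt0 //.
rewrite mul1r [w ^+ 3]exprS mulrCA ler_wpM2l ?(ltW w0) //.
have : r ^+ 2 <= w ^+ 2 by rewrite lerXn2r ?nnegrE ?(ltW r0) ?(ltW w0) //; lra.
lra.
Qed.

Lemma error_weight_ge0 r w : 0 < r -> 0 < w -> 0 <= error_weight r w.
Proof.
by move=> r0 w0; rewrite divr_ge0 ?mulr_ge0 ?addr_ge0 ?exprn_ge0 ?(ltW r0) ?(ltW w0).
Qed.

Lemma re_exponent z w : 0 < w ->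
  re (- (z / w%:C) + (z / w%:C) ^+ 2 / 2) = - re z / w + re (z ^+ 2) * (2 * w ^+ 2)^-1.
Proof.
move=> w0; rewrite -realCV natC -realCV !expr2 !reimE /=; field.
by rewrite gt_eqF.
Qed.

(** As |z| <= 2 r, a period beyond 8 r satisfies 4 |z| <= w, as [barnes_factor_close] requires. For
    smaller periods |1 + x| <= exp |x| and - Re x <= |x|, where x = z / w, leave an error 2 |z| / w
    <= 4 r / w besides the quadratic term; 260 = 4 * 65. *)
Lemma barnes_factor_upper : exists2 C : R, 0 <= C & forall r z k l, 1 <= r -> cabs z <= 2 * r ->
  (0 < k + l)%N ->
  cabs (barnes_factor tau z k l) <=
  expR (re (z ^+ 2) * low_weight r (wt k l) + C * error_weight r (wt k l)).
Proof.
exists 260 => [|r z k l r1 zr kl]; first exact: ler0n.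
have r0 : 0 < r by lra.
have w0 : 0 < wt k l := lt_le_trans c0 (lattice_gt0 tau_gt0 kl).
have e0 := error_weight_ge0 r0 w0.
have xE : cabs (z / (wt k l)%:C) = cabs z / wt k l by rewrite cabsM cabsV cabs_real gtr0_norm.
rewrite /low_weight; case: ifPn => [wr|].
  rewrite barnes_factorE cabsM cabs_cexp re_exponent //.
  have h : cabs z / wt k l <= 2 * (r / wt k l).
    by rewrite mulrA ler_wpM2r // invr_ge0 ltW.
  have h1 : cabs (1 + z / (wt k l)%:C) <= expR (cabs z / wt k l).
    by apply: le_trans (cabsD _ _) _; rewrite cabs1 xE expR_ge1Dx.
  apply: le_trans (ler_wpM2r (expR_ge0 _) h1) _; rewrite -expRD ler_expR.
  have h2 : - re z / wt k l <= cabs z / wt k l.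
    rewrite ler_wpM2r ?invr_ge0 ?(ltW w0) //.
    by apply: le_trans (cabs_re z); rewrite -normrN ler_norm.
  have := error_weight_near r0 w0 wr; lra.
rewrite -ltNge => wr; rewrite mulr0 add0r.
have zw : 4 * cabs z <= wt k l by lra.
have [h _] := barnes_factor_close w0 zw.
rewrite -[barnes_factor _ _ _ _](subrK 1); apply: le_trans (cabsD _ _) _; rewrite cabs1.
apply: le_trans (_ : 1 + 260 * error_weight r (wt k l) <= _); last exact: expR_ge1Dx.
rewrite addrC lerD2l; apply: le_trans h _.
have h3 : cabs z ^+ 3 / wt k l ^+ 3 <= 8 * (r ^+ 3 / wt k l ^+ 3).
  rewrite mulrA ler_wpM2r ?invr_ge0 ?exprn_ge0 ?(ltW w0) //.
  have -> : 8 * r ^+ 3 = (2 * r) ^+ 3 by ring.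
  by rewrite lerXn2r ?nnegrE ?cabs_ge0 ?mulr_ge0 ?(ltW r0).
have := error_weight_far r0 wr; lra.
Qed.

(** Excludes a sector around the negative real axis, which carries the zeros of G other than 0. *)
Definition in_cone (d : R) z := 0 <= re z \/ d * cabs z <= `|im z|.

(** If re z < 0, the direction of z makes an angle of sine at least d with the negative axis, so z
    is at distance at least d w from - w. *)
Lemma cone_distance d z w : 0 < d <= 1 -> 0 < w -> in_cone d z -> d <= cabs (1 + z / w%:C).
Proof.
move=> /andP[d0 d1] w0 [z0|zd].
  apply: le_trans d1 _; apply: le_trans (re_le_cabs _).
  by rewrite -realCV !reimE /= mulr0 subr0 lerDl mulr_ge0 // invr_ge0 ltW.
have E : cabs (1 + z / w%:C) = cabs (w%:C + z) / w.
  have -> : 1 + z / w%:C = (w%:C + z) / w%:C.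
    by rewrite mulrDl divff // (inj_eq (@complexI R) w 0) gt_eqF.
  by rewrite cabsM cabsV cabs_real gtr0_norm.
rewrite E ler_pdivlMr // -(ler_pXn2r (n := 2)) ?nnegrE ?mulr_ge0 ?cabs_ge0 ?(ltW d0) ?(ltW w0) //.
rewrite cabs_sqr !reimE /= add0r.
have h : (d * cabs z) ^+ 2 <= im z ^+ 2.
  rewrite -(real_normK (num_real (im z))) lerXn2r ?nnegrE ?mulr_ge0 ?cabs_ge0 ?(ltW d0) //.
rewrite exprMn cabs_sqr in h.
have dd : 0 < d ^+ 2 by rewrite exprn_gt0.
have d2 : d ^+ 2 <= 1 by rewrite exprn_ile1 // ltW.
have [d21|d21] := leP 1 (d ^+ 2).
  have e1 : d ^+ 2 = 1 by apply/eqP; rewrite eq_le d2.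
  rewrite e1 in h; have x0 : re z ^+ 2 = 0 by have := sqr_ge0 (re z); lra.
  have xz : re z = 0 by apply/eqP; rewrite -sqrf_eq0 x0.
  by rewrite exprMn e1 xz addr0 mul1r lerDl sqr_ge0.
(* With z = x + i y and e = d^2 the product equals ((1 - e) w + x)^2 + (y^2 - e (x^2 + y^2)), where
   the second term is non-negative in the cone. *)
have : 0 <= (1 - d ^+ 2) * ((w + re z) ^+ 2 + im z ^+ 2 - (d * w) ^+ 2).
  rewrite exprMn; move: (re z) (im z) (d ^+ 2) h dd d21 => x y e h e0 e1.
  have := sqr_ge0 ((1 - e) * w + x); nra.
by rewrite pmulr_rge0 ?subr_gt0 // subr_ge0.
Qed.

(** For w <= 8 r the bound 1 / d on |1 + z / w|^-1 is absorbed into exp(8 r / (d w)), because 8 r /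
    w >= 1; 520 = 8 * 65. *)
Lemma barnes_factor_lower (d : R) : 0 < d <= 1 -> exists2 C : R, 0 <= C &
  forall r z k l, 1 <= r -> cabs z <= 2 * r -> in_cone d z -> (0 < k + l)%N ->
  cabs (barnes_factor tau z k l)^-1 <=
  expR (- re (z ^+ 2) * low_weight r (wt k l) + C * error_weight r (wt k l)).
Proof.
move=> dP; have /andP[d0 d1] := dP; have di0 : 0 <= d^-1 by rewrite invr_ge0 ltW.
exists (520 * (d^-1 + 1)) => [|r z k l r1 zr zc kl]; first by rewrite mulr_ge0 ?addr_ge0.
have r0 : 0 < r by lra.
have w0 : 0 < wt k l := lt_le_trans c0 (lattice_gt0 tau_gt0 kl).
have e0 := error_weight_ge0 r0 w0.
rewrite /low_weight; case: ifPn => [wr|].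
  have h0 := cone_distance dP w0 zc.
  rewrite barnes_factorE cabsV cabsM cabs_cexp re_exponent // invfM -expRN.
  have h : cabs z / wt k l <= 2 * (r / wt k l).
    by rewrite mulrA ler_wpM2r // invr_ge0 ltW.
  have h1 : (cabs (1 + z / (wt k l)%:C))^-1 <= expR (d^-1 * (8 * (r / wt k l))).
    apply: (@le_trans _ _ d^-1).
      by rewrite lef_pV2 ?posrE // (lt_le_trans d0).
    have p1 : 1 <= 8 * (r / wt k l) by rewrite mulrA ler_pdivlMr // mul1r.
    apply: le_trans (_ : d^-1 * (8 * (r / wt k l)) <= _); first by rewrite ler_peMr.
    by apply: le_trans (expR_ge1Dx _); rewrite lerDr.
  apply: le_trans (ler_wpM2r (expR_ge0 _) h1) _; rewrite -expRD ler_expR.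
  have h2 : re z / wt k l <= cabs z / wt k l.
    by rewrite ler_wpM2r ?invr_ge0 ?(ltW w0) // re_le_cabs.
  have h3 := error_weight_near r0 w0 wr.
  have h4 := ler_wpM2l di0 h3.
  lra.
rewrite -ltNge => wr; rewrite mulr0 add0r.
have zw : 4 * cabs z <= wt k l by lra.
have [_ h] := barnes_factor_close w0 zw.
rewrite -[(barnes_factor _ _ _ _)^-1](subrK 1); apply: le_trans (cabsD _ _) _; rewrite cabs1.
apply: le_trans (_ : 1 + 520 * (d^-1 + 1) * error_weight r (wt k l) <= _); last exact: expR_ge1Dx.
rewrite addrC lerD2l; apply: le_trans h _.
have h3 : cabs z ^+ 3 / wt k l ^+ 3 <= 8 * (r ^+ 3 / wt k l ^+ 3).
  rewrite mulrA ler_wpM2r ?invr_ge0 ?exprn_ge0 ?(ltW w0) //.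
  have -> : 8 * r ^+ 3 = (2 * r) ^+ 3 by ring.
  by rewrite lerXn2r ?nnegrE ?cabs_ge0 ?mulr_ge0 ?(ltW r0).
have := error_weight_far r0 wr; have := mulr_ge0 di0 e0; lra.
Qed.

(** All layers added from this size on have periods beyond 8 r, so [low_sum r] is already the full
    sum A(r). *)
Definition cutoff r : nat := (Num.bound (8 * r / c)).+1.
Definition low_sum r : R := square_sum (low_weight r) (cutoff r).

Lemma low_sum_stable r K : 0 <= r -> (cutoff r <= K)%N -> square_sum (low_weight r) K = low_sum r.
Proof.
move=> r0 hK; rewrite /low_sum -(subnK hK); elim: (K - cutoff r)%N => [//|i ih].
move: ih; rewrite addSn /cutoff addnS square_sum_recr => ->; rewrite big_seq big1 ?addr0 // => x xl.
have /andP[w1 _] := layer_bounds tau_gt0 xl.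
rewrite /low_weight; case: ifPn => // wr.
have q : 0 <= 8 * r / c by rewrite divr_ge0 ?mulr_ge0 // ltW.
have : 8 * r / c < (i + Num.bound (8 * r / c)).+1%:R.
  by apply: lt_le_trans (archi_boundP q) _; rewrite ler_nat leqW // leq_addl.
by rewrite ltr_pdivrMr // [X in _ < X]mulrC ltNge => /negP[]; exact: le_trans w1 wr.
Qed.

Lemma low_weight_ge0 r w : 0 <= low_weight r w.
Proof. by rewrite /low_weight; case: ifP => // _; rewrite invr_ge0 mulr_ge0 ?sqr_ge0. Qed.

Lemma low_sum_ge0 r : 0 <= low_sum r.
Proof. by do 2 (apply: sumr_ge0 => ? _); exact: low_weight_ge0. Qed.

(** A crude bound, sufficient to make A(r) times the O(r) change of Re(z^2) under a translation an
    O(r^2). *)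
Lemma low_sum_le : exists2 C : R, 0 <= C & forall r, 1 <= r -> low_sum r <= C * r.
Proof.
have [C C0 hC] := error_weight_sum.
exists (33 / c * C) => [|r r1]; first by rewrite mulr_ge0 ?divr_ge0 // ltW.
have r0 : 0 < r by lra.
apply: (@le_trans _ _ (33 / c / r * square_sum (error_weight r) (cutoff r))).
  have -> : 33 / c / r * square_sum (error_weight r) (cutoff r) =
    square_sum (fun w => 33 / c / r * error_weight r w + 0 * 0) (cutoff r).
    by rewrite (square_sum_lin _ _ _ (fun=> 0)) mul0r addr0.
  apply: ler_square_sum => w cw; rewrite mul0r addr0.
  have w0 : 0 < w by exact: lt_le_trans cw.
  have e0 := error_weight_ge0 r0 w0.
  rewrite /low_weight; case: ifP => wr; last first.
    by rewrite mulr_ge0 // divr_ge0 ?(ltW r0) // divr_ge0 // ltW.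
  have := error_weight_near r0 w0 wr => h.
  have -> : (2 * w ^+ 2)^-1 = w^-1 * ((2 * r)^-1 * (r / w)).
    by field; rewrite !gt_eqF.
  have -> : 33 / c / r * error_weight r w = c^-1 * ((2 * r)^-1 * (66 * error_weight r w)).
    by field; rewrite !gt_eqF.
  have p1 : w^-1 <= c^-1 by rewrite lef_pV2 ?posrE.
  have p2 : 0 <= (2 * r)^-1 by rewrite invr_ge0 mulr_ge0 // ltW.
  have p3 : 0 <= r / w by rewrite divr_ge0 // ltW.
  have p4 : r / w <= 66 * error_weight r w by lra.
  apply: ler_pM p1 _; first by rewrite invr_ge0 ltW.
    exact: mulr_ge0.
  exact: ler_wpM2l.
have -> : 33 / c * C * r = 33 / c / r * (C * r ^+ 2) by field; rewrite !gt_eqF.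
apply: ler_wpM2l (hC _ _ r1).
by rewrite divr_ge0 ?(ltW r0) // divr_ge0 // ltW.
Qed.

(** Layer j has 2 j + 1 periods of size at most (1 + tau) j; as long as this is at most 8 r, the
    layer contributes at least 1 / ((1 + tau)^2 j). The harmonic series diverges. *)
Lemma low_sum_unbounded (M : R) : exists R0 : R, forall r, R0 <= r -> M <= low_sum r.
Proof.
have t1 : 0 < 1 + tau by rewrite addr_gt0.
have nd : nondecreasing_seq (series (@harmonic R)).
  apply/nondecreasing_seqP => n; rewrite /series /= big_nat_recr //= lerDl invr_ge0.
  exact: ler0n.
have /cvgryPge /(_ ((1 + tau) ^+ 2 * M))[J _ hJ] := nondecreasing_dvgn_lt nd (@dvg_harmonic R).
have {}hJ := hJ J (leqnn J).
exists (`|M| + (1 + tau) * J%:R) => r hr.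
have r0 : 0 <= r by apply: le_trans hr; rewrite addr_ge0 ?mulr_ge0 ?ler0n // ltW.
have Jr : (1 + tau) * J%:R <= 8 * r by have := normr_ge0 M; lra.
rewrite -(@low_sum_stable r (maxn (cutoff r) J.+1)) ?leq_maxl //.
have mono K : square_sum (low_weight r) K <= square_sum (low_weight r) K.+1.
  case: K => [|K]; first by rewrite square_sum1 /square_sum big_ord0.
  by rewrite square_sum_recr lerDl sumr_ge0 // => x _; exact: low_weight_ge0.
have {}mono i j : (i <= j)%N -> square_sum (low_weight r) i <= square_sum (low_weight r) j.
  by move=> ij; rewrite -(subnK ij); elim: (j - i)%N => [//|k ih]; exact: le_trans ih (mono _).
apply: le_trans (mono _ _ (leq_maxr _ _)).
suff H j : (j <= J)%N -> series harmonic j <= (1 + tau) ^+ 2 * square_sum (low_weight r) j.+1.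
  by rewrite -(ler_pM2l (exprn_gt0 2 t1)); apply: le_trans hJ (H J _).
elim: j => [|j ih] jJ; first by rewrite square_sum1 mulr0 /series /= big_geq.
rewrite square_sum_recr mulrDr seriesSr; apply: lerD; first exact: ih (ltnW jJ).
have j0 : 0 < j.+1%:R :> R by rewrite ltr0n.
have j1 : 1 <= j.+1%:R :> R by rewrite ler1n.
pose b : R := (2 * ((1 + tau) * j.+1%:R) ^+ 2)^-1.
have : (size (layer j.+1))%:R * b <= \sum_(x <- layer j.+1) low_weight r (wt x.1 x.2).
  apply: sum_ge_size => x xl; have /andP[w1 w2] := layer_bounds tau_gt0 xl.
  have w0 : 0 < wt x.1 x.2 by apply: lt_le_trans w1; rewrite mulr_gt0.
  rewrite /low_weight; case: ifPn => [_|].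
    rewrite /b lef_pV2 ?posrE ?mulr_gt0 ?exprn_gt0 ?mulr_gt0 // ler_pM2l //.
    by rewrite lerXn2r ?nnegrE ?mulr_ge0 ?(ltW w0) ?(ltW t1).
  rewrite -ltNge => h; exfalso; move: h; apply/negP; rewrite -leNgt.
  by apply: le_trans w2 _; apply: le_trans Jr; rewrite ler_pM2l // ler_nat.
move=> h; rewrite /=.
apply: le_trans (ler_wpM2l (exprn_ge0 2 (ltW t1)) h).
rewrite size_layer; have -> : (j.+1 + j.+2)%:R = 2 * j.+1%:R + 1 :> R.
  by rewrite natrD -[j.+2%:R]natr1; ring.
rewrite /b; move: (j.+1%:R) j0 j1 => t t0 t1'.
have -> : (1 + tau) ^+ 2 * ((2 * t + 1) / (2 * ((1 + tau) * t) ^+ 2)) = t^-1 + (2 * t ^+ 2)^-1.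
  by field; rewrite !gt_eqF.
by rewrite lerDl invr_ge0 mulr_ge0 ?exprn_ge0 // ltW.
Qed.

Lemma barnes_partial_upper : exists2 C : R, 0 <= C & forall r z K, 1 <= r -> cabs z <= 2 * r ->
  (cutoff r <= K)%N -> cabs (barnes_partial tau z K) <= expR (re (z ^+ 2) * low_sum r + C * r ^+ 2).
Proof.
have [C C0 hC] := barnes_factor_upper; have [C' C0' hC'] := error_weight_sum.
exists (C * C') => [|r z K r1 zr rK]; first by rewrite mulr_ge0.
apply: le_trans (square_prod_le
  (g := fun w => re (z ^+ 2) * low_weight r w + C * error_weight r w) _ _) _.
  by move=> k l kl; exact: hC.
rewrite ler_expR square_sum_lin low_sum_stable //; last by lra.
by rewrite lerD2l -mulrA ler_wpM2l ?hC'.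
Qed.

Lemma barnes_partial_lower (d : R) : 0 < d <= 1 -> exists2 C : R, 0 <= C &
  forall r z K, 1 <= r -> cabs z <= 2 * r -> in_cone d z -> (cutoff r <= K)%N ->
  cabs (barnes_partial tau z K)^-1 <= expR (- re (z ^+ 2) * low_sum r + C * r ^+ 2).
Proof.
move=> dP; have [C C0 hC] := barnes_factor_lower dP; have [C' C0' hC'] := error_weight_sum.
exists (C * C') => [|r z K r1 zr zc rK]; first by rewrite mulr_ge0.
rewrite -square_prodV; apply: le_trans (square_prod_le
  (g := fun w => - re (z ^+ 2) * low_weight r w + C * error_weight r w) _ _) _.
  by move=> k l kl; exact: hC.
rewrite ler_expR square_sum_lin low_sum_stable //; last by lra.
by rewrite lerD2l -mulrA ler_wpM2l ?hC'.
Qed.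

End BarnesGrowth.

(** * Growth and approximation of shifted double gamma functions *)

Section DoubleGammaGrowth.
Context {R : realType}.
Variables (tau : R) (tau_gt0 : 0 < tau) (G : R[i] -> R[i]) (c1 c2 : R).
Hypothesis GE : forall z, G z = barnes_product tau c1 c2 z.
Variables (sigma : R) (sigmaE : is_sign sigma).
Implicit Types (s z u w : R[i]) (A : set R[i]) (g h : R[i] -> R[i]).

Let exponent z : R[i] := c1%:C * z / tau%:C + c2%:C * z ^+ 2 / (2 * tau%:C ^+ 2).

Lemma double_gammaE z : G z = z / tau%:C * cexp (exponent z) * barnes_lim tau z.
Proof. exact: GE. Qed.

Lemma exponent_papprox A h : cbounded A -> papprox A h -> papprox A (fun s => exponent (h s)).
Proof.
move=> bA ah; apply: papprox_ext (papproxD (papproxZ bA (c1%:C / tau%:C) ah)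
  (papproxZ bA (c2%:C / (2 * tau%:C ^+ 2)) (papproxX bA 2 ah))) => s _.
by rewrite /exponent; congr (_ + _); rewrite mulrAC.
Qed.

Lemma double_gamma_papprox A h : cbounded A -> papprox A h -> papprox A (fun s => G (h s)).
Proof.
move=> bA ah; have [al _] := barnes_limP tau_gt0 bA ah.
apply: papprox_ext (papproxM bA (papproxM bA (papproxZ bA (tau%:C)^-1 ah)
  (papprox_cexp bA (exponent_papprox bA ah))) al) => s _.
by rewrite double_gammaE [_^-1 * _]mulrC.
Qed.

(** The zero of G (w + sigma s) in s that belongs to the period k tau + l; the pair (0, 0), absent
    from the product, comes from the prefactor z / tau. *)
Definition gamma_zero w (k l : nat) : R[i] := - sigma%:C * (w + (lattice tau k l)%:C).

Lemma sigmaC_sqr : sigma%:C * sigma%:C = 1 :> R[i].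
Proof.
rewrite -rmorphM; case: sigmaE => ->; first by rewrite mul1r.
by rewrite mulrNN mul1r.
Qed.

Lemma gamma_zeroE w s k l : w + sigma%:C * s + (lattice tau k l)%:C = sigma%:C * (s - gamma_zero w k l).
Proof.
rewrite /gamma_zero mulNr opprK mulrDr mulrA sigmaC_sqr mul1r; ring.
Qed.

(** The reciprocal of 1 + z / (k tau + l) is a multiple of a simple pole in s at [gamma_zero], so
    approximating these poles suffices. *)
Lemma double_gamma_inv_papprox A w : cbounded A ->
  (forall k l, papprox A (fun s => (s - gamma_zero w k l)^-1)) ->
  papprox A (fun s => (G (w + sigma%:C * s))^-1).
Proof.
move=> bA ai; have ah : papprox A (fun s => w + sigma%:C * s).
  by apply: papproxD; [exact: papprox_cst|apply: papproxZ => //; exact: papprox_id].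
have ai' k l : (0 < k + l)%N ->
    papprox A (fun s => (1 + (w + sigma%:C * s) / (lattice tau k l)%:C)^-1).
  move=> kl; have w0 : 0 < lattice tau k l.
    by apply: lt_le_trans (lattice_gt0 tau_gt0 kl); rewrite lt_min ltr01.
  have {}w0 : (lattice tau k l)%:C != 0 :> R[i] by rewrite (inj_eq (@complexI R) _ 0) gt_eqF.
  apply: papprox_ext (papproxZ bA ((lattice tau k l)%:C * sigma%:C^-1) (ai k l)) => s _.
  rewrite -mulrA -invfM -gamma_zeroE -{1}(divff w0) -mulrDl invfM invrK mulrC.
  by rewrite [_%:C + _]addrC.
have [al _] := barnes_lim_invP tau_gt0 bA ah ai'.
apply: papprox_ext (papproxM bA (papproxM bA (papproxZ bA (tau%:C * sigma%:C^-1) (ai 0%N 0%N))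
  (papprox_cexp bA (papproxN bA (exponent_papprox bA ah)))) al) => s _.
rewrite double_gammaE !invfM invrK cexpN.
have := gamma_zeroE w s 0 0; rewrite /lattice mul0r addr0 addr0 => ->.
by rewrite invfM; ring.
Qed.

Let A0 r := low_sum tau r.

(** The coefficient k counts factors G with sign and is additive under products. The main term uses
    Re(s^2) and A(|s|) for every factor, whatever its shift, which [shift_bounds] makes possible. *)
Definition growth (k : R) g := forall c : R, 0 < c -> exists2 C : R, 0 <= C &
  exists R0 : R, forall s, R0 <= cabs s -> 0 <= sigma * re s \/ c * cabs s <= `|im s| ->
    cabs (g s) <= expR (k * (re (s ^+ 2) * A0 (cabs s)) + C * cabs s ^+ 2).

Lemma growth_ext k g h : (forall s, g s = h s) -> growth k g -> growth k h.
Proof. by move=> /funext ->. Qed.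

Lemma growthM k k' g h : growth k g -> growth k' h -> growth (k + k') (fun s => g s * h s).
Proof.
move=> gg gh c c0; have [C C0 [R0 h0]] := gg c c0; have [C' C0' [R0' h0']] := gh c c0.
exists (C + C'); first exact: addr_ge0.
exists (Num.max R0 R0') => s; rewrite ge_max => /andP[r1 r2] sc.
rewrite cabsM; apply: le_trans (ler_pM _ _ (h0 s r1 sc) (h0' s r2 sc)) _; rewrite ?cabs_ge0 //.
by rewrite -expRD ler_expR le_eqVlt; apply/orP; left; apply/eqP; ring.
Qed.

Lemma growth1 : growth 0 (fun=> 1).
Proof.
move=> c c0; exists 0 => //; exists 0 => s _ _.
by rewrite cabs1 !mul0r addr0 expR0.
Qed.

Lemma growth_prod (I : Type) (q : seq I) (P : pred I) k (F : I -> R[i] -> R[i]) :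
  (forall i, P i -> growth k (F i)) ->
  growth (\sum_(i <- q | P i) k) (fun s => \prod_(i <- q | P i) F i s).
Proof.
move=> h; elim: q => [|i q ih].
  by rewrite big_nil; apply: growth_ext growth1 => s; rewrite big_nil.
rewrite big_cons; have [pi|pi] := boolP (P i).
  by apply: growth_ext (growthM (h i pi) ih) => s; rewrite big_cons pi.
by apply: growth_ext ih => s; rewrite big_cons (negbTE pi).
Qed.

Lemma growth_cexp h (C : R) : 0 <= C -> (forall s, 1 <= cabs s -> cabs (h s) <= C * cabs s ^+ 2) ->
  growth 0 (fun s => cexp (h s)).
Proof.
move=> C0 hC c c0; exists C => //; exists 1 => s s1 _.
by rewrite cabs_cexp mul0r add0r ler_expR; apply: le_trans (re_le_cabs _) (hC s s1).
Qed.

Lemma exponent_le : exists2 C : R, 0 <= C & forall r z, 1 <= r -> cabs z <= 2 * r ->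
  cabs (exponent z) <= C * r ^+ 2.
Proof.
exists (2 * `|c1| / tau + 2 * `|c2| / tau ^+ 2) => [|r z r1 zr].
  by rewrite addr_ge0 // divr_ge0 ?mulr_ge0 ?exprn_ge0 // ltW.
have r0 : 0 < r by lra.
apply: le_trans (cabsD _ _) _; rewrite [leRHS]mulrDl; apply: lerD.
  rewrite cabsM cabsV cabsM !cabs_real (gtr0_norm tau_gt0).
  have -> : 2 * `|c1| / tau * r ^+ 2 = `|c1| * (2 * r ^+ 2) / tau by ring.
  rewrite ler_wpM2r ?invr_ge0 ?(ltW tau_gt0) // ler_wpM2l //; nra.
rewrite cabsM cabsM cabsX cabsV cabsM cabsX natC !cabs_real (gtr0_norm tau_gt0).
rewrite (ger0_norm (ler0n _ 2)).
have -> : 2 * `|c2| / tau ^+ 2 * r ^+ 2 = `|c2| * (2 * r) ^+ 2 / (2 * tau ^+ 2).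
  by field; rewrite gt_eqF.
rewrite ler_wpM2r ?invr_ge0 ?mulr_ge0 ?exprn_ge0 ?(ltW tau_gt0) // ler_wpM2l //.
by rewrite lerXn2r ?nnegrE ?cabs_ge0 ?mulr_ge0 ?(ltW r0).
Qed.

(** Re((u + y s)^2) differs from Re(s^2) by O(|s|), and A(|s|) = O(|s|) turns this into O(|s|^2). *)
Lemma shift_bounds u y : is_sign y -> exists2 C : R, 0 <= C &
  forall s, Num.max 1 (cabs u) <= cabs s -> 
    [/\ 1 <= cabs s, cabs (u + y%:C * s) <= 2 * cabs s &
        `|re ((u + y%:C * s) ^+ 2) * A0 (cabs s) - re (s ^+ 2) * A0 (cabs s)| <= C * cabs s ^+ 2].
Proof.
move=> sy; have [C C0 hC] := low_sum_le tau_gt0.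
exists ((2 * cabs u + cabs u ^+ 2) * C).
  by rewrite mulr_ge0 ?addr_ge0 ?mulr_ge0 ?exprn_ge0 ?cabs_ge0.
move=> s; rewrite ge_max => /andP[r1 ru].
have ys : cabs (y%:C * s) = cabs s by rewrite cabsM cabs_real is_sign_norm // mul1r.
split=> //; first by apply: le_trans (cabsD _ _) _; rewrite ys; lra.
rewrite -mulrBl normrM (ger0_norm (low_sum_ge0 _ _)).
have -> : re ((u + y%:C * s) ^+ 2) - re (s ^+ 2) = re (2 * u * (y%:C * s) + u ^+ 2).
  have -> : (u + y%:C * s) ^+ 2 = (2 * u * (y%:C * s) + u ^+ 2) + (y%:C * y%:C) * s ^+ 2 by ring.
  have -> : y%:C * y%:C = 1 :> R[i].
    by rewrite -rmorphM; case: sy => ->; rewrite ?mulrNN mul1r.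
  by rewrite mul1r [in LHS]reD addrK.
have h : `|re (2 * u * (y%:C * s) + u ^+ 2)| <= (2 * cabs u + cabs u ^+ 2) * cabs s.
  apply: le_trans (cabs_re _) _; apply: le_trans (cabsD _ _) _.
  rewrite cabsM ys cabsM natC cabs_real (ger0_norm (ler0n _ 2)) cabsX [leRHS]mulrDl lerD2l.
  by rewrite ler_peMr // exprn_ge0 // cabs_ge0.
apply: le_trans (ler_pM (normr_ge0 _) (low_sum_ge0 _ _) h (hC _ r1)) _.
by rewrite le_eqVlt; apply/orP; left; apply/eqP; ring.
Qed.

Lemma growth_double_gamma u y : is_sign y -> growth 1 (fun s => G (u + y%:C * s)).
Proof.
move=> sy c c0; have [C1 C10 h1] := shift_bounds u sy; have [C2 C20 h2] := exponent_le.
have [C3 C30 h3] := barnes_partial_upper tau_gt0.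
exists (C1 + C2 + C3 + 2 / tau); first by rewrite !addr_ge0 ?divr_ge0 // ltW.
exists (Num.max 1 (cabs u)) => s /h1[r1 z2 hre] _; set z := u + _ in z2 hre *.
set r := cabs s in r1 z2 hre *.
(* On the singleton of z the uniform convergence statement reduces to convergence at z, through
   which the bounds on partial products pass to the limit. *)
have bs : cbounded [set z] by exists (cabs z) => _ ->.
have [_ /(_ z erefl) lim] := barnes_limP tau_gt0 bs (papprox_id _).
have b1 := converges_le lim (fun K => h3 r z K r1 z2).
have b2 : cabs (cexp (exponent z)) <= expR (C2 * r ^+ 2).
  by rewrite cabs_cexp ler_expR; apply: le_trans (re_le_cabs _) (h2 r z r1 z2).
have b3 : cabs (z / tau%:C) <= expR (2 / tau * r ^+ 2).
  rewrite cabsM cabsV cabs_real gtr0_norm //.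
  apply: le_trans (_ : 2 / tau * r ^+ 2 <= _).
    have -> : 2 / tau * r ^+ 2 = 2 * r ^+ 2 / tau by ring.
    by rewrite ler_wpM2r ?invr_ge0 ?(ltW tau_gt0) // expr2; nra.
  by apply: le_trans (expR_ge1Dx _); rewrite lerDr.
rewrite double_gammaE 2!cabsM.
have b32 := ler_pM (cabs_ge0 _) (cabs_ge0 _) b3 b2.
apply: le_trans (ler_pM (mulr_ge0 (cabs_ge0 _) (cabs_ge0 _)) (cabs_ge0 _) b32 b1) _.
rewrite -!expRD ler_expR mul1r.
by have := ler_norm (re (z ^+ 2) * A0 r - re (s ^+ 2) * A0 r); rewrite /A0 in hre *; lra.
Qed.

(** If |im s| >= c' |s|, the shift takes at most a quarter off that bound and the modulus at most
    doubles, whence d = c' / 4. Otherwise c' <= 1/2 gives sigma re s >= |s| / 2, which a shift of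
    size at most |s| / 8 cannot make negative. *)
Lemma shift_cone w (c : R) : 0 < c -> exists d : R, 0 < d <= 1 /\ exists R0 : R, forall s,
  R0 <= cabs s -> 0 <= sigma * re s \/ c * cabs s <= `|im s| -> in_cone d (w + sigma%:C * s).
Proof.
move=> c0; pose c' := Num.min c 2^-1.
have c0' : 0 < c' by rewrite lt_min c0 invr_gt0 ltr0n.
have c1' : c' <= 2^-1 by rewrite ge_min lexx orbT.
have cc' : c' <= c by rewrite ge_min lexx. clearbody c'.
exists (c' / 4); split.
  apply/andP; split; first by rewrite divr_gt0.
  lra.
exists (4 * cabs w / c') => s hs sc.
have sn : `|sigma| = 1 := is_sign_norm sigmaE.
have hw : 4 * cabs w <= c' * cabs s by rewrite -ler_pdivrMl // mulrC.
have s0 := cabs_ge0 s; have w0 := cabs_ge0 w.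
have rw := cabs_re w; have iw := cabs_im w.
have [h|h] := leP (c' * cabs s) `|im s|.
- right; have z2 : cabs (w + sigma%:C * s) <= 2 * cabs s.
    by apply: le_trans (cabsD _ _) _; rewrite cabsM cabs_real sn mul1r; nra.
  have : `|im s| - cabs w <= `|im (w + sigma%:C * s)|.
    rewrite !reimE /= mul0r addr0; have := lerB_normD (sigma * im s) (im w).
    by rewrite normrM sn mul1r [sigma * _ + _]addrC; lra.
  have := ler_wpM2l (ltW c0') z2; nra.
- left; case: sc => [sc|sc]; last by have := ler_wpM2r s0 cc'; lra.
  have re_s : `|re s| = sigma * re s by rewrite -[LHS]mul1r -sn -normrM ger0_norm.
  have := cabs_le s; rewrite re_s !reimE /= mul0r subr0.
  have := ler_norm (- re w); rewrite normrN; nra.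
Qed.

Lemma growth_double_gamma_inv w :
  growth (-1) (fun s => (G (w + sigma%:C * s))^-1).
Proof.
move=> c c0; have [C1 C10 h1] := shift_bounds w sigmaE; have [C2 C20 h2] := exponent_le.
have [d [dP [R1 hR1]]] := shift_cone w c0.
have [C3 C30 h3] := barnes_partial_lower tau_gt0 dP.
exists (C1 + C2 + C3 + 2 * tau); first by rewrite !addr_ge0 ?mulr_ge0 // ltW.
exists (Num.max (2 * cabs w) (Num.max R1 (Num.max 1 (cabs w)))) => s.
rewrite ge_max => /andP[ws]; rewrite ge_max => /andP[R1s /h1[r1 z2 hre]] sc.
have zc := hR1 s R1s sc; set z := w + _ in zc z2 hre *.
set r := cabs s in r1 z2 hre ws *.
have sn : `|sigma| = 1 := is_sign_norm sigmaE.
have z1 : r / 2 <= cabs z.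
  have := cabs_dist (sigma%:C * s) (- w); rewrite opprK [_ + w]addrC cabsM cabs_real sn mul1r cabsN -/z -/r.
  by lra.
have dd : 0 < d by case/andP: dP.
have bs : cbounded [set z] by exists (cabs z) => _ ->.
have nz k l : (0 < k + l)%N -> papprox [set z] (fun s => (1 + s / (lattice tau k l)%:C)^-1).
  move=> _; apply: papprox_ext (papprox_cst _ (1 + z / (lattice tau k l)%:C)^-1) => _ ->.
  by [].
have [_ /(_ z erefl) lim] := barnes_lim_invP tau_gt0 bs (papprox_id _) nz.
have b1 := converges_le lim (fun K => h3 r z K r1 z2 zc).
have b2 : cabs (cexp (exponent z))^-1 <= expR (C2 * r ^+ 2).
  rewrite -cexpN cabs_cexp ler_expR; apply: le_trans (re_le_cabs _) _.
  by rewrite cabsN; exact: h2.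
have b3 : cabs (z / tau%:C)^-1 <= expR (2 * tau * r ^+ 2).
  rewrite cabsV cabsM cabsV cabs_real gtr0_norm // invfM invrK.
  have r0 : 0 < r by lra.
  have zi : (cabs z)^-1 <= 2.
    by rewrite invf_ple ?posrE //; lra.
  apply: le_trans (_ : 2 * tau * r ^+ 2 <= _).
    apply: le_trans (ler_wpM2r (ltW tau_gt0) zi) _.
    by rewrite ler_peMr ?mulr_ge0 ?(ltW tau_gt0) // exprn_ege1.
  by apply: le_trans (expR_ge1Dx _); rewrite lerDr.
rewrite double_gammaE 2!invfM 2!cabsM.
have b32 := ler_pM (cabs_ge0 _) (cabs_ge0 _) b3 b2.
apply: le_trans (ler_pM (mulr_ge0 (cabs_ge0 _) (cabs_ge0 _)) (cabs_ge0 _) b32 b1) _.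
rewrite -!expRD ler_expR mulN1r.
have := ler_norm (- (re (z ^+ 2) * A0 r - re (s ^+ 2) * A0 r)); rewrite normrN /A0 in hre *.
lra.
Qed.

(** Where Re(s^2) >= c |s|^2 the exponent is at most (k c A + C) |s|^2, and A exceeds (C + 1) / (- k
    c) far out. *)
Lemma growth_decay k g : k < 0 -> growth k g ->
  forall c : R, 0 < c -> exists R0 : R, forall s, R0 <= cabs s ->
  c * cabs s ^+ 2 <= re (s ^+ 2) -> 0 <= sigma * re s \/ c * cabs s <= `|im s| ->
  cabs (g s) <= expR (- cabs s ^+ 2).
Proof.
move=> k0 gg c c0; have [C C0 [R0 h]] := gg c c0.
have [R1 hR1] := low_sum_unbounded tau_gt0 ((C + 1) / (- k * c)).
exists (Num.max R0 R1) => s; rewrite ge_max => /andP[r0 r1] sq sc.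
apply: le_trans (h s r0 sc) _; rewrite ler_expR.
have := hR1 _ r1; rewrite -/(A0 _) ler_pdivrMr ?mulr_gt0 ?oppr_gt0 // => hA.
have A0' : 0 <= A0 (cabs s) by exact: low_sum_ge0.
have := ler_wpM2r A0' sq; have := exprn_ge0 2 (cabs_ge0 s).
move: (re (s ^+ 2)) (A0 (cabs s)) (cabs s ^+ 2) hA A0' => x a y hA A0' y0 h1.
have h2 : k * (x * a) <= k * (c * y * a) by rewrite ler_wnM2l // ltW.
have h3 := ler_wpM2r y0 hA.
apply: le_trans (lerD h2 (lexx _)) _; lra.
Qed.

End DoubleGammaGrowth.

(** * From the growth bounds to the contour integrals *)

Section Assembly.
Context {R : realType}.
Implicit Types (s z w p : R[i]) (f : R[i] -> R[i]) (Lam Lp Lm : set R[i]).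

(** d0 has both rays on the pole-free side sigma, d1 both on the other side. Each value is read off
    from one reference curve of angle pi / 8. *)
Lemma contour_values (sigma B : R) f Lam Lp Lm (d0 d1 : direction) :
  start_sign d0 = sigma -> end_sign d0 = sigma ->
  start_sign d1 = - sigma -> end_sign d1 = - sigma ->
  (sigma = 1 /\ Lam = Lm /\ Lp = set0) \/ (sigma = -1 /\ Lam = Lp /\ Lm = set0) ->
  (forall c : R, 0 < c -> exists R0 : R, forall s, R0 <= cabs s ->
    c * cabs s ^+ 2 <= re (s ^+ 2) -> 0 <= sigma * re s \/ c * cabs s <= `|im s| ->
    cabs (f s) <= expR (- cabs s ^+ 2)) ->
  (forall K : set R[i], cbounded K ->
    (forall p, Lam p -> papprox K (fun s => (s - p)^-1)) -> papprox K f) ->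
  0 <= B -> (forall p, Lam p -> `|im p| <= B) -> (forall p, Lam p -> sigma * re p <= B) ->
  (forall X : R, exists l : seq R[i], forall p, Lam p -> - X <= sigma * re p -> p \in l) ->
  exists v : direction -> R[i],
    [/\ forall d eps, 0 < eps < pi / 4 ->
          exists gam, admissible_curve Lp Lm (angle_start d eps) (angle_end d eps) gam,
        forall d eps gam, 0 < eps < pi / 4 ->
          admissible_curve Lp Lm (angle_start d eps) (angle_end d eps) gam ->
          is_line_integral f gam (v d),
        v d0 = 0
      & v Upward + v Downward = v d1].
Proof.
move=> s0 e0 s1 e1 sL f_decay f_approx B0 strip left fin.
have sE : sigma = 1 \/ sigma = -1 by case: sL => [[? _]|[? _]]; [left|right].
have sL' : (sigma = 1 /\ Lam = Lm) \/ (sigma = -1 /\ Lam = Lp).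
  by case: sL => [[? [? _]]|[? [? _]]]; [left|right].
have adm d eps : 0 < eps < pi / 4 ->
    exists gam, admissible_curve Lp Lm (angle_start d eps) (angle_end d eps) gam.
  by move=> epsP; eexists; exact: two_ray_path_admissible sL B0 strip left epsP.
have pi8 : 0 < (pi / 8 : R) < pi / 4.
  by have := @pi_gt0 R => ?; apply/andP; split; lra.
pose g d := projT1 (cid (adm d _ pi8)).
have gP d : two_ray_curve sigma Lam (start_sign d) (end_sign d) (pi / 8) (g d) (curve_deriv (g d)).
  by apply: admissible_two_ray sL' _; rewrite /g; case: cid.
exists (fun d => cint setT (fun t => f (g d t) * curve_deriv (g d) t)); split; first exact: adm.
- move=> d eps gam epsP /(admissible_two_ray sL') gamP.
  have [i1 i2] := curve_integrable sE f_decay f_approx B0 strip fin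
    (start_signP d) (end_signP d) epsP gamP.
  split; [exact: i1|exact: i2|].
  exact: (two_ray_integral_unique sE f_decay f_approx B0 strip fin
    (start_signP d) (end_signP d) pi8 epsP (gP d) gamP).
- have gP0 := gP d0; rewrite s0 e0 in gP0.
  exact: (corner_integral_vanishes sE f_decay f_approx B0 strip fin pi8 gP0).
- have gP0 := gP d0; rewrite s0 e0 in gP0.
  have gP1 := gP d1; rewrite s1 e1 in gP1.
  exact: (corner_integral_additive sE f_decay f_approx B0 strip fin pi8 pi8 pi8 pi8
    (gP Upward) (gP Downward) gP0 gP1).
Qed.

(** The zeros are the points - sigma w_j moved by a non-negative real number in the direction -
    sigma. In a bounded part both k and l are bounded, since c k and c l are at most k tau + l with
    c = min(1, tau). *)
Lemma gamma_zero_geometry (tau sigma : R) (N : nat) (w : 'I_N -> R[i]) Lam :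
  0 < tau -> is_sign sigma ->
  (forall p, Lam p -> exists j k l, p = gamma_zero tau sigma (w j) k l) ->
  exists2 B : R, 0 <= B &
    [/\ forall p, Lam p -> `|im p| <= B, forall p, Lam p -> sigma * re p <= B
      & forall X : R, exists l : seq R[i], forall p, Lam p -> - X <= sigma * re p -> p \in l].
Proof.
move=> tau0 sP hL; pose B : R := \sum_j cabs (w j).
have wB j : cabs (w j) <= B by rewrite /B (bigD1 j) //= lerDl sumr_ge0 // => i _; exact: cabs_ge0.
have B0 : 0 <= B by rewrite sumr_ge0 // => i _; exact: cabs_ge0.
have s2 : sigma * sigma = 1 by case: sP => ->; rewrite ?mulrNN mul1r.
have lat k l : 0 <= lattice tau k l by rewrite addr_ge0 ?mulr_ge0 ?ler0n // ltW.
have reE j k l : sigma * re (gamma_zero tau sigma (w j) k l) = - re (w j) - lattice tau k l.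
  rewrite /gamma_zero !reimE /= oppr0 mul0r subr0 mulNr mulrN mulrA s2; ring.
have imE j k l : `|im (gamma_zero tau sigma (w j) k l)| = `|im (w j)|.
  by rewrite /gamma_zero !reimE /= oppr0 mul0r addr0 addr0 normrM normrN (is_sign_norm sP) mul1r.
have reB j : - re (w j) <= B.
  by apply: le_trans (wB j); apply: le_trans (cabs_re _); rewrite -normrN ler_norm.
exists B => //; split.
- by move=> p /hL[j [k [l ->]]]; rewrite imE; apply: le_trans (cabs_im _) (wB j).
- by move=> p /hL[j [k [l ->]]]; rewrite reE; have := reB j; have := lat k l; lra.
- move=> X; pose c : R := Num.min 1 tau.
  have c0 : 0 < c by rewrite lt_min ltr01.
  have cE : c <= 1 /\ c <= tau by rewrite /c !ge_min !lexx orbT.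
  pose M := (Num.bound ((`|B| + `|X|) / c)).+1.
  have M0 : 0 <= (`|B| + `|X|) / c by rewrite divr_ge0 ?addr_ge0 // ltW.
  exists [seq gamma_zero tau sigma (w x.1) x.2.1 x.2.2 | x <- [seq (j, y) | j <- enum 'I_N,
    y <- [seq (k, l) | k <- iota 0 M, l <- iota 0 M]]].
  move=> p /hL[j [k [l ->]]]; rewrite reE => hX.
  have hl : lattice tau k l <= `|B| + `|X|.
    by have := reB j; have := ler_norm B; have := ler_norm X; lra.
  have small (i : nat) : c * i%:R <= lattice tau k l -> (i < M)%N.
    move=> ci; rewrite ltnS -(ler_nat R); apply: le_trans (ltW (archi_boundP M0)).
    by rewrite ler_pdivlMr // mulrC; exact: le_trans ci hl.
  have k0 : 0 <= k%:R :> R by rewrite ler0n.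
  have l0 : 0 <= l%:R :> R by rewrite ler0n.
  have kM : (k < M)%N by apply: small; rewrite /lattice; case: cE => ? ?; nra.
  have lM : (l < M)%N by apply: small; rewrite /lattice; case: cE => ? ?; nra.
  apply/mapP; exists (j, (k, l)) => //; apply/allpairsPdep; exists j, (k, l); split => //.
    by rewrite mem_enum.
  by apply/allpairsPdep; exists k, l; rewrite !mem_iota !add0n.
Qed.

Lemma sum_ord_lt (q m : nat) (x : R) : (m <= q)%N -> \sum_(j < q | (j < m)%N) x = m%:R * x.
Proof.
by move=> mq; rewrite (big_ord_narrow mq) sumr_const card_ord mulr_natl.
Qed.

Lemma sum_ord_ge (q m : nat) (x : R) : (m <= q)%N -> \sum_(j < q | (m <= j)%N) x = (q - m)%:R * x.
Proof.
move=> mq; have h : \sum_(j < q) x = \sum_(j < q | (j < m)%N) x + \sum_(j < q | (m <= j)%N) x.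
  rewrite (bigID (fun j : 'I_q => (j < m)%N)) /=; congr (_ + _).
  by apply: eq_bigl => j; rewrite -leqNgt.
move: h; rewrite sumr_const card_ord sum_ord_lt // => h.
by rewrite natrB // mulrBl [q%:R * x]mulr_natl h addrC addKr.
Qed.

Section Integrand.
Variables (tau : R) (m n p q : nat) (a : 'I_p -> R[i]) (b : 'I_q -> R[i]).
Variables (alpha logz : R[i]) (G : R[i] -> R[i]) (c1 c2 sigma : R).
Hypotheses (tau_gt0 : 0 < tau) (le_m_q : (m <= q)%N) (le_n_p : (n <= p)%N).
Hypothesis GE : forall z, G z = barnes_product tau c1 c2 z.
Hypothesis N_lt0 : fox_index m n p q < 0.
Hypothesis sigmaP : is_sign sigma.
Hypothesis b_side : forall j : 'I_q, (m <= j)%N -> sigma = 1.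
Hypothesis a_side : forall j : 'I_p, (n <= j)%N -> sigma = -1.

Definition integrand s : R[i] := phi tau m n a b G alpha s * cexp (- s * logz).

Let expo s : R[i] := (pi%:C * alpha / tau%:C) * s ^+ 2 + - logz * s.

(** [b_side] and [a_side] exclude each other, so at least one of the two denominators is an empty
    product and both can be written with the same sign sigma. *)
Let factors s : R[i] :=
  cexp (expo s) *
  (\prod_(j < q | (j < m)%N) G (b j + (-1)%:C * s) *
   \prod_(j < p | (j < n)%N) G (1 + tau%:C - a j + 1%:C * s) *
   (\prod_(j < q | (m <= j)%N) (G (1 + tau%:C - b j + sigma%:C * s))^-1 *
    \prod_(j < p | (n <= j)%N) (G (a j + sigma%:C * s))^-1)).

Lemma integrandE s : integrand s = factors s.
Proof.
rewrite /integrand /phi /calG /factors invfM -!prodfV.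
have E1 j : G (b j - s) = G (b j + (-1)%:C * s) by rewrite rmorphN mulN1r.
under [\prod_(j < q | (j < m)%N) G (b j - s)]eq_bigr => j _ do rewrite E1.
have E2 j : G (1 + tau%:C - a j + s) = G (1 + tau%:C - a j + 1%:C * s) by rewrite mul1r.
under [\prod_(j < p | (j < n)%N) G (_ + s)]eq_bigr => j _ do rewrite E2.
have -> : \prod_(j < q | (m <= j)%N) (G (1 + tau%:C - b j + s))^-1 =
    \prod_(j < q | (m <= j)%N) (G (1 + tau%:C - b j + sigma%:C * s))^-1.
  by apply: eq_bigr => j /b_side ->; rewrite mul1r.
have -> : \prod_(j < p | (n <= j)%N) (G (a j - s))^-1 =
    \prod_(j < p | (n <= j)%N) (G (a j + sigma%:C * s))^-1.
  by apply: eq_bigr => j /a_side ->; rewrite rmorphN mulN1r.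
have -> : cexp (expo s) = cexp (pi%:C * alpha * s ^+ 2 / tau%:C) * cexp (- s * logz).
  by rewrite -cexpD /expo; congr cexp; ring.
ring.
Qed.

Lemma integrand_decay (c : R) : 0 < c -> exists R0 : R, forall s, R0 <= cabs s ->
  c * cabs s ^+ 2 <= re (s ^+ 2) -> 0 <= sigma * re s \/ c * cabs s <= `|im s| ->
  cabs (integrand s) <= expR (- cabs s ^+ 2).
Proof.
(* The value is N: the m + n numerators count 1 each, the (q - m) + (p - n) denominators -1 each,
   and the exponential of a quadratic polynomial counts 0. *)
pose k : R := 0 + (m%:R + n%:R + (- (q - m)%:R - (p - n)%:R)).
have k0 : k < 0.
  have h : (m + n + (m + n) < p + q)%N by move: N_lt0; rewrite /fox_index; lia.
  rewrite /k !natrB // add0r.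
  have : (m + n + (m + n))%:R < (p + q)%:R :> R by rewrite ltr_nat.
  by rewrite !natrD; lra.
suff gr : growth tau sigma k integrand by exact: (growth_decay tau_gt0 k0 gr).
have e : forall s, factors s = integrand s by move=> s; rewrite integrandE.
apply: growth_ext e _; apply: growthM.
  apply: (@growth_cexp _ _ _ _ (cabs (pi%:C * alpha / tau%:C) + cabs logz)).
    by rewrite addr_ge0 ?cabs_ge0.
  move=> s s1; apply: le_trans (cabsD _ _) _; rewrite cabsM cabsX [cabs (- logz * _)]cabsM cabsN [leRHS]mulrDl lerD2l.
  by rewrite ler_wpM2l ?cabs_ge0 // expr2 ler_peMl ?cabs_ge0.
have ms : m%:R = \sum_(j < q | (j < m)%N) (1 : R) by rewrite sum_ord_lt ?mulr1.
have ns : n%:R = \sum_(j < p | (j < n)%N) (1 : R) by rewrite sum_ord_lt ?mulr1.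
have qs : - (q - m)%:R = \sum_(j < q | (m <= j)%N) (-1 : R) by rewrite sum_ord_ge ?mulrN1.
have ps : - (p - n)%:R = \sum_(j < p | (n <= j)%N) (-1 : R) by rewrite sum_ord_ge ?mulrN1.
apply: growthM; first apply: growthM.
- rewrite ms; apply: growth_prod => j _; apply: (growth_double_gamma tau_gt0 GE); by right.
- rewrite ns; apply: growth_prod => j _; apply: (growth_double_gamma tau_gt0 GE); by left.
- apply: growthM.
  + rewrite qs; apply: growth_prod => j _; exact: (growth_double_gamma_inv tau_gt0 GE sigmaP).
  + rewrite ps; apply: growth_prod => j _; exact: (growth_double_gamma_inv tau_gt0 GE sigmaP).
Qed.

Lemma integrand_papprox (K : set R[i]) : cbounded K ->
  (forall (j : 'I_q) k l, (m <= j)%N ->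
    papprox K (fun s => (s - gamma_zero tau sigma (1 + tau%:C - b j) k l)^-1)) ->
  (forall (j : 'I_p) k l, (n <= j)%N ->
    papprox K (fun s => (s - gamma_zero tau sigma (a j) k l)^-1)) ->
  papprox K integrand.
Proof.
move=> bK hb ha; have e : forall s, K s -> factors s = integrand s by move=> s _; rewrite integrandE.
apply: papprox_ext e _.
have lin (y : R) u : papprox K (fun s => u + y%:C * s).
  by apply: papproxD; [exact: papprox_cst|apply: papproxZ => //; exact: papprox_id].
apply: papproxM => //.
  apply: papprox_cexp => //; apply: papproxD; apply: papproxZ => //; last exact: papprox_id.
  exact: papproxX (papprox_id K).
apply: papproxM => //; first apply: papproxM => //.
- by apply: papprox_prod => // j _; apply: (double_gamma_papprox tau_gt0 GE).
- by apply: papprox_prod => // j _; apply: (double_gamma_papprox tau_gt0 GE).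
- apply: papproxM => //.
  + by apply: papprox_prod => // j mj; apply: (double_gamma_inv_papprox tau_gt0 GE sigmaP) => // k l; exact: hb.
  + by apply: papprox_prod => // j nj; apply: (double_gamma_inv_papprox tau_gt0 GE sigmaP) => // k l; exact: ha.
Qed.

End Integrand.

End Assembly.

Theorem theorem7p1 (R : realType) (tau : R) (m n p q : nat)
    (a : 'I_p -> R[i]) (b : 'I_q -> R[i]) (alpha : R[i]) (G : R[i] -> R[i])
    (tau_gt0 : 0 < tau) (le_m_q : (m <= q)%N) (le_n_p : (n <= p)%N)
    (G_double_gamma : is_double_gamma tau G)
    (N_lt0 : fox_index m n p q < 0)
    (lt_lambda : (lambda_sharp tau m b < lambda_flat n a)%E)
    (H_arc : arc_hypothesis (sine_quotient tau m n a b G)) :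
  (n = p ->
     forall logz : R[i],
       is_K tau m n a b G alpha Rightward logz 0 /\
       exists Kup Kdown Kleft : R[i],
         [/\ is_K tau m n a b G alpha Upward logz Kup,
             is_K tau m n a b G alpha Downward logz Kdown,
             is_K tau m n a b G alpha Leftward logz Kleft
           & Kup + Kdown = Kleft]) /\
  (m = q ->
     forall logz : R[i],
       is_K tau m n a b G alpha Leftward logz 0 /\
       exists Kup Kdown Kright : R[i],
         [/\ is_K tau m n a b G alpha Upward logz Kup,
             is_K tau m n a b G alpha Downward logz Kdown,
             is_K tau m n a b G alpha Rightward logz Kright
           & Kup + Kdown = Kright]).
Proof.
have [c1 [c2 [GE _ _]]] := G_double_gamma.
have concl (logz : R[i]) (d0 d1 : direction) :
    (exists v : direction -> R[i],
    [/\ forall d eps, 0 < eps < pi / 4 ->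
          exists gam, admissible_curve (Lambda_plus tau n a) (Lambda_minus tau m b)
            (angle_start d eps) (angle_end d eps) gam,
        forall d eps gam, 0 < eps < pi / 4 ->
          admissible_curve (Lambda_plus tau n a) (Lambda_minus tau m b)
            (angle_start d eps) (angle_end d eps) gam ->
          is_line_integral (integrand tau m n a b alpha logz G) gam (v d),
        v d0 = 0
      & v Upward + v Downward = v d1]) ->
    is_K tau m n a b G alpha d0 logz 0 /\
    exists Kup Kdown K1 : R[i],
      [/\ is_K tau m n a b G alpha Upward logz Kup,
          is_K tau m n a b G alpha Downward logz Kdown,
          is_K tau m n a b G alpha d1 logz K1 & Kup + Kdown = K1].
  move=> [v [ex int v0 vE]].
  have K d : is_K tau m n a b G alpha d logz (v d / (0 +i* (2 * pi))).
    move=> eps epsP; split; first exact: ex.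
    by move=> gam gamP; exists (v d) => //; exact: int epsP gamP.
  split; first by have := K d0; rewrite v0 mul0r.
  exists (v Upward / (0 +i* (2 * pi))), (v Downward / (0 +i* (2 * pi))), (v d1 / (0 +i* (2 * pi))).
  by split; rewrite // -mulrDl vE.
split=> [np|mq] logz; apply: concl.
- have s1 : is_sign (1 : R) by left.
  have a_side (j : 'I_p) : (n <= j)%N -> 1 = -1 :> R.
    by rewrite np leqNgt ltn_ord.
  (* The indices in [Lambda_minus] start at 1, those of [gamma_zero] at 0; the shift 1 + tau in the
     argument of G makes up for the difference. *)
  have zeros s : Lambda_minus tau m b s -> exists j k l, s = gamma_zero tau 1 (1 + tau%:C - b j) k l.
    move=> [j [[|l] [[|k] [_ l0 k0 ->]]]] //; exists j, l, k.
    rewrite /gamma_zero /lattice -!natr1; apply: complex_ext; rewrite !reimE /=; ring.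
  have [B B0 [g1 g2 g3]] := gamma_zero_geometry tau_gt0 s1 zeros.
  apply: (@contour_values _ 1 B _ (Lambda_minus tau m b)) => //.
  + left; split=> //; split=> //; apply/seteqP; split=> // s [j [l [k [nj _]]]].
    by move: nj; rewrite np leqNgt ltn_ord.
  + by move=> c c0; apply: (@integrand_decay R tau m n p q a b alpha logz G c1 c2 1).
  + move=> K bK hK; apply: (@integrand_papprox R tau m n p q a b alpha logz G c1 c2 1) => //.
    * move=> j k l mj; apply: hK; exists j, k.+1, l.+1; split => //.
      rewrite /gamma_zero /lattice -!natr1; apply: complex_ext; rewrite !reimE /=; ring.
    * by move=> j k l; rewrite np leqNgt ltn_ord.
- have s1 : is_sign (-1 : R) by right.
  have b_side (j : 'I_q) : (m <= j)%N -> -1 = 1 :> R.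
    by rewrite mq leqNgt ltn_ord.
  have zeros s : Lambda_plus tau n a s -> exists j k l, s = gamma_zero tau (-1) (a j) k l.
    move=> [j [l [k [_ ->]]]]; exists j, l, k.
    by rewrite /gamma_zero /lattice rmorphN opprK mul1r.
  have [B B0 [g1 g2 g3]] := gamma_zero_geometry tau_gt0 s1 zeros.
  apply: (@contour_values _ (-1) B _ (Lambda_plus tau n a)) => //.
  + by rewrite opprK.
  + by rewrite opprK.
  + right; split=> //; split=> //; apply/seteqP; split=> // s [j [l [k [mj _ _ _]]]].
    by move: mj; rewrite mq leqNgt ltn_ord.
  + by move=> c c0; apply: (@integrand_decay R tau m n p q a b alpha logz G c1 c2 (-1)).
  + move=> K bK hK; apply: (@integrand_papprox R tau m n p q a b alpha logz G c1 c2 (-1)) => //.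
    * by move=> j k l; rewrite mq leqNgt ltn_ord.
    * move=> j k l nj; apply: hK; exists j, k, l; split => //.
      by rewrite /gamma_zero /lattice rmorphN opprK mul1r.
Qed.
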